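(* Let $\tau\in\mathbb{C}$ with $\mathrm{Im}(\tau)>0$, $q=e^{2\pi i\tau}$, $u,v,\alpha\in\mathbb{C}$, and put $x=e^{2\pi iu}$, $y=e^{2\pi iv}$, $a=q^{\alpha}=e^{2\pi i\alpha\tau}$, $(x/y)^{\alpha/2}=e^{\pi i\alpha(u-v)}$. Assume that none of $x,\ y,\ x/a,\ y/a,\ xy/a$ is an integer power of $q$. Then the generalized Zwegers $\mu$-function satisfies $$ \mu(x,y;a)=-iq^{-\frac18}\Big(\frac{x}{y}\Big)^{\frac{\alpha}{2}}\frac{(x,y,aq/x,aq/y)_\infty}{(q)_\infty\theta(y)\theta(x/a)\theta(xy/aq)}\Big(1-\frac{xy}{aq}\Big)\;{}_{4}\psi_{8}\!\left(\begin{matrix}\sqrt{\frac{qxy}{a}},-\sqrt{\frac{qxy}{a}},x/a,y/a\\ \sqrt{\frac{xy}{aq}},-\sqrt{\frac{xy}{aq}},y,x,0,0,0,0\end{matrix};q,\frac{x^2y^2}{aq}\right) $$ $$ =-iq^{-\frac18}\Big(\frac{x}{y}\Big)^{\frac{\alpha}{2}}\frac{(x,y,aq/x,aq/y)_\infty}{(q)_\infty\theta(y)\theta(x/a)\theta(xy/aq)}\sum_{n\in\mathbb{Z}}\Big(1-\frac{xy}{a}q^{2n-1}\Big)\frac{(x/a,y/a)_n}{(x,y)_n}q^{2n^2-3n}\Big(\frac{x^2y^2}{a}\Big)^{n}. $$ In the case $a=q$ (i.e. $\alpha=1$), if none of $x,y,xy$ is an integer power of $q$, then with $\mu(x,y)=\mu(u,v)$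 the original Zwegers $\mu$-function and $\sqrt{xy}=e^{\pi i(u+v)}$ in the prefactors, $$ \mu(x,y)=iq^{-\frac18}\frac{\sqrt{xy}}{\left(1-\frac{x}{q}\right)(q-y)}\frac{1}{(q)_\infty\theta(xy/q^2)}\Big(1-\frac{xy}{q^2}\Big)\;{}_{4}\psi_{8}\!\left(\begin{matrix}\sqrt{xy},-\sqrt{xy},x/q,y/q\\ \frac{\sqrt{xy}}{q},-\frac{\sqrt{xy}}{q},y,x,0,0,0,0\end{matrix};q,\frac{x^2y^2}{q^2}\right) $$ $$ =iq^{-\frac18}\frac{\sqrt{xy}}{(q)_\infty\theta(xy)}\sum_{n\in\mathbb{Z}}\frac{1-xyq^{2n}}{(1-xq^n)(1-yq^n)}x^{2n}y^{2n}q^{2n^2} $$ $$ =iq^{-\frac18}\frac{\sqrt{xy}}{(q)_\infty\theta(xy)}\left\{\sum_{n\in\mathbb{Z}}\frac{x^{2n}y^{2n}q^{2n^2}}{(1-xq^n)(1-yq^n)}-\sum_{n\in\mathbb{Z}}\frac{x^{-2n}y^{-2n}q^{2n^2}}{(1-x^{-1}q^n)(1-y^{-1}q^n)}\right\}. $$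
   Context: Notation. $q=e^{2\pi i\tau}$ with $\mathrm{Im}(\tau)>0$, and $q^{s}:=e^{2\pi i\tau s}$ for complex $s$. $(z)_\infty=(z;q)_\infty:=\prod_{j\ge0}(1-zq^{j})$; $(z)_n:=(z)_\infty/(q^{n}z)_\infty$ for $n\in\mathbb{Z}$; $(z_1,\dots,z_r)_n:=(z_1)_n\cdots(z_r)_n$ for $n\in\mathbb{Z}\cup\{\infty\}$. $\theta(z):=(z,q/z)_\infty$. The bilateral basic hypergeometric series is $${}_r\psi_s\!\left(\begin{matrix}a_1,\dots,a_r\\ b_1,\dots,b_s\end{matrix};q,z\right):=\sum_{n\in\mathbb{Z}}\frac{(a_1,\dots,a_r)_n}{(b_1,\dots,b_s)_n}\left((-1)^nq^{\frac{n(n-1)}{2}}\right)^{s-r}z^n .$$ In the ${}_4\psi_8$ series, the square roots in the upper and lower parameters are chosen compatibly ($\sqrt{qxy/a}=q\sqrt{xy/(aq)}$); the value does not depend on the choice. The theta function is $\vartheta_{11}(u):=\sum_{n\in\mathbb{Z}}e^{2\pi i(n+\frac12)(u+\frac12)+\pi i(n+\frac12)^2\tau}=-iq^{\frac18}e^{-\pi iu}(q,e^{2\pi iu},qe^{-2\pi iu})_\infty$. The generalized Zwegers $\mu$-function is $$ \mu(x,y;a)=\mu(u,v;\alpha):=\frac{e^{\pi i\alpha(u-v)}}{\vartheta_{11}(v)}\sum_{n\in\mathbb{Z}}(-1)^{n}e^{2\pi i(n+\frac12)v}q^{\frac{n(n+1)}{2}}\frac{(e^{2\pi iu}q^{n+1})_\infty}{(e^{2\pi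 iu}q^{n-\alpha+1})_\infty}, $$ where $x=e^{2\pi iu}$, $y=e^{2\pi iv}$, $a=q^{\alpha}=e^{2\pi i\alpha\tau}$. For $\alpha=1$ it is the original Zwegers $\mu$-function $$ \mu(u,v)=\frac{e^{\pi iu}}{\vartheta_{11}(v)}\sum_{n\in\mathbb{Z}}\frac{(-1)^ne^{2\pi inv}q^{\frac{n(n+1)}{2}}}{1-e^{2\pi iu}q^n},\qquad u,v\in\mathbb{C}\setminus(\mathbb{Z}+\mathbb{Z}\tau), $$ also written $\mu(x,y)$. *)

(* Defs.v *)
From Stdlib Require Import Reals ZArith List.
From Coquelicot Require Import Coquelicot.
Import ListNotations.

Open Scope C_scope.

(* [iota] picks the point characterised by the predicate (as in Coquelicot's
   [RInt]); the value is meaningful only when the limit exists. *)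
Definition Clim (u : nat -> C) : C :=
  @iota C_R_CompleteNormedModule
    (fun l => filterlim u eventually (@locally C_UniformSpace l)).

Lemma Clim_correct (u : nat -> C) (l : C) :
  filterlim u eventually (@locally C_UniformSpace l) -> Clim u = l.
Proof.
exact (@iota_filterlim_locally R_AbsRing C_R_CompleteNormedModule
         nat eventually _ u l).
Qed.

Fixpoint Cprod (f : nat -> C) (n : nat) : C :=
  match n with
  | O => 1
  | S m => Cprod f m * f m
  end.

(* The two halves [n >= 0] and [n < 0] are required to converge separately. *)
Definition is_zseries (f : Z -> C) (s : C) : Prop :=
  exists s1 s2 : C,
    @is_series R_AbsRing C_R_NormedModule (fun n => f (Z.of_nat n)) s1 /\
    @is_series R_AbsRing C_R_NormedModule (fun n => f (- Z.of_nat (S n))%Z) s2 /\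
    s = s1 + s2.

Definition ex_zseries (f : Z -> C) : Prop := exists s : C, is_zseries f s.

(* Meaningful only when [ex_zseries f] holds. *)
Definition ZSeries (f : Z -> C) : C :=
  @iota C_R_CompleteNormedModule (is_zseries f).

Lemma is_zseries_unique (f : Z -> C) (s : C) :
  is_zseries f s -> ZSeries f = s.
Proof.
intros H; apply (@iota_unique R_AbsRing C_R_CompleteNormedModule); [|exact H].
destruct H as (s1 & s2 & H1 & H2 & ->).
intros y (t1 & t2 & K1 & K2 & ->).
rewrite (filterlim_locally_unique _ _ _ K1 H1).
now rewrite (filterlim_locally_unique _ _ _ K2 H2).
Qed.

Definition cexp (z : C) : C :=
  ((exp (Re z) * cos (Im z))%R, (exp (Re z) * sin (Im z))%R).

Definition Cpowz (z : C) (n : Z) : C :=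
  match n with
  | Z0 => 1
  | Zpos p => z ^ Pos.to_nat p
  | Zneg p => / z ^ Pos.to_nat p
  end.

Notation "z ^^ n" := (Cpowz z n%Z) (at level 30, right associativity) : C_scope.

(* [q^s] for complex [s]; it depends on [tau], not only on [q]. *)
Definition qpow (tau s : C) : C := cexp (2 * PI * Ci * tau * s).

Definition nome (tau : C) : C := qpow tau 1.

Definition is_qpower (q z : C) : Prop := exists n : Z, z = q ^^ n.

Definition qpoch_inf (q z : C) : C :=
  Clim (Cprod (fun j => 1 - z * q ^ j)).

Definition qpoch (q z : C) (n : Z) : C :=
  qpoch_inf q z / qpoch_inf q (q ^^ n * z).

Definition qpochs_inf (q : C) (zs : list C) : C :=
  fold_right Cmult 1 (map (qpoch_inf q) zs).

Definition qpochs (q : C) (zs : list C) (n : Z) : C :=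
  fold_right Cmult 1 (map (fun z => qpoch q z n) zs).

Definition qtheta (q z : C) : C := qpochs_inf q [z; q / z].

(* The numbers of parameters [r] and [s] are the lengths of the two lists; the
   integer division by 2 is exact. *)
Definition psi_term (q : C) (al bl : list C) (z : C) (n : Z) : C :=
  qpochs q al n / qpochs q bl n
  * ((-1) ^^ n * q ^^ (n * (n - 1) / 2))
      ^^ (Z.of_nat (length bl) - Z.of_nat (length al))
  * z ^^ n.

Definition psi (q : C) (al bl : list C) (z : C) : C :=
  ZSeries (psi_term q al bl z).

Definition vartheta11 (tau u : C) : C :=
  ZSeries (fun n =>
    cexp (2 * PI * Ci * (IZR n + / 2) * (u + / 2)
          + PI * Ci * (IZR n + / 2) ^ 2 * tau)).

Definition gen_mu (tau u v alpha : C) : C :=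
  let q := nome tau in
  let x := cexp (2 * PI * Ci * u) in
  cexp (PI * Ci * alpha * (u - v)) / vartheta11 tau v
  * ZSeries (fun n =>
      (-1) ^^ n * cexp (2 * PI * Ci * (IZR n + / 2) * v)
      * q ^^ (n * (n + 1) / 2)
      * (qpoch_inf q (x * q ^^ (n + 1))
         / qpoch_inf q (x * qpow tau (IZR n - alpha + 1)))).

Definition zwegers_mu (tau u v : C) : C :=
  let q := nome tau in
  let x := cexp (2 * PI * Ci * u) in
  cexp (PI * Ci * u) / vartheta11 tau v
  * ZSeries (fun n =>
      (-1) ^^ n * cexp (2 * PI * Ci * IZR n * v) * q ^^ (n * (n + 1) / 2)
      / (1 - x * q ^^ n)).

(* Main.v *)
(* Write P(z) = (z;q)_oo, A = xy/(aq) and T_n = q^(n(n-1)/2). After the shift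
   n -> n - 1 the function mu is, up to elementary factors, the series
     L = sum_n (-y)^n T_n P(x q^n) / P(x q^n / a),
   and the claim becomes theta(y/a) S = theta(A) L, where
     S = sum_n (1 - A q^(2n)) T_n^4 q^(-n) (x^2 y^2 / a)^n
               P(x q^n) P(y q^n) / (P(x q^n / a) P(y q^n / a)).
   This is a bilateral Bailey transformation. In the double series [double_term]
   over n and m the sum over m is a 1phi1 sum and gives the n-th term of P(q) S;
   the sum over n is, read backwards from n = m, a limiting case of the very well
   poised 6phi5 sum and gives the m-th term of P(q) theta(A) / theta(y/a) L.
   Both summation formulas follow from a telescoping first order recurrence in one
   parameter, iterated until that parameter tends to 0. The 1phi1 sum also yields
   the Jacobi triple product, which evaluates vartheta_11. *)

Require Import Defs.
From Stdlib Require Import Reals ZArith List Lia Lra.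
From Coquelicot Require Import Coquelicot.
Import ListNotations.

Open Scope C_scope.

(** The analytic obstacle is the interchange of the two summations: factors such as (x q^n)_oo grow
    like |q|^(-n^2/2) as n tends to -oo, and only the whole product decays. Sizes are therefore
    recorded as exponents of |q|, which add up under multiplication, and absolute convergence of the
    double series becomes positivity of one piecewise quadratic form in n and m. The indices are
    coupled only through the Bailey kernel 1/((q)_(m-n) (A q)_(m+n)). With w = x/a and c = y/a, the
    relation x c = y w is what lets the same kernel serve both summation formulas; since 1/(q)_(m-n)
    vanishes for n > m, both inner sums are one-sided. The excluded powers of q keep the
    denominators and the values of theta that get divided by away from 0. Since [Clim] and [ZSeries]
    are meaningful only when the limit exists, identities between bilateral series are stated with
    [is_zseries f s], which carries convergence together with the value. *)

(** * Limits of complex sequences, measured by the modulus *)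

Definition is_Clim (u : nat -> C) (l : C) : Prop :=
  forall eps : R, (0 < eps)%R ->
  exists N : nat, forall n : nat, (N <= n)%nat -> (Cmod (u n - l) < eps)%R.

(** The uniform structure of [C] uses coordinatewise balls, which agree with the modulus only up to
    a factor [sqrt 2]. *)
Lemma is_Clim_filterlim (u : nat -> C) (l : C) :
  is_Clim u l <-> filterlim u eventually (@locally C_UniformSpace l).
Proof.
rewrite (@filterlim_locally nat C_UniformSpace eventually _ u l).
split.
- intros H eps. destruct (H eps (cond_pos eps)) as [N HN].
  exists N. intros n Hn. apply C_NormedModule_mixin_compat1. apply HN, Hn.
- intros H eps Heps.
  assert (H2 : (0 < sqrt 2)%R) by (apply sqrt_lt_R0; lra).
  assert (He : (0 < eps / sqrt 2)%R) by (apply Rdiv_lt_0_compat; lra).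
  destruct (H (mkposreal _ He)) as [N HN].
  exists N. intros n Hn.
  assert (Hb := C_NormedModule_mixin_compat2 l (u n) (mkposreal _ He) (HN n Hn)).
  simpl in Hb. replace eps with (sqrt 2 * (eps / sqrt 2))%R by (field; lra).
  exact Hb.
Qed.

(** As for [sum_n], the last term included is the one of index [n]. *)
Definition Csum (a : nat -> C) (n : nat) : C := @sum_n C_AbelianGroup a n.

Lemma is_series_Clim (a : nat -> C) (l : C) :
  @is_series R_AbsRing C_R_NormedModule a l <->
  is_Clim (Csum a) l.
Proof.
symmetry. exact (is_Clim_filterlim (Csum a) l).
Qed.

Lemma is_Clim_unique (u : nat -> C) (l l' : C) :
  is_Clim u l -> is_Clim u l' -> l = l'.
Proof.
intros H H'. apply is_Clim_filterlim in H. apply is_Clim_filterlim in H'.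
exact (@filterlim_locally_unique nat R_AbsRing C_R_NormedModule eventually _ u l l' H H').
Qed.

Lemma is_Clim_ext (u w : nat -> C) (l : C) :
  (forall n, u n = w n) -> is_Clim u l -> is_Clim w l.
Proof.
intros E H eps Heps. destruct (H eps Heps) as [N HN].
exists N. intros n Hn. rewrite <- E. auto.
Qed.

Lemma is_Clim_const (c : C) : is_Clim (fun _ => c) c.
Proof.
intros eps Heps. exists 0%nat. intros n _.
replace (c - c) with (RtoC 0) by ring. now rewrite Cmod_0.
Qed.

Lemma is_Clim_plus (u w : nat -> C) (l k : C) :
  is_Clim u l -> is_Clim w k -> is_Clim (fun n => u n + w n) (l + k).
Proof.
intros H H' eps Heps.
destruct (H (eps / 2)%R) as [N HN]; [lra|].
destruct (H' (eps / 2)%R) as [N' HN']; [lra|].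
exists (N + N')%nat. intros n Hn.
replace (u n + w n - (l + k)) with ((u n - l) + (w n - k)) by ring.
apply Rle_lt_trans with (1 := Cmod_triangle _ _).
specialize (HN n ltac:(lia)). specialize (HN' n ltac:(lia)). lra.
Qed.

Lemma is_Clim_shift (u : nat -> C) (l : C) (k : nat) :
  is_Clim u l -> is_Clim (fun n => u (n + k)%nat) l.
Proof.
intros H eps Heps. destruct (H eps Heps) as [N HN].
exists N. intros n Hn. apply HN. lia.
Qed.

Lemma is_Clim_mult (u w : nat -> C) (l k : C) :
  is_Clim u l -> is_Clim w k -> is_Clim (fun n => u n * w n) (l * k).
Proof.
intros H H' eps Hp.
set (e1 := Rmin 1 (eps / (2 * (Cmod l + Cmod k + 1)))).
assert (Hl := Cmod_ge_0 l). assert (Hk := Cmod_ge_0 k).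
assert (He0 : (0 < eps / (2 * (Cmod l + Cmod k + 1)))%R).
{ apply Rdiv_lt_0_compat; lra. }
assert (He1 : (0 < e1)%R) by (apply Rmin_glb_lt; lra).
destruct (H e1 He1) as [N HN]. destruct (H' e1 He1) as [N' HN'].
exists (N + N')%nat. intros n Hn.
assert (Ha := HN n ltac:(lia)). assert (Hb := HN' n ltac:(lia)).
set (a := u n) in *. set (b := w n) in *.
replace (a * b - l * k) with ((a - l) * (b - k) + ((a - l) * k + l * (b - k))) by ring.
apply Rle_lt_trans with (1 := Cmod_triangle _ _).
rewrite Cmod_mult.
assert (Ht := Cmod_triangle ((a - l) * k) (l * (b - k))).
rewrite !Cmod_mult in Ht.
assert (H1 : (e1 <= 1)%R) by apply Rmin_l.
assert (H2 : (e1 <= eps / (2 * (Cmod l + Cmod k + 1)))%R) by apply Rmin_r.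
assert (H3 : (e1 * (Cmod l + Cmod k + 1) <= eps / 2)%R).
{ replace (eps / 2)%R with (eps / (2 * (Cmod l + Cmod k + 1)) * (Cmod l + Cmod k + 1))%R by (field; lra).
  apply Rmult_le_compat_r; lra. }
assert (Ga := Cmod_ge_0 (a - l)). assert (Gb := Cmod_ge_0 (b - k)).
assert (H4 : (Cmod (a - l) * Cmod (b - k) <= e1)%R) by nra.
assert (H5 : (Cmod (a - l) * Cmod k <= e1 * Cmod k)%R) by nra.
assert (H6 : (Cmod l * Cmod (b - k) <= Cmod l * e1)%R) by nra.
nra.
Qed.

Lemma is_Clim_scal (c : C) (u : nat -> C) (l : C) :
  is_Clim u l -> is_Clim (fun n => c * u n) (c * l).
Proof.
intros H. apply is_Clim_mult; [apply is_Clim_const | exact H].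
Qed.

Lemma is_Clim_Cmod_le (u : nat -> C) (l c : C) (B : R) (J : nat) :
  is_Clim u l -> (forall n, (J <= n)%nat -> (Cmod (u n - c) <= B)%R) ->
  (Cmod (l - c) <= B)%R.
Proof.
intros H HB. apply Rnot_lt_le. intros Hlt.
destruct (H (Cmod (l - c) - B)%R) as [N HN]; [lra|].
specialize (HN (N + J)%nat ltac:(lia)). specialize (HB (N + J)%nat ltac:(lia)).
assert (Ht := Cmod_triangle (l - u (N + J)%nat) (u (N + J)%nat - c)).
replace (l - u (N + J)%nat + (u (N + J)%nat - c)) with (l - c) in Ht by ring.
replace (l - u (N + J)%nat) with (- (u (N + J)%nat - l)) in Ht by ring.
rewrite Cmod_opp in Ht. lra.
Qed.

(** * Series with geometrically decaying terms *)

Definition Cser (a : nat -> C) (l : C) : Prop := is_Clim (Csum a) l.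

Lemma Csum_Sn (a : nat -> C) (n : nat) :
  Csum a (S n) = Csum a n + a (S n).
Proof. exact (@sum_Sn C_AbelianGroup a n). Qed.

Lemma Csum_O (a : nat -> C) : Csum a 0 = a 0%nat.
Proof. exact (@sum_O C_AbelianGroup a). Qed.

Lemma exp_neg_INR_S (n : nat) : exp (- INR (S n)) = (exp (- INR n) * exp (-1))%R.
Proof. rewrite <- exp_plus. f_equal. rewrite S_INR. ring. Qed.

Lemma exp_le_compat (a b : R) : (a <= b)%R -> (exp a <= exp b)%R.
Proof.
intros [H| ->]; [left; now apply exp_increasing | right; reflexivity].
Qed.

Lemma exp_m1_lt_1 : (exp (-1) < 1)%R.
Proof. rewrite <- exp_0. apply exp_increasing. lra. Qed.

Lemma exp_neg_INR_lt (B eps : R) : (0 <= B)%R -> (0 < eps)%R ->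
  exists J : nat, (B * exp (- INR J) < eps)%R.
Proof.
intros HB Heps.
destruct (INR_unbounded (B / eps)) as [J HJ].
exists J.
assert (H := exp_ineq1_le (INR J)).
assert (H0 : (exp (INR J) * exp (- INR J) = 1)%R) by (rewrite <- exp_plus; replace (INR J + - INR J)%R with 0%R by ring; apply exp_0).
assert (Hp := exp_pos (- INR J)). assert (Hq := exp_pos (INR J)).
assert (HB2 : (B < eps * INR J)%R).
{ apply Rmult_lt_reg_r with (/ eps)%R; [now apply Rinv_0_lt_compat|].
  replace (eps * INR J * / eps)%R with (INR J) by (field; lra). exact HJ. }
apply Rmult_lt_reg_r with (exp (INR J)); [exact Hq|].
rewrite Rmult_assoc, (Rmult_comm (exp (- _))), H0. nra.
Qed.

(** The subtracted [exp (- INR n)] makes the bound inductive: its increment from [n] to [S n] is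
    exactly [M * exp (- INR n)], which dominates the new term. *)
Lemma Csum_tail_bound (a : nat -> C) (M : R) (J n : nat) :
  (forall k, (Cmod (a k) <= M * exp (- INR k))%R) -> (J <= n)%nat ->
  (Cmod (Csum a n - Csum a J)
   <= M / (1 - exp (-1)) * (exp (- INR J) - exp (- INR n)))%R.
Proof.
intros Ha Hn. assert (Hw := exp_m1_lt_1).
induction Hn as [|n Hn IH].
- replace (Csum a J - Csum a J) with (RtoC 0) by ring. rewrite Cmod_0. right. ring.
- rewrite Csum_Sn.
  replace (Csum a n + a (S n) - Csum a J) with ((Csum a n - Csum a J) + a (S n)) by ring.
  apply Rle_trans with (1 := Cmod_triangle _ _).
  assert (Hk := Ha (S n)). rewrite exp_neg_INR_S in Hk |- *.
  assert (HM : (0 <= M)%R).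
  { assert (H0 := Ha 0%nat). assert (H1 := Cmod_ge_0 (a 0%nat)). simpl in H0.
    rewrite Ropp_0, exp_0 in H0. lra. }
  apply Rle_trans with (M / (1 - exp (-1)) * (exp (- INR J) - exp (- INR n))
    + M * exp (- INR n))%R.
  { apply Rplus_le_compat; [exact IH|]. apply Rle_trans with (1 := Hk).
    assert (Hp := exp_pos (- INR n)).
    assert (Hq : (0 <= M * exp (- INR n) * (1 - exp (-1)))%R)
      by (repeat apply Rmult_le_pos; lra).
    lra. }
  right. field. lra.
Qed.

Lemma Cser_tail (a : nat -> C) (l : C) (M : R) (J : nat) :
  (forall k, (Cmod (a k) <= M * exp (- INR k))%R) -> Cser a l ->
  (Cmod (l - Csum a J) <= M / (1 - exp (-1)) * exp (- INR J))%R.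
Proof.
intros Ha Hl. assert (Hw := exp_m1_lt_1).
apply is_Clim_Cmod_le with (1 := Hl) (J := J).
intros n Hn. apply Rle_trans with (1 := Csum_tail_bound a M J n Ha Hn).
assert (HM : (0 <= M)%R).
{ assert (H0 := Ha 0%nat). assert (H1 := Cmod_ge_0 (a 0%nat)). simpl in H0.
  rewrite Ropp_0, exp_0 in H0. lra. }
apply Rmult_le_compat_l.
- apply Rdiv_le_0_compat; lra.
- assert (Hp := exp_pos (- INR n)). lra.
Qed.

Lemma ex_Cser (a : nat -> C) (M : R) :
  (forall k, (Cmod (a k) <= M * exp (- INR k))%R) -> exists l, Cser a l.
Proof.
intros Ha.
destruct (@ex_series_le R_AbsRing C_R_CompleteNormedModule a
  (fun k => (M * exp (- INR k))%R)) as [l Hl].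
- intros n. assert (Hn := Ha n). rewrite Cmod_norm in Hn. exact Hn.
- apply (@ex_series_ext R_AbsRing R_NormedModule (fun k => scal M (exp (-1) ^ k)%R)).
  + intros n. change (M * exp (-1) ^ n = M * exp (- INR n))%R. f_equal.
    induction n as [|n IH]; [simpl; now rewrite Ropp_0, exp_0|].
    rewrite exp_neg_INR_S, <- IH. simpl. ring.
  + apply (@ex_series_scal R_AbsRing R_NormedModule). exists (/ (1 - exp (-1)))%R.
    apply is_series_geom. rewrite Rabs_pos_eq; [apply exp_m1_lt_1 | left; apply exp_pos].
- exists l. now apply is_series_Clim.
Qed.

(** Dominated convergence. The majorant gives a tail estimate uniform in [N]: one cut [J] leaves
    tails below [eps / 4] in every series [f N] and in the limit series, and the finite head
    converges term by term. *)
Lemma tannery_nat (f : nat -> nat -> C) (g : nat -> C) (s : nat -> C) (M : R) :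
  (forall N k, (Cmod (f N k) <= M * exp (- INR k))%R) ->
  (forall k, is_Clim (fun N => f N k) (g k)) ->
  (forall N, Cser (f N) (s N)) ->
  exists t, Cser g t /\ is_Clim s t.
Proof.
intros Hf Hg Hs.
assert (Hgb : forall k, (Cmod (g k) <= M * exp (- INR k))%R).
{ intros k. replace (g k) with (g k - 0) by ring.
  apply is_Clim_Cmod_le with (1 := Hg k) (J := 0%nat).
  intros n _. replace (f n k - 0) with (f n k) by ring. apply Hf. }
destruct (ex_Cser g M Hgb) as [t Ht]. exists t. split; [exact Ht|].
assert (HM : (0 <= M)%R).
{ assert (H0 := Hgb 0%nat). assert (H1 := Cmod_ge_0 (g 0%nat)). simpl in H0.
  rewrite Ropp_0, exp_0 in H0. lra. }
assert (Hw := exp_m1_lt_1).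
assert (HC : (0 <= M / (1 - exp (-1)))%R) by (apply Rdiv_le_0_compat; lra).
intros eps Heps.
destruct (exp_neg_INR_lt (M / (1 - exp (-1))) (eps / 4) HC) as [J HJ]; [lra|].
assert (HsumJ : is_Clim (fun N => Csum (f N) J) (Csum g J)).
{ clear HJ. induction J as [|J IH].
  - rewrite Csum_O. apply is_Clim_ext with (2 := Hg 0%nat).
    intros n. now rewrite Csum_O.
  - rewrite Csum_Sn. apply is_Clim_ext with (2 := is_Clim_plus _ _ _ _ IH (Hg (S J))).
    intros n. now rewrite Csum_Sn. }
destruct (HsumJ (eps / 2)%R) as [N HN]; [lra|].
exists N. intros n Hn. specialize (HN n Hn).
assert (T1 := Cser_tail (f n) (s n) M J (Hf n) (Hs n)).
assert (T2 := Cser_tail g t M J Hgb Ht).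
replace (s n - t) with ((s n - Csum (f n) J) + ((Csum (f n) J - Csum g J) + - (t - Csum g J))) by ring.
apply Rle_lt_trans with (1 := Cmod_triangle _ _).
assert (T3 := Cmod_triangle (Csum (f n) J - Csum g J) (- (t - Csum g J))).
rewrite Cmod_opp in T3. lra.
Qed.

(** * Bilateral series *)

Lemma is_zseries_Cser (f : Z -> C) (s : C) :
  is_zseries f s <->
  exists s1 s2, Cser (fun n => f (Z.of_nat n)) s1 /\
    Cser (fun n => f (- Z.of_nat (S n))%Z) s2 /\ s = s1 + s2.
Proof.
split; intros (s1 & s2 & H1 & H2 & E); exists s1, s2;
  split; [|split| |split]; try exact E; now apply is_series_Clim.
Qed.

Lemma Cser_ext (a b : nat -> C) (l : C) :
  (forall n, a n = b n) -> Cser a l -> Cser b l.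
Proof.
intros E H. apply is_Clim_ext with (2 := H).
intros n. apply (@sum_n_ext C_AbelianGroup). exact E.
Qed.

Lemma Cser_plus (a b : nat -> C) (l k : C) :
  Cser a l -> Cser b k -> Cser (fun n => a n + b n) (l + k).
Proof.
intros Ha Hb. apply is_Clim_ext with (2 := is_Clim_plus _ _ _ _ Ha Hb).
intros n. symmetry. exact (@sum_n_plus C_AbelianGroup a b n).
Qed.

Lemma Cser_scal (c : C) (a : nat -> C) (l : C) :
  Cser a l -> Cser (fun n => c * a n) (c * l).
Proof.
intros Ha. apply is_Clim_ext with (2 := is_Clim_scal c _ _ Ha).
intros n. symmetry. exact (@sum_n_mult_l C_Ring c a n).
Qed.

Lemma Cser_incr (a : nat -> C) (l : C) :
  Cser a l <-> Cser (fun n => a (S n)) (l - a 0%nat).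
Proof.
split; intros H; apply is_series_Clim; apply is_series_Clim in H.
- apply is_series_incr_1.
  assert (E : (l - a 0%nat) + a 0%nat = l) by ring.
  change (@is_series R_AbsRing C_R_NormedModule a ((l - a 0%nat) + a 0%nat)).
  now rewrite E.
- apply is_series_decr_1. exact H.
Qed.

Lemma is_zseries_uniq (f : Z -> C) (s t : C) :
  is_zseries f s -> is_zseries f t -> s = t.
Proof.
intros H K. rewrite <- (is_zseries_unique f s H). now apply is_zseries_unique.
Qed.

Lemma is_zseries_ext (f g : Z -> C) (s : C) :
  (forall n, f n = g n) -> is_zseries f s -> is_zseries g s.
Proof.
intros E H. apply is_zseries_Cser in H. apply is_zseries_Cser.
destruct H as (s1 & s2 & H1 & H2 & ->). exists s1, s2. split; [|split; [|reflexivity]].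
- apply Cser_ext with (2 := H1). intros n. apply E.
- apply Cser_ext with (2 := H2). intros n. apply E.
Qed.

Lemma is_zseries_plus (f g : Z -> C) (s t : C) :
  is_zseries f s -> is_zseries g t -> is_zseries (fun n => f n + g n) (s + t).
Proof.
intros H K. apply is_zseries_Cser in H. apply is_zseries_Cser in K. apply is_zseries_Cser.
destruct H as (s1 & s2 & H1 & H2 & ->). destruct K as (t1 & t2 & K1 & K2 & ->).
exists (s1 + t1), (s2 + t2). split; [|split; [|ring]].
- exact (Cser_plus _ _ _ _ H1 K1).
- exact (Cser_plus _ _ _ _ H2 K2).
Qed.

Lemma is_zseries_scal (c : C) (f : Z -> C) (s : C) :
  is_zseries f s -> is_zseries (fun n => c * f n) (c * s).
Proof.
intros H. apply is_zseries_Cser in H. apply is_zseries_Cser.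
destruct H as (s1 & s2 & H1 & H2 & ->).
exists (c * s1), (c * s2). split; [|split; [|ring]].
- exact (Cser_scal c _ _ H1).
- exact (Cser_scal c _ _ H2).
Qed.

Lemma is_zseries_minus (f g : Z -> C) (s t : C) :
  is_zseries f s -> is_zseries g t -> is_zseries (fun n => f n - g n) (s - t).
Proof.
intros H K. replace (s - t) with (s + (- (1)) * t) by ring.
apply is_zseries_ext with (f := fun n => f n + (- (1)) * g n); [intros n; ring|].
apply is_zseries_plus; [exact H|]. now apply is_zseries_scal.
Qed.

(** The two halves converge separately, so a shift by one moves the term [f 0] from the nonnegative
    half to the negative one. *)
Lemma is_zseries_succ (f : Z -> C) (s : C) :
  is_zseries f s -> is_zseries (fun n => f (n + 1)%Z) s.
Proof.
intros H. apply is_zseries_Cser in H. apply is_zseries_Cser.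
destruct H as (s1 & s2 & H1 & H2 & ->).
exists (s1 - f 0%Z), (s2 + f 0%Z). split; [|split; [|ring]].
- apply Cser_incr in H1. apply Cser_ext with (2 := H1). intros n. f_equal. lia.
- apply Cser_incr. replace (s2 + f 0%Z - _) with s2; [|simpl; ring].
  apply Cser_ext with (2 := H2). intros n. f_equal. lia.
Qed.

Lemma is_zseries_opp (f : Z -> C) (s : C) :
  is_zseries f s -> is_zseries (fun n => f (- n)%Z) s.
Proof.
intros H. apply is_zseries_Cser in H. apply is_zseries_Cser.
destruct H as (s1 & s2 & H1 & H2 & ->).
exists (s2 + f 0%Z), (s1 - f 0%Z). split; [|split; [|ring]].
- apply Cser_incr. replace (s2 + f 0%Z - _) with s2; [|simpl; ring].
  apply Cser_ext with (2 := H2). reflexivity.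
- apply Cser_incr in H1. apply Cser_ext with (2 := H1). intros n.
  now rewrite Z.opp_involutive.
Qed.

Lemma is_zseries_shift (f : Z -> C) (s : C) (k : Z) :
  is_zseries f s -> is_zseries (fun n => f (n + k)%Z) s.
Proof.
assert (Hnat : forall (j : nat) (g : Z -> C), is_zseries g s ->
  is_zseries (fun n => g (n + Z.of_nat j)%Z) s).
{ intros j g Hg. induction j as [|j IH].
  - apply is_zseries_ext with (2 := Hg). intros n. f_equal. lia.
  - apply is_zseries_succ in IH. apply is_zseries_ext with (2 := IH).
    intros n. cbv beta. f_equal. lia. }
intros H. destruct (Z_le_gt_dec 0 k) as [Hk|Hk].
- apply is_zseries_ext with (2 := Hnat (Z.to_nat k) f H). intros n. f_equal. lia.
(* A negative shift is a positive one conjugated by the reflection of [Z]. *)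
- apply is_zseries_opp in H.
  apply (Hnat (Z.to_nat (- k))) in H. apply is_zseries_opp in H.
  apply is_zseries_ext with (2 := H). intros n. cbv beta. f_equal. lia.
Qed.

Lemma is_zseries_reflect (f : Z -> C) (s : C) (m : Z) :
  is_zseries f s -> is_zseries (fun n => f (m - n)%Z) s.
Proof.
intros H. apply (is_zseries_shift _ _ m) in H. apply is_zseries_opp in H.
apply is_zseries_ext with (2 := H). intros n. cbv beta. f_equal. lia.
Qed.

(** * Dominated bilateral series: the theorems of Tannery and Fubini *)

(** The rate is fixed once and for all: the terms to be estimated decay like [exp (- lam * n ^ 2)],
    which beats every geometric rate, so only the constant [M] has to be tracked. *)
Definition expdec (M : R) (f : Z -> C) : Prop :=
  forall n, (Cmod (f n) <= M * exp (- Rabs (IZR n)))%R.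

Lemma expdec_nonneg (M : R) (f : Z -> C) : expdec M f -> (0 <= M)%R.
Proof.
intros H. specialize (H 0%Z). assert (H1 := Cmod_ge_0 (f 0%Z)).
rewrite Rabs_R0, Ropp_0, exp_0 in H. lra.
Qed.

Lemma expdec_pos (M : R) (f : Z -> C) (n : nat) :
  expdec M f -> (Cmod (f (Z.of_nat n)) <= M * exp (- INR n))%R.
Proof.
intros H. specialize (H (Z.of_nat n)). rewrite <- INR_IZR_INZ in H.
rewrite Rabs_pos_eq in H; [exact H | apply pos_INR].
Qed.

Lemma expdec_neg (M : R) (f : Z -> C) (n : nat) :
  expdec M f -> (Cmod (f (- Z.of_nat (S n))%Z) <= M * exp (- INR n))%R.
Proof.
intros H. assert (HM := expdec_nonneg M f H).
specialize (H (- Z.of_nat (S n))%Z).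
rewrite opp_IZR, Rabs_Ropp, <- INR_IZR_INZ in H.
rewrite Rabs_pos_eq in H; [| apply pos_INR].
apply Rle_trans with (1 := H). apply Rmult_le_compat_l; [exact HM|].
apply exp_le_compat. rewrite S_INR. lra.
Qed.

Lemma expdec_ex (M : R) (f : Z -> C) : expdec M f -> ex_zseries f.
Proof.
intros H.
destruct (ex_Cser (fun n => f (Z.of_nat n)) M) as [s1 H1].
{ intros k. now apply expdec_pos. }
destruct (ex_Cser (fun n => f (- Z.of_nat (S n))%Z) M) as [s2 H2].
{ intros k. now apply expdec_neg. }
exists (s1 + s2). apply is_zseries_Cser. now exists s1, s2.
Qed.

Lemma tannery (f : nat -> Z -> C) (g : Z -> C) (s : nat -> C) (M : R) :
  (forall N, expdec M (f N)) ->
  (forall n, is_Clim (fun N => f N n) (g n)) ->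
  (forall N, is_zseries (f N) (s N)) ->
  exists t, is_zseries g t /\ is_Clim s t.
Proof.
intros Hf Hg Hs.
assert (E1 : forall N, exists l, Cser (fun k => f N (Z.of_nat k)) l).
{ intros N. apply (ex_Cser _ M). intros k. now apply expdec_pos. }
assert (E2 : forall N, exists l, Cser (fun k => f N (- Z.of_nat (S k))%Z) l).
{ intros N. apply (ex_Cser _ M). intros k. now apply expdec_neg. }
(* The hypothesis gives only the total [s N]; the half-sums are needed as functions of [N], and
   [Clim] extracts them from the existence statements. *)
set (S1 := fun N => Clim (Csum (fun k => f N (Z.of_nat k)))).
set (S2 := fun N => Clim (Csum (fun k => f N (- Z.of_nat (S k))%Z))).
assert (HS1 : forall N, Cser (fun k => f N (Z.of_nat k)) (S1 N)).
{ intros N. destruct (E1 N) as [l Hl]. unfold S1.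
  rewrite (Clim_correct _ l); [exact Hl|]. now apply is_Clim_filterlim. }
assert (HS2 : forall N, Cser (fun k => f N (- Z.of_nat (S k))%Z) (S2 N)).
{ intros N. destruct (E2 N) as [l Hl]. unfold S2.
  rewrite (Clim_correct _ l); [exact Hl|]. now apply is_Clim_filterlim. }
destruct (tannery_nat (fun N k => f N (Z.of_nat k)) (fun k => g (Z.of_nat k)) S1 M)
  as (t1 & G1 & L1).
{ intros N k. now apply expdec_pos. } { intros k. apply Hg. } { exact HS1. }
destruct (tannery_nat (fun N k => f N (- Z.of_nat (S k))%Z) (fun k => g (- Z.of_nat (S k))%Z) S2 M)
  as (t2 & G2 & L2).
{ intros N k. now apply expdec_neg. } { intros k. apply Hg. } { exact HS2. }
exists (t1 + t2). split.
- apply is_zseries_Cser. now exists t1, t2.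
- apply is_Clim_ext with (2 := is_Clim_plus _ _ _ _ L1 L2).
  intros N. apply is_zseries_uniq with (f := f N); [|apply Hs].
  apply is_zseries_Cser. now exists (S1 N), (S2 N).
Qed.

(** The range of summation is [- N - 1 <= n <= N], with [N + 1] terms in each half. *)
Definition zsum (f : Z -> C) (N : nat) : C :=
  Csum (fun k => f (Z.of_nat k)) N +
  Csum (fun k => f (- Z.of_nat (S k))%Z) N.

Lemma zsum_lim (f : Z -> C) (s : C) : is_zseries f s -> is_Clim (zsum f) s.
Proof.
intros H. apply is_zseries_Cser in H. destruct H as (s1 & s2 & H1 & H2 & ->).
now apply is_Clim_plus.
Qed.

Lemma zsum_bound (f : Z -> C) (M : R) (N : nat) :
  expdec M f -> (Cmod (zsum f N) <= M * (2 * / (1 - exp (-1)) + 2))%R.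
Proof.
intros H. assert (HM := expdec_nonneg M f H). assert (Hw := exp_m1_lt_1).
assert (G : forall a, (forall k, (Cmod (a k) <= M * exp (- INR k))%R) ->
  (Cmod (Csum a N) <= M * (/ (1 - exp (-1)) + 1))%R).
{ intros a Ha. assert (T := Csum_tail_bound a M 0 N Ha ltac:(lia)).
  rewrite Csum_O in T. assert (T0 := Ha 0%nat). simpl in T, T0.
  rewrite Ropp_0, exp_0 in T, T0.
  replace (Csum a N) with ((Csum a N - a 0%nat) + a 0%nat) by ring.
  apply Rle_trans with (1 := Cmod_triangle _ _).
  assert (Hp := exp_pos (- INR N)).
  assert (HC : (0 <= M / (1 - exp (-1)))%R) by (apply Rdiv_le_0_compat; lra).
  replace (M * (/ (1 - exp (-1)) + 1))%R with (M / (1 - exp (-1)) + M * 1)%R by (field; lra).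
  nra. }
unfold zsum. apply Rle_trans with (1 := Cmod_triangle _ _).
assert (G1 := G (fun k => f (Z.of_nat k)) (fun k => expdec_pos M f k H)).
assert (G2 := G (fun k => f (- Z.of_nat (S k))%Z) (fun k => expdec_neg M f k H)).
cbv beta in G1, G2. lra.
Qed.

Lemma zsum_zseries (F : Z -> Z -> C) (c : Z -> C) (N : nat) :
  (forall m, is_zseries (fun n => F n m) (c m)) ->
  is_zseries (fun n => zsum (F n) N) (zsum c N).
Proof.
intros H.
assert (G : forall h : nat -> Z, is_zseries (fun n => Csum (fun k => F n (h k)) N)
  (Csum (fun k => c (h k)) N)).
{ intros h. induction N as [|N IH].
  - rewrite Csum_O. apply is_zseries_ext with (2 := H (h 0%nat)).
    intros n. now rewrite Csum_O.
  - rewrite Csum_Sn. apply is_zseries_ext with (2 := is_zseries_plus _ _ _ _ IH (H (h (S N)))).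
    intros n. now rewrite Csum_Sn. }
unfold zsum. apply is_zseries_plus; [apply (G Z.of_nat) | apply (G (fun k => - Z.of_nat (S k))%Z)].
Qed.

(** Tannery's theorem applied to the rows cut at [N] identifies the sum of the rows with the limit
    of the partial sums [zsum c]. That alone does not make the two halves of [c] converge
    separately; this comes from the same argument for the transposed array, and uniqueness of limits
    identifies the two sums. *)
Lemma zseries_fubini (F : Z -> Z -> C) (r c : Z -> C) (M : R) :
  (forall n m, (Cmod (F n m) <= M * exp (- Rabs (IZR n)) * exp (- Rabs (IZR m)))%R) ->
  (forall n, is_zseries (fun m => F n m) (r n)) ->
  (forall m, is_zseries (fun n => F n m) (c m)) ->
  exists s, is_zseries r s /\ is_zseries c s.
Proof.
assert (half : forall (G : Z -> Z -> C) (r c : Z -> C),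
  (forall n m, (Cmod (G n m) <= M * exp (- Rabs (IZR n)) * exp (- Rabs (IZR m)))%R) ->
  (forall n, is_zseries (fun m => G n m) (r n)) ->
  (forall m, is_zseries (fun n => G n m) (c m)) ->
  exists s, is_zseries r s /\ is_Clim (zsum c) s).
{ clear. intros F r c HF Hr Hc.
  apply (tannery (fun N n => zsum (F n) N) r (zsum c) (M * (2 * / (1 - exp (-1)) + 2))).
  - intros N n. replace (M * (2 * / (1 - exp (-1)) + 2) * exp (- Rabs (IZR n)))%R
      with ((M * exp (- Rabs (IZR n))) * (2 * / (1 - exp (-1)) + 2))%R by ring.
    apply zsum_bound. intros m. apply HF.
  - intros n. apply zsum_lim, Hr.
  - intros N. now apply zsum_zseries. }
intros HF Hr Hc. destruct (half F r c HF Hr Hc) as (s & Hs & Ls).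
destruct (half (fun m n => F n m) c r) as (t & Ht & _); [|exact Hc | exact Hr|].
{ intros m n. rewrite Rmult_assoc, (Rmult_comm (exp _)), <- Rmult_assoc. apply HF. }
exists s. split; [exact Hs|].
now rewrite (is_Clim_unique _ _ _ Ls (zsum_lim _ _ Ht)).
Qed.

(** * Integer powers *)

Lemma C1_neq_0 : RtoC 1 <> 0.
Proof. intros E. apply (f_equal fst) in E. simpl in E. lra. Qed.

Lemma Cinv_neq_0 (z : C) : z <> 0 -> / z <> 0.
Proof.
intros Hz E. apply C1_neq_0. rewrite <- (Cinv_r z Hz), E. ring.
Qed.

Lemma Cdiv_neq_0 (z w : C) : z <> 0 -> w <> 0 -> z / w <> 0.
Proof. intros Hz Hw. apply Cmult_neq_0; [exact Hz | now apply Cinv_neq_0]. Qed.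

Lemma Copp_neq_0 (z : C) : z <> 0 -> - z <> 0.
Proof. intros Hz E. apply Hz. replace z with (- - z) by ring. rewrite E. ring. Qed.

Lemma Csub_neq_0 (z w : C) : z <> w -> z - w <> 0.
Proof. intros Hz E. apply Hz. replace z with (z - w + w) by ring. rewrite E. ring. Qed.

Lemma Cpowz_of_nat (z : C) (n : nat) : z ^^ Z.of_nat n = z ^ n.
Proof.
destruct n as [|n]; [reflexivity|]. simpl Z.of_nat. unfold Cpowz.
now rewrite SuccNat2Pos.id_succ.
Qed.

Lemma Cpowz_opp_nat (z : C) (n : nat) : z ^^ (- Z.of_nat n) = / z ^ n.
Proof.
destruct n as [|n]; [simpl; field; exact C1_neq_0|]. simpl Z.of_nat. unfold Cpowz. simpl Z.opp.
cbv iota. now rewrite SuccNat2Pos.id_succ.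
Qed.

Lemma Cpowz_neq_0 (z : C) (n : Z) : z <> 0 -> z ^^ n <> 0.
Proof.
intros Hz. destruct n as [|p|p]; simpl; [exact C1_neq_0 | now apply Cpow_nz |].
apply Cinv_neq_0. now apply Cpow_nz.
Qed.

Lemma Cpowz_succ (z : C) (n : Z) : z <> 0 -> z ^^ (n + 1) = z ^^ n * z.
Proof.
intros Hz. destruct (Z_le_gt_dec 0 n) as [Hn|Hn].
- rewrite <- (Z2Nat.id n Hn).
  replace (Z.of_nat (Z.to_nat n) + 1)%Z with (Z.of_nat (S (Z.to_nat n))) by lia.
  rewrite !Cpowz_of_nat, Cpow_S. ring.
- replace n with (- Z.of_nat (S (Z.to_nat (- n - 1))))%Z by lia.
  replace (- Z.of_nat (S (Z.to_nat (- n - 1))) + 1)%Z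
    with (- Z.of_nat (Z.to_nat (- n - 1)))%Z by lia.
  rewrite !Cpowz_opp_nat, Cpow_S.
  field. split; [now apply Cpow_nz | exact Hz].
Qed.

(** An induction step in the form of an equivalence covers both directions of [Z]; for identities
    between powers the backward half is cancellation of a nonzero factor. *)
Lemma Z_ind_succ (P : Z -> Prop) :
  P 0%Z -> (forall n, P n <-> P (n + 1)%Z) -> forall n, P n.
Proof.
intros H0 Hs n. induction n as [|n IH|n IH] using Z.peano_ind; [exact H0| |].
- rewrite <- Z.add_1_r. exact (proj1 (Hs n) IH).
- apply Hs. replace (Z.pred n + 1)%Z with n by lia. exact IH.
Qed.

Lemma Cmult_cancel_r (a b z : C) : z <> 0 -> a * z = b * z -> a = b.
Proof.
intros Hz E. replace a with (a * z / z) by (field; exact Hz). rewrite E. field. exact Hz.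
Qed.

Lemma Cpowz_add (z : C) (m n : Z) : z <> 0 -> z ^^ (m + n) = z ^^ m * z ^^ n.
Proof.
intros Hz. revert n. apply Z_ind_succ.
- rewrite Z.add_0_r. simpl. ring.
- intros n. rewrite Z.add_assoc, !Cpowz_succ by exact Hz. split; intros E.
  + rewrite E. ring.
  + apply (Cmult_cancel_r _ _ z Hz). rewrite E. ring.
Qed.

Lemma Cpowz_opp (z : C) (n : Z) : z <> 0 -> z ^^ (- n) = / z ^^ n.
Proof.
intros Hz. apply (Cmult_cancel_r _ _ (z ^^ n)); [now apply Cpowz_neq_0|].
rewrite <- Cpowz_add by exact Hz. replace (- n + n)%Z with 0%Z by lia. simpl.
rewrite Cinv_l; [reflexivity | now apply Cpowz_neq_0].
Qed.

Lemma Cpowz_sub (z : C) (m n : Z) : z <> 0 -> z ^^ (m - n) = z ^^ m / z ^^ n.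
Proof.
intros Hz. unfold Z.sub. now rewrite Cpowz_add, Cpowz_opp.
Qed.

Lemma Cpowz_mult_l (z w : C) (n : Z) : z <> 0 -> w <> 0 -> (z * w) ^^ n = z ^^ n * w ^^ n.
Proof.
intros Hz Hw. assert (Hzw := Cmult_neq_0 z w Hz Hw).
revert n. apply Z_ind_succ; [simpl; ring|].
intros n. rewrite !Cpowz_succ by assumption. split; intros E.
- rewrite E. ring.
- apply (Cmult_cancel_r _ _ (z * w) Hzw). rewrite E. ring.
Qed.

Lemma Cpowz_inv_l (z : C) (n : Z) : z <> 0 -> (/ z) ^^ n = / z ^^ n.
Proof.
intros Hz. assert (Hi := Cinv_neq_0 z Hz).
apply (Cmult_cancel_r _ _ (z ^^ n)); [now apply Cpowz_neq_0|].
rewrite <- Cpowz_mult_l, !Cinv_l by (try apply Cpowz_neq_0; assumption).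
revert n. apply Z_ind_succ; [reflexivity|].
intros n. rewrite Cpowz_succ by exact C1_neq_0. now rewrite Cmult_1_r.
Qed.

Lemma Cpowz_div_l (z w : C) (n : Z) : z <> 0 -> w <> 0 -> (z / w) ^^ n = z ^^ n / w ^^ n.
Proof.
intros Hz Hw. unfold Cdiv. rewrite Cpowz_mult_l; [|exact Hz | now apply Cinv_neq_0].
now rewrite Cpowz_inv_l.
Qed.

Lemma Cpowz_1_l (n : Z) : 1 ^^ n = 1.
Proof.
revert n. apply Z_ind_succ; [reflexivity|].
intros n. rewrite Cpowz_succ by exact C1_neq_0. now rewrite Cmult_1_r.
Qed.

Lemma Cpowz_mult (z : C) (m n : Z) : z <> 0 -> z ^^ (m * n) = (z ^^ m) ^^ n.
Proof.
intros Hz. assert (Hzm := Cpowz_neq_0 z m Hz).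
revert n. apply Z_ind_succ; [now rewrite Z.mul_0_r|].
intros n. rewrite Z.mul_add_distr_l, Z.mul_1_r, Cpowz_add, Cpowz_succ by assumption.
split; intros E; [now rewrite E|].
now apply (Cmult_cancel_r _ _ (z ^^ m) Hzm).
Qed.

Lemma Cmod_Cpowz (z : C) (n : Z) : z <> 0 -> Cmod (z ^^ n) = exp (IZR n * ln (Cmod z)).
Proof.
intros Hz. assert (Hm : (0 < Cmod z)%R) by now apply Cmod_gt_0.
revert n. apply Z_ind_succ.
- simpl. now rewrite Rmult_0_l, exp_0, Cmod_1.
- intros n. rewrite Cpowz_succ, Cmod_mult, plus_IZR, Rmult_plus_distr_r, exp_plus, Rmult_1_l, exp_ln by assumption.
  split; intros E; [now rewrite E|]. apply Rmult_eq_reg_r with (Cmod z); [exact E | lra].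
Qed.

(** * Triangular exponents *)

(** Spelled like the exponent in [psi_term], which therefore folds to it. *)
Definition tri (n : Z) : Z := (n * (n - 1) / 2)%Z.

(** Eliminates the integer division: every later identity between exponents follows from this
    equation by [nia]. *)
Lemma tri_double (n : Z) : (2 * tri n = n * (n - 1))%Z.
Proof.
unfold tri. assert (H : ((n * (n - 1)) mod 2 = 0)%Z).
{ assert (E := Z.div_mod n 2 ltac:(lia)). assert (B := Z.mod_pos_bound n 2 ltac:(lia)).
  set (k := (n / 2)%Z) in *.
  assert (n mod 2 = 0 \/ n mod 2 = 1)%Z as [H|H] by lia; rewrite H in E.
  - replace (n * (n - 1))%Z with ((k * (n - 1)) * 2)%Z by (rewrite E; ring). apply Z_mod_mult.
  - replace (n * (n - 1))%Z with ((n * k) * 2)%Z by (rewrite E; ring). apply Z_mod_mult. }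
assert (E := Z.div_mod (n * (n - 1)) 2 ltac:(lia)). lia.
Qed.

Lemma tri_succ (n : Z) : tri (n + 1) = (tri n + n)%Z.
Proof. assert (H := tri_double n). assert (K := tri_double (n + 1)). nia. Qed.

Lemma tri_add (m n : Z) : tri (m + n) = (tri m + tri n + m * n)%Z.
Proof.
assert (H := tri_double n). assert (K := tri_double m). assert (L := tri_double (m + n)). nia.
Qed.

Lemma tri_sub (m n : Z) : tri (m - n) = (tri m + tri n - m * n + n)%Z.
Proof.
assert (H := tri_double n). assert (K := tri_double m). assert (L := tri_double (m - n)). nia.
Qed.

(** * The infinite product *)

Lemma Cprod_ext (f g : nat -> C) (n : nat) :
  (forall j, f j = g j) -> Cprod f n = Cprod g n.
Proof. intros E. induction n as [|n IH]; [reflexivity|]. simpl. now rewrite IH, E. Qed.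

Lemma Cprod_shift (f : nat -> C) (n : nat) :
  Cprod f (S n) = f 0%nat * Cprod (fun j => f (S j)) n.
Proof.
induction n as [|n IH]; [simpl; ring|].
change (Cprod f (S (S n))) with (Cprod f (S n) * f (S n)). rewrite IH. simpl. ring.
Qed.

Lemma Cmod_sub_le (a b : C) : (Cmod (a - b) <= Cmod a + Cmod b)%R.
Proof.
rewrite <- (Cmod_opp b). exact (Cmod_triangle a (- b)).
Qed.

Lemma pow_lt_1_bounds (r : R) (n : nat) : (0 <= r < 1)%R -> (0 <= r ^ n <= 1)%R.
Proof.
intros Hr. split; [apply pow_le; lra|]. rewrite <- (pow1 n). apply pow_incr. lra.
Qed.

Definition qfin (q z : C) (n : nat) : C := Cprod (fun j => 1 - z * q ^ j) n.

(** The bound obtained from [1 + t <= exp t] applied to each factor, with the exponents summed as a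
    geometric series. *)
Definition qbnd (q z : C) : R := exp (Cmod z / (1 - Cmod q)).

Lemma qfin_bound (q z : C) (n : nat) : (Cmod q < 1)%R -> (Cmod (qfin q z n) <= qbnd q z)%R.
Proof.
intros Hq. assert (H0 := Cmod_ge_0 q). assert (Hz := Cmod_ge_0 z).
assert (H : (Cmod (qfin q z n) <= exp (Cmod z * (1 - Cmod q ^ n) / (1 - Cmod q)))%R).
{ induction n as [|n IH].
  - change (qfin q z 0) with (RtoC 1). rewrite Cmod_1. simpl pow. replace (Cmod z * (1 - 1) / (1 - Cmod q))%R with 0%R by (field; lra).
    rewrite exp_0. lra.
  - change (qfin q z (S n)) with (qfin q z n * (1 - z * q ^ n)). rewrite Cmod_mult.
    replace (Cmod z * (1 - Cmod q ^ S n) / (1 - Cmod q))%R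
      with (Cmod z * (1 - Cmod q ^ n) / (1 - Cmod q) + Cmod z * Cmod q ^ n)%R
      by (simpl; field; lra).
    rewrite exp_plus. apply Rmult_le_compat; try apply Cmod_ge_0; [exact IH|].
    apply Rle_trans with (1 := Cmod_sub_le _ _).
    rewrite Cmod_1, Cmod_mult, Cmod_pow. apply exp_ineq1_le. }
apply Rle_trans with (1 := H). apply exp_le_compat.
apply Rmult_le_compat_r; [left; apply Rinv_0_lt_compat; lra|].
assert (P := pow_lt_1_bounds (Cmod q) n ltac:(lra)). nra.
Qed.

(** The increments of the partial products are summed as a geometric series. The factor [Cmod z] on
    the right is what later makes [(z q^n)_oo] tend to 1. *)
Lemma qfin_sub_1 (q z : C) (n : nat) : (Cmod q < 1)%R ->
  (Cmod (qfin q z n - 1) <= qbnd q z * Cmod z / (1 - Cmod q))%R.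
Proof.
intros Hq. assert (H0 := Cmod_ge_0 q). assert (Hz := Cmod_ge_0 z).
assert (HB : (0 < qbnd q z)%R) by apply exp_pos.
assert (H : (Cmod (qfin q z n - 1) <= qbnd q z * Cmod z * (1 - Cmod q ^ n) / (1 - Cmod q))%R).
{ induction n as [|n IH].
  - change (qfin q z 0) with (RtoC 1). replace (1 - 1) with (RtoC 0) by ring.
    rewrite Cmod_0. right. simpl. field. lra.
  - change (qfin q z (S n)) with (qfin q z n * (1 - z * q ^ n)).
    replace (qfin q z n * (1 - z * q ^ n) - 1) with ((qfin q z n - 1) - qfin q z n * (z * q ^ n)) by ring.
    apply Rle_trans with (1 := Cmod_sub_le _ _). rewrite !Cmod_mult, Cmod_pow.
    replace (qbnd q z * Cmod z * (1 - Cmod q ^ S n) / (1 - Cmod q))%R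
      with (qbnd q z * Cmod z * (1 - Cmod q ^ n) / (1 - Cmod q) + qbnd q z * (Cmod z * Cmod q ^ n))%R
      by (simpl; field; lra).
    apply Rplus_le_compat; [exact IH|]. apply Rmult_le_compat_r.
    + apply Rmult_le_pos; [exact Hz | apply pow_le; exact H0].
    + now apply qfin_bound. }
apply Rle_trans with (1 := H).
apply Rmult_le_compat_r; [left; apply Rinv_0_lt_compat; lra|].
assert (P := pow_lt_1_bounds (Cmod q) n ltac:(lra)).
assert (0 <= qbnd q z * Cmod z)%R by (apply Rmult_le_pos; lra). nra.
Qed.

(** Gives meaning to the [Clim] in [qpoch_inf]: the increments of the partial products are dominated
    by a geometric series. *)
Lemma qfin_cvg (q z : C) : (Cmod q < 1)%R -> is_Clim (qfin q z) (qpoch_inf q z).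
Proof.
intros Hq. assert (H0 := Cmod_ge_0 q).
set (a := fun n => qfin q z (S n) - qfin q z n).
assert (Hex : exists l, is_Clim (Csum a) l).
{ destruct (@ex_series_le R_AbsRing C_R_CompleteNormedModule a
    (fun k => (qbnd q z * Cmod z * Cmod q ^ k)%R)) as [l Hl].
  - intros n. change (norm (a n)) with (@norm R_AbsRing C_R_NormedModule (a n)).
    rewrite <- Cmod_norm. unfold a.
    change (qfin q z (S n)) with (qfin q z n * (1 - z * q ^ n)).
    replace (qfin q z n * (1 - z * q ^ n) - qfin q z n) with (- (qfin q z n * (z * q ^ n))) by ring.
    rewrite Cmod_opp, !Cmod_mult, Cmod_pow, Rmult_assoc.
    apply Rmult_le_compat_r; [|now apply qfin_bound].
    apply Rmult_le_pos; [apply Cmod_ge_0 | apply pow_le; exact H0].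
  - apply (@ex_series_scal R_AbsRing R_NormedModule (qbnd q z * Cmod z)%R).
    exists (/ (1 - Cmod q))%R. apply is_series_geom. now rewrite Rabs_pos_eq.
  - exists l. now apply is_series_Clim. }
destruct Hex as [l Hl].
assert (E : forall n, Csum a n = qfin q z (S n) - 1).
{ induction n as [|n IH]; [rewrite Csum_O; reflexivity|].
  rewrite Csum_Sn, IH. unfold a. ring. }
assert (Hlim : is_Clim (qfin q z) (l + 1)).
{ intros eps Heps. destruct (Hl eps Heps) as [N HN]. exists (S N). intros n Hn.
  destruct n as [|n]; [lia|]. specialize (HN n ltac:(lia)). rewrite E in HN.
  replace (qfin q z (S n) - (l + 1)) with (qfin q z (S n) - 1 - l) by ring. exact HN. }
unfold qpoch_inf. rewrite (Clim_correct _ (l + 1)); [exact Hlim|].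
now apply is_Clim_filterlim.
Qed.

Lemma qpoch_inf_bound (q z : C) : (Cmod q < 1)%R -> (Cmod (qpoch_inf q z) <= qbnd q z)%R.
Proof.
intros Hq. replace (qpoch_inf q z) with (qpoch_inf q z - 0) by ring.
apply is_Clim_Cmod_le with (1 := qfin_cvg q z Hq) (J := 0%nat).
intros n _. replace (qfin q z n - 0) with (qfin q z n) by ring. now apply qfin_bound.
Qed.

Lemma qpoch_inf_sub_1 (q z : C) : (Cmod q < 1)%R ->
  (Cmod (qpoch_inf q z - 1) <= qbnd q z * Cmod z / (1 - Cmod q))%R.
Proof.
intros Hq.
apply is_Clim_Cmod_le with (1 := qfin_cvg q z Hq) (J := 0%nat).
intros n _. now apply qfin_sub_1.
Qed.

Lemma qpoch_inf_step (q z : C) : (Cmod q < 1)%R ->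
  qpoch_inf q z = (1 - z) * qpoch_inf q (z * q).
Proof.
intros Hq. apply is_Clim_unique with (u := fun n => qfin q z (n + 1)%nat).
- apply is_Clim_shift. now apply qfin_cvg.
- apply is_Clim_ext with (2 := is_Clim_scal (1 - z) _ _ (qfin_cvg q (z * q) Hq)).
  intros n. rewrite Nat.add_1_r. unfold qfin. rewrite Cprod_shift. simpl. f_equal; [ring|].
  apply Cprod_ext. intros j. ring.
Qed.

Lemma qpoch_inf_fin (q z : C) (n : nat) : (Cmod q < 1)%R ->
  qpoch_inf q z = qfin q z n * qpoch_inf q (z * q ^ n).
Proof.
intros Hq. induction n as [|n IH].
- simpl. rewrite Cmult_1_l, Cmult_1_r. reflexivity.
- rewrite IH, (qpoch_inf_step q (z * q ^ n) Hq).
  change (qfin q z (S n)) with (qfin q z n * (1 - z * q ^ n)).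
  replace (z * q ^ n * q) with (z * q ^ S n) by (simpl; ring). ring.
Qed.

Lemma qpoch_inf_0 (q : C) : (Cmod q < 1)%R -> qpoch_inf q 0 = 1.
Proof.
intros Hq. apply is_Clim_unique with (1 := qfin_cvg q 0 Hq).
apply is_Clim_ext with (2 := is_Clim_const 1).
induction n as [|n IH]; [reflexivity|].
change (qfin q 0 (S n)) with (qfin q 0 n * (1 - 0 * q ^ n)). rewrite <- IH. ring.
Qed.

Lemma is_Clim_pow_0 (q : C) : (Cmod q < 1)%R -> is_Clim (fun n => q ^ n) 0.
Proof.
intros Hq eps Heps.
destruct (pow_lt_1_zero (Cmod q)) with (y := eps) as [N HN]; [|exact Heps|].
- rewrite Rabs_pos_eq; [exact Hq | apply Cmod_ge_0].
- exists N. intros n Hn. specialize (HN n ltac:(lia)).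
  replace (q ^ n - 0) with (q ^ n) by ring. rewrite Cmod_pow.
  now rewrite Rabs_pos_eq in HN by (apply pow_le, Cmod_ge_0).
Qed.

Lemma qbnd_le (q z w : C) : (Cmod q < 1)%R -> (Cmod z <= Cmod w)%R -> (qbnd q z <= qbnd q w)%R.
Proof.
intros Hq H. apply exp_le_compat. apply Rmult_le_compat_r; [|exact H].
left. apply Rinv_0_lt_compat. lra.
Qed.

Lemma Cmod_mult_pow_le (q z : C) (n : nat) : (Cmod q < 1)%R -> (Cmod (z * q ^ n) <= Cmod z)%R.
Proof.
intros Hq. rewrite Cmod_mult, Cmod_pow. assert (Hz := Cmod_ge_0 z).
assert (P := pow_lt_1_bounds (Cmod q) n ltac:(split; [apply Cmod_ge_0 | exact Hq])). nra.
Qed.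

Lemma qpoch_inf_lim (q z : C) : (Cmod q < 1)%R ->
  is_Clim (fun n => qpoch_inf q (z * q ^ n)) 1.
Proof.
intros Hq eps Heps.
set (K := (qbnd q z / (1 - Cmod q))%R).
assert (HK : (0 < K)%R) by (apply Rdiv_lt_0_compat; [apply exp_pos | lra]).
destruct (is_Clim_scal z _ _ (is_Clim_pow_0 q Hq) (eps / K)%R) as [N HN];
  [now apply Rdiv_lt_0_compat|].
exists N. intros n Hn. specialize (HN n Hn). cbv beta in HN.
replace (z * q ^ n - z * 0) with (z * q ^ n) in HN by ring.
apply Rle_lt_trans with (1 := qpoch_inf_sub_1 q _ Hq).
apply Rle_lt_trans with (K * Cmod (z * q ^ n))%R.
- unfold K, Rdiv. rewrite (Rmult_assoc (qbnd q z)), (Rmult_comm (/ _)), <- Rmult_assoc.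
  apply Rmult_le_compat_r; [left; apply Rinv_0_lt_compat; lra|].
  apply Rmult_le_compat_r; [apply Cmod_ge_0|].
  apply qbnd_le; [exact Hq|]. now apply Cmod_mult_pow_le.
- replace eps with (K * (eps / K))%R by (field; lra). now apply Rmult_lt_compat_l.
Qed.

(** Some tail [(z q^N)_oo] lies within distance 1 of 1, hence is nonzero, and the finite product in
    front of it has no zero factor. *)
Lemma qpoch_inf_neq_0 (q z : C) : (Cmod q < 1)%R ->
  (forall j : nat, z * q ^ j <> 1) -> qpoch_inf q z <> 0.
Proof.
intros Hq Hz. destruct (qpoch_inf_lim q z Hq 1%R) as [N HN]; [lra|].
specialize (HN N (le_n N)).
rewrite (qpoch_inf_fin q z N Hq). apply Cmult_neq_0.
- clear HN. induction N as [|N IH]; [exact C1_neq_0|].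
  change (qfin q z (S N)) with (qfin q z N * (1 - z * q ^ N)). apply Cmult_neq_0; [exact IH|].
  apply Csub_neq_0. intros E. now apply (Hz N).
- intros E. rewrite E in HN. replace (0 - 1) with (- (1)) in HN by ring.
  rewrite Cmod_m1 in HN. lra.
Qed.

Lemma qpoch_inf_qpow_le_0 (q : C) (n : Z) : q <> 0 -> (Cmod q < 1)%R -> (n <= 0)%Z ->
  qpoch_inf q (q ^^ n) = 0.
Proof.
intros Hq0 Hq Hn.
rewrite (qpoch_inf_fin q _ (S (Z.to_nat (- n))) Hq).
change (qfin q (q ^^ n) (S (Z.to_nat (- n)))) with
  (qfin q (q ^^ n) (Z.to_nat (- n)) * (1 - q ^^ n * q ^ Z.to_nat (- n))).
rewrite <- Cpowz_of_nat, <- Cpowz_add by exact Hq0.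
replace (n + Z.of_nat (Z.to_nat (- n)))%Z with 0%Z by lia. simpl. ring.
Qed.

(** * Parameters that are not powers of the nome *)

Lemma is_qpower_mul (q z : C) (k : Z) : q <> 0 -> is_qpower q (z * q ^^ k) -> is_qpower q z.
Proof.
intros Hq [n Hn]. exists (n - k)%Z. rewrite Cpowz_sub by exact Hq. rewrite <- Hn.
field. now apply Cpowz_neq_0.
Qed.

Lemma is_qpower_inv (q z : C) : q <> 0 -> z <> 0 -> is_qpower q (/ z) -> is_qpower q z.
Proof.
intros Hq Hz [n Hn]. exists (- n)%Z. rewrite Cpowz_opp by exact Hq. rewrite <- Hn.
field. exact Hz.
Qed.

Lemma qpoch_inf_nz (q z : C) (k : Z) : q <> 0 -> (Cmod q < 1)%R -> ~ is_qpower q z ->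
  qpoch_inf q (z * q ^^ k) <> 0.
Proof.
intros Hq0 Hq Hz. apply qpoch_inf_neq_0; [exact Hq|]. intros j E. apply Hz.
apply (is_qpower_mul q z (k + Z.of_nat j) Hq0). exists 0%Z.
rewrite Cpowz_add, Cpowz_of_nat by exact Hq0. rewrite Cmult_assoc. exact E.
Qed.

Lemma qpoch_inf_nz0 (q z : C) : q <> 0 -> (Cmod q < 1)%R -> ~ is_qpower q z ->
  qpoch_inf q z <> 0.
Proof.
intros Hq0 Hq Hz. replace z with (z * q ^^ 0) by (simpl; ring). now apply qpoch_inf_nz.
Qed.

Lemma qpoch_inf_stepz (q z : C) (k : Z) : q <> 0 -> (Cmod q < 1)%R ->
  qpoch_inf q (z * q ^^ k) = (1 - z * q ^^ k) * qpoch_inf q (z * q ^^ (k + 1)).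
Proof.
intros Hq0 Hq. rewrite qpoch_inf_step by exact Hq. rewrite Cpowz_succ by exact Hq0.
now rewrite Cmult_assoc.
Qed.

(** * The theta function and its quasi-periodicity *)

Definition th (q z : C) : C := qpoch_inf q z * qpoch_inf q (q / z).

(** Iterates [theta(z q) (- z) = theta(z)]; the power of [q] collects the factors produced along the
    way. The product form, without division, suits the induction in both directions. *)
Lemma th_shift (q z : C) (n : Z) : q <> 0 -> (Cmod q < 1)%R -> z <> 0 ->
  th q (z * q ^^ n) * ((- z) ^^ n * q ^^ tri n) = th q z.
Proof.
intros Hq0 Hq Hz. assert (Hmz := Copp_neq_0 z Hz).
revert n. apply Z_ind_succ.
- simpl. rewrite !Cmult_1_r. reflexivity.
- intros n. rewrite tri_succ, (Cpowz_succ (- z)), (Cpowz_add q (tri n)) by assumption.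
  assert (Hn := Cpowz_neq_0 q n Hq0).
  assert (E : th q (z * q ^^ (n + 1)) * (- z * q ^^ n) = th q (z * q ^^ n)).
  { unfold th. rewrite (qpoch_inf_stepz q z n Hq0 Hq).
    rewrite (qpoch_inf_step q (q / (z * q ^^ (n + 1))) Hq).
    rewrite !Cpowz_succ by exact Hq0.
    replace (q / (z * (q ^^ n * q)) * q) with (q / (z * q ^^ n)) by (field; tauto).
    field. tauto. }
  rewrite <- E. split; intros K; rewrite <- K; ring.
Qed.

Lemma th_neq_0 (q z : C) : q <> 0 -> (Cmod q < 1)%R -> z <> 0 -> ~ is_qpower q z -> th q z <> 0.
Proof.
intros Hq0 Hq Hz Hp. apply Cmult_neq_0; [now apply qpoch_inf_nz0|].
replace (q / z) with (/ z * q ^^ 1) by (simpl; field; exact Hz).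
apply qpoch_inf_nz; [exact Hq0 | exact Hq|]. intros H. apply Hp. now apply is_qpower_inv.
Qed.

(** * Growth estimates *)

(** [kappa] is the maximum of [(mu + 1) s - lam s^2], read off by completing the square. *)
Lemma quad_absorb (lam mu : R) : (0 < lam)%R ->
  exists kappa : R, forall s : R, (mu * s - lam * s ^ 2 <= kappa - s)%R.
Proof.
intros Hl. exists ((mu + 1) ^ 2 / (4 * lam))%R. intros s.
assert (H : (0 <= (2 * lam * s - (mu + 1)) ^ 2 / (4 * lam))%R).
{ apply Rdiv_le_0_compat; [apply pow2_ge_0 | lra]. }
replace ((2 * lam * s - (mu + 1)) ^ 2 / (4 * lam))%R
  with (lam * s ^ 2 - (mu + 1) * s + (mu + 1) ^ 2 / (4 * lam))%R in H by (field; lra).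
lra.
Qed.

(* [f = O(exp(mu * sz) * |q|^e)]: in a product the exponents [e] add up, and [e]
   only matters up to terms linear in [sz]. *)
Definition grow {I : Type} (q : C) (sz e : I -> R) (f : I -> C) : Prop :=
  exists kappa mu : R, (0 <= mu)%R /\
  forall i, (Cmod (f i) <= exp (kappa + mu * sz i + ln (Cmod q) * e i))%R.

Lemma ln_Cmod_neg (q : C) : q <> 0 -> (Cmod q < 1)%R -> (ln (Cmod q) < 0)%R.
Proof.
intros Hq0 Hq. rewrite <- ln_1. apply ln_increasing; [now apply Cmod_gt_0 | exact Hq].
Qed.

Lemma grow_mult {I : Type} (q : C) (sz e e' : I -> R) (f g : I -> C) :
  grow q sz e f -> grow q sz e' g -> grow q sz (fun i => e i + e' i)%R (fun i => f i * g i).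
Proof.
intros (k & m & Hm & H) (k' & m' & Hm' & H').
exists (k + k')%R, (m + m')%R. split; [lra|]. intros i. rewrite Cmod_mult.
replace (k + k' + (m + m') * sz i + ln (Cmod q) * (e i + e' i))%R
  with ((k + m * sz i + ln (Cmod q) * e i) + (k' + m' * sz i + ln (Cmod q) * e' i))%R by ring.
rewrite exp_plus. apply Rmult_le_compat; auto using Cmod_ge_0.
Qed.

Lemma grow_comp {I J : Type} (q : C) (sz e : I -> R) (szJ : J -> R) (f : I -> C) (phi : J -> I) (c : R) :
  grow q sz e f -> (forall j, (sz (phi j) <= szJ j + c)%R) ->
  grow q szJ (fun j => e (phi j)) (fun j => f (phi j)).
Proof.
intros (k & m & Hm & H) Hphi. exists (k + m * c)%R, m. split; [exact Hm|].
intros j. apply Rle_trans with (1 := H (phi j)). apply exp_le_compat.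
assert (K := Rmult_le_compat_l m _ _ Hm (Hphi j)). lra.
Qed.

Lemma grow_bounded {I : Type} (q : C) (sz : I -> R) (f : I -> C) (K : R) :
  (forall i, (Cmod (f i) <= K)%R) -> grow q sz (fun _ => 0%R) f.
Proof.
intros H. exists K, 0%R. split; [lra|]. intros i. apply Rle_trans with (1 := H i).
replace (K + 0 * sz i + ln (Cmod q) * 0)%R with K by ring.
assert (E := exp_ineq1_le K). lra.
Qed.

Lemma grow_qpow {I : Type} (q : C) (sz : I -> R) (h : I -> Z) : q <> 0 ->
  grow q sz (fun i => IZR (h i)) (fun i => q ^^ h i).
Proof.
intros Hq. exists 0%R, 0%R. split; [lra|]. intros i. rewrite Cmod_Cpowz by exact Hq.
right. f_equal. ring.
Qed.

Definition zabs (n : Z) : R := Rabs (IZR n).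

Lemma zabs_add (m n : Z) : (zabs (m + n) <= zabs m + zabs n)%R.
Proof. unfold zabs. rewrite plus_IZR. apply Rabs_triang. Qed.

Lemma zabs_opp (n : Z) : zabs (- n) = zabs n.
Proof. unfold zabs. rewrite opp_IZR. apply Rabs_Ropp. Qed.

Lemma mult_IZR_le_zabs (n : Z) (c : R) : (IZR n * c <= Rabs c * zabs n)%R.
Proof.
unfold zabs. rewrite Rmult_comm, <- Rabs_mult. apply Rle_abs.
Qed.

Lemma grow_pow (q z : C) : z <> 0 -> grow q zabs (fun _ => 0%R) (fun n => z ^^ n).
Proof.
intros Hz. exists 0%R, (Rabs (ln (Cmod z))). split; [apply Rabs_pos|].
intros n. rewrite Cmod_Cpowz by exact Hz. apply exp_le_compat.
assert (H := mult_IZR_le_zabs n (ln (Cmod z))). lra.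
Qed.

(** Since [ln (Cmod q)] is negative, a quadratic lower bound on the exponent of [|q|] is a Gaussian
    upper bound on the modulus, which absorbs every term linear in [sz]. *)
Lemma grow_decay {I : Type} (q : C) (sz e : I -> R) (f : I -> C) (c d : R) :
  q <> 0 -> (Cmod q < 1)%R -> (0 < c)%R -> grow q sz e f ->
  (forall i, (c * sz i ^ 2 - d * sz i <= e i)%R) ->
  exists M : R, forall i, (Cmod (f i) <= M * exp (- sz i))%R.
Proof.
intros Hq0 Hq Hc (k & m & Hm & H) He. assert (HL := ln_Cmod_neg q Hq0 Hq).
set (L := ln (Cmod q)) in *.
destruct (quad_absorb (- L * c) (m - L * d)) as [kap Hk]; [nra|].
exists (exp (k + kap)). intros i. apply Rle_trans with (1 := H i).
rewrite <- exp_plus. apply exp_le_compat. specialize (Hk (sz i)). specialize (He i).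
assert (L * e i <= L * (c * sz i ^ 2 - d * sz i))%R by nra. lra.
Qed.

(** For a general [z] the products [(z q^n)_oo] blow up as [n] tends to [-oo]; on powers of [q] they
    vanish there instead, so one bound serves all of [Z]. *)
Lemma qpoch_inf_qpow_bound (q : C) (n : Z) : q <> 0 -> (Cmod q < 1)%R ->
  (Cmod (qpoch_inf q (q ^^ n)) <= qbnd q 1)%R.
Proof.
intros Hq0 Hq. destruct (Z_le_gt_dec n 0) as [Hn|Hn].
- rewrite qpoch_inf_qpow_le_0 by assumption. rewrite Cmod_0. left. apply exp_pos.
- apply Rle_trans with (1 := qpoch_inf_bound q _ Hq). apply qbnd_le; [exact Hq|].
  replace n with (Z.of_nat (Z.to_nat n)) by lia. rewrite Cpowz_of_nat, Cmod_pow, Cmod_1.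
  apply pow_lt_1_bounds. split; [apply Cmod_ge_0 | exact Hq].
Qed.

Lemma qpoch_inf_bound_pow (q z : C) (n : nat) : (Cmod q < 1)%R ->
  (Cmod (qpoch_inf q (z * q ^ n)) <= qbnd q z)%R.
Proof.
intros Hq. apply Rle_trans with (1 := qpoch_inf_bound q _ Hq).
apply qbnd_le; [exact Hq|]. now apply Cmod_mult_pow_le.
Qed.

(** The reciprocal equals the finite product [qfin q z n] divided by the fixed value [(z)_oo], hence
    a bound uniform in [n]. *)
Lemma qpoch_inf_inv_bound (q z : C) (n : nat) : (Cmod q < 1)%R -> qpoch_inf q z <> 0 ->
  (Cmod (/ qpoch_inf q (z * q ^ n)) <= qbnd q z / Cmod (qpoch_inf q z))%R.
Proof.
intros Hq Hz. assert (E := qpoch_inf_fin q z n Hq).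
assert (Hf : qfin q z n <> 0) by (intros E0; apply Hz; rewrite E, E0; ring).
assert (Hn : qpoch_inf q (z * q ^ n) <> 0) by (intros E0; apply Hz; rewrite E, E0; ring).
replace (/ qpoch_inf q (z * q ^ n)) with (qfin q z n / qpoch_inf q z)
  by (rewrite E; field; tauto).
rewrite Cmod_div by exact Hz. apply Rmult_le_compat_r.
- left. apply Rinv_0_lt_compat. now apply Cmod_gt_0.
- now apply qfin_bound.
Qed.

(* By quasi-periodicity of theta, [|(z q^n)_oo|] behaves like [|q|^(-n^2/2)] up to
   a geometric factor as [n] tends to [-oo], and is bounded as [n] tends to [+oo]. *)
Definition negsq (n : Z) : R := if Z_lt_le_dec n 0 then (IZR n ^ 2 / 2)%R else 0%R.

Lemma IZR_tri (n : Z) : IZR (tri n) = ((IZR n ^ 2 - IZR n) / 2)%R.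
Proof.
assert (H := f_equal IZR (tri_double n)). rewrite !mult_IZR, minus_IZR in H. lra.
Qed.

Lemma th_shift_neg (q z : C) (n : Z) : q <> 0 -> (Cmod q < 1)%R -> z <> 0 ->
  qpoch_inf q (z * q ^^ n) * qpoch_inf q (q / z * q ^^ (- n)) * ((- z) ^^ n * q ^^ tri n) = th q z.
Proof.
intros Hq0 Hq Hz. rewrite <- (th_shift q z n Hq0 Hq Hz). unfold th. do 3 f_equal.
rewrite Cpowz_opp by exact Hq0. field. split; [now apply Cpowz_neq_0 | exact Hz].
Qed.

Lemma grow_theta_factor (q z : C) : q <> 0 -> z <> 0 ->
  grow q zabs (fun n => IZR n ^ 2 / 2)%R (fun n => (- z) ^^ n * q ^^ tri n).
Proof.
intros Hq0 Hz.
exists 0%R, (Rabs (ln (Cmod z)) + Rabs (ln (Cmod q) / 2))%R.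
assert (H1 := Rabs_pos (ln (Cmod z))). assert (H2 := Rabs_pos (ln (Cmod q) / 2)).
split; [lra|]. intros n.
rewrite Cmod_mult, !Cmod_Cpowz, Cmod_opp, <- exp_plus, IZR_tri by (try apply Copp_neq_0; assumption).
apply exp_le_compat. assert (H := mult_IZR_le_zabs n (ln (Cmod z))).
assert (H' := mult_IZR_le_zabs (- n) (ln (Cmod q) / 2)). rewrite zabs_opp, opp_IZR in H'. lra.
Qed.

Lemma grow_theta_factor_inv (q z : C) : q <> 0 -> z <> 0 ->
  grow q zabs (fun n => - (IZR n ^ 2 / 2))%R (fun n => / ((- z) ^^ n * q ^^ tri n)).
Proof.
intros Hq0 Hz.
exists 0%R, (Rabs (ln (Cmod z)) + Rabs (ln (Cmod q) / 2))%R.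
assert (H1 := Rabs_pos (ln (Cmod z))). assert (H2 := Rabs_pos (ln (Cmod q) / 2)).
split; [lra|]. intros n.
assert (Hmz := Copp_neq_0 z Hz).
rewrite Cmod_inv by (apply Cmult_neq_0; now apply Cpowz_neq_0).
rewrite Cmod_mult, !Cmod_Cpowz, Cmod_opp, <- exp_plus, IZR_tri, <- exp_Ropp by assumption.
apply exp_le_compat. assert (H := mult_IZR_le_zabs (- n) (ln (Cmod z))).
rewrite zabs_opp, opp_IZR in H.
assert (H' := mult_IZR_le_zabs n (ln (Cmod q) / 2)). lra.
Qed.

(** Gluing of a bounded regime [B] and a regime comparable to a known function [g]; the constant is
    absorbed through [k0 <= exp k0]. *)
Lemma grow_two_regimes {I : Type} (q : C) (sz e e' : I -> R) (f g : I -> C) (k0 : R) (B : I -> Prop) :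
  grow q sz e' g -> (forall i, (0 <= sz i)%R) ->
  (forall i, B i -> (Cmod (f i) <= k0)%R /\ e i = 0%R) ->
  (forall i, ~ B i -> (Cmod (f i) <= k0 * Cmod (g i))%R /\ e i = e' i) ->
  (forall i, B i \/ ~ B i) -> (0 <= k0)%R ->
  grow q sz e f.
Proof.
intros (k & m & Hm & H) Hsz H1 H2 HB Hk0.
exists (k0 + Rabs k)%R, m. split; [exact Hm|]. intros i.
assert (E := exp_ineq1_le k0). assert (Hk := Rle_abs k). assert (Hk' := Rabs_pos k).
destruct (HB i) as [Bi|Bi].
- destruct (H1 i Bi) as [Ha ->]. apply Rle_trans with (exp k0); [lra|].
  apply exp_le_compat. assert (K := Rmult_le_pos m _ Hm (Hsz i)). lra.
- destruct (H2 i Bi) as [Ha ->]. apply Rle_trans with (1 := Ha).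
  apply Rle_trans with (exp k0 * exp (k + m * sz i + ln (Cmod q) * e' i))%R.
  + apply Rmult_le_compat; auto using Cmod_ge_0. lra.
  + rewrite <- exp_plus. apply exp_le_compat. lra.
Qed.

Lemma zabs_pos (n : Z) : (0 <= zabs n)%R.
Proof. apply Rabs_pos. Qed.

Lemma is_qpower_theta (q z : C) : q <> 0 -> z <> 0 -> ~ is_qpower q z -> ~ is_qpower q (q / z).
Proof.
intros Hq0 Hz Hp H. apply Hp. apply is_qpower_inv; [exact Hq0 | exact Hz|].
apply (is_qpower_mul q _ 1 Hq0). replace (/ z * q ^^ 1) with (q / z); [exact H|].
simpl. field. exact Hz.
Qed.

Lemma grow_qpoch (q z : C) : q <> 0 -> (Cmod q < 1)%R -> z <> 0 -> ~ is_qpower q z ->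
  grow q zabs (fun n => - negsq n)%R (fun n => qpoch_inf q (z * q ^^ n)).
Proof.
intros Hq0 Hq Hz Hp.
assert (Hp' := is_qpower_theta q z Hq0 Hz Hp).
assert (Hnz := qpoch_inf_nz0 q (q / z) Hq0 Hq Hp').
assert (Hc : (0 <= Cmod (th q z) * (qbnd q (q / z) / Cmod (qpoch_inf q (q / z))))%R).
{ apply Rmult_le_pos; [apply Cmod_ge_0|].
  apply Rdiv_le_0_compat; [left; apply exp_pos | now apply Cmod_gt_0]. }
assert (Hb : (0 < qbnd q z)%R) by apply exp_pos.
apply (grow_two_regimes q zabs _ _ _ _
  (Cmod (th q z) * (qbnd q (q / z) / Cmod (qpoch_inf q (q / z))) + qbnd q z)%R
  (fun n => (0 <= n)%Z) (grow_theta_factor_inv q z Hq0 Hz) zabs_pos).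
- intros n Hn. split.
  + replace n with (Z.of_nat (Z.to_nat n)) by lia. rewrite Cpowz_of_nat.
    assert (H := qpoch_inf_bound_pow q z (Z.to_nat n) Hq). lra.
  + unfold negsq. destruct (Z_lt_le_dec n 0); [lia | ring].
- intros n Hn. split.
  + assert (E := th_shift_neg q z n Hq0 Hq Hz).
    replace (- n)%Z with (Z.of_nat (Z.to_nat (- n))) in E by lia. rewrite Cpowz_of_nat in E.
    assert (HP := qpoch_inf_inv_bound q (q / z) (Z.to_nat (- n)) Hq Hnz).
    set (g := (- z) ^^ n * q ^^ tri n) in *.
    assert (Hg : g <> 0).
    { apply Cmult_neq_0; apply Cpowz_neq_0; [now apply Copp_neq_0 | exact Hq0]. }
    assert (HX : qpoch_inf q (q / z * q ^ Z.to_nat (- n)) <> 0).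
    { rewrite <- Cpowz_of_nat. now apply qpoch_inf_nz. }
    set (X := qpoch_inf q (q / z * q ^ Z.to_nat (- n))) in *.
    (* For [n < 0] quasi-periodicity trades [(z q^n)_oo] for the reciprocals of a product with
       argument [q / z] times a nonnegative power of [q], which is under control, and of the
       explicit factor [g]. *)
    replace (qpoch_inf q (z * q ^^ n)) with (th q z * / X * / g) by (rewrite <- E; field; tauto).
    rewrite !Cmod_mult. apply Rmult_le_compat_r; [apply Cmod_ge_0|].
    assert (K := Rmult_le_compat_l _ _ _ (Cmod_ge_0 (th q z)) HP). lra.
  + unfold negsq. destruct (Z_lt_le_dec n 0); [reflexivity | lia].
- intros n. lia.
- lra.
Qed.

Lemma grow_qpoch_inv (q z : C) : q <> 0 -> (Cmod q < 1)%R -> z <> 0 -> ~ is_qpower q z ->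
  grow q zabs negsq (fun n => / qpoch_inf q (z * q ^^ n)).
Proof.
intros Hq0 Hq Hz Hp.
assert (Hth := th_neq_0 q z Hq0 Hq Hz Hp).
assert (Hnz := qpoch_inf_nz0 q z Hq0 Hq Hp).
assert (Hc : (0 <= Cmod (/ th q z) * qbnd q (q / z))%R).
{ apply Rmult_le_pos; [apply Cmod_ge_0 | left; apply exp_pos]. }
assert (Hb : (0 <= qbnd q z / Cmod (qpoch_inf q z))%R).
{ apply Rdiv_le_0_compat; [left; apply exp_pos | now apply Cmod_gt_0]. }
apply (grow_two_regimes q zabs _ _ _ _
  (Cmod (/ th q z) * qbnd q (q / z) + qbnd q z / Cmod (qpoch_inf q z))%R
  (fun n => (0 <= n)%Z) (grow_theta_factor q z Hq0 Hz) zabs_pos).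
- intros n Hn. split.
  + replace n with (Z.of_nat (Z.to_nat n)) by lia. rewrite Cpowz_of_nat.
    assert (H := qpoch_inf_inv_bound q z (Z.to_nat n) Hq Hnz). lra.
  + unfold negsq. destruct (Z_lt_le_dec n 0); [lia | ring].
- intros n Hn. split.
  + assert (E := th_shift_neg q z n Hq0 Hq Hz).
    replace (- n)%Z with (Z.of_nat (Z.to_nat (- n))) in E by lia. rewrite Cpowz_of_nat in E.
    assert (HP := qpoch_inf_bound_pow q (q / z) (Z.to_nat (- n)) Hq).
    assert (HY := qpoch_inf_nz q z n Hq0 Hq Hp).
    set (g := (- z) ^^ n * q ^^ tri n) in *.
    set (X := qpoch_inf q (q / z * q ^ Z.to_nat (- n))) in *.
    replace (/ qpoch_inf q (z * q ^^ n)) with (/ th q z * X * g).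
    2:{ rewrite <- E in Hth |- *. field. repeat split; try assumption;
        intros E0; apply Hth; rewrite E0; ring. }
    rewrite !Cmod_mult. apply Rmult_le_compat_r; [apply Cmod_ge_0|].
    assert (K := Rmult_le_compat_l _ _ _ (Cmod_ge_0 (/ th q z)) HP). lra.
  + unfold negsq. destruct (Z_lt_le_dec n 0); [reflexivity | lia].
- intros n. lia.
- lra.
Qed.

(** * Summation formulas *)

Lemma ZSeries_correct (f : Z -> C) : ex_zseries f -> is_zseries f (ZSeries f).
Proof. intros [s H]. now rewrite (is_zseries_unique f s H). Qed.

Lemma Cmod_Cpow_le_exp (z : C) (B : R) (n : nat) : (Cmod z <= B)%R ->
  (Cmod (z ^ n) <= exp (B * INR n))%R.
Proof.
intros H. rewrite Cmod_pow. apply Rle_trans with (B ^ n)%R.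
- apply pow_incr. split; [apply Cmod_ge_0 | exact H].
- assert (HB : (0 <= B)%R) by (apply Rle_trans with (2 := H), Cmod_ge_0).
  apply Rle_trans with (exp B ^ n)%R.
  + apply pow_incr. split; [exact HB|]. assert (E := exp_ineq1_le B). lra.
  + right. induction n as [|n IH]; [simpl; now rewrite Rmult_0_r, exp_0|].
    rewrite S_INR, Rmult_plus_distr_l, exp_plus, <- IH, Rmult_1_r. simpl. ring.
Qed.

Lemma geo_tri_bound (q : C) (B : R) : q <> 0 -> (Cmod q < 1)%R ->
  exists M : R, forall (D : C) (k : nat), (Cmod D <= B)%R ->
  (Cmod (D ^^ Z.of_nat k * q ^^ tri (Z.of_nat k)) <= M * exp (- INR k))%R.
Proof.
intros Hq0 Hq. assert (HL := ln_Cmod_neg q Hq0 Hq). set (L := ln (Cmod q)) in *.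
destruct (quad_absorb (- L / 2) (B - L / 2)) as [kap Hk]; [lra|].
exists (exp kap). intros D k HD.
rewrite Cmod_mult, Cpowz_of_nat, Cmod_Cpowz by exact Hq0. fold L.
apply Rle_trans with (exp (B * INR k) * exp (IZR (tri (Z.of_nat k)) * L))%R.
- apply Rmult_le_compat_r; [left; apply exp_pos | now apply Cmod_Cpow_le_exp].
- rewrite <- !exp_plus. apply exp_le_compat. rewrite IZR_tri, <- INR_IZR_INZ.
  specialize (Hk (INR k)). lra.
Qed.

(** [M] is chosen before [c] and [D], so a single majorant serves the whole sequence of parameters
    shrinking to 0, as Tannery's theorem requires. *)
Lemma expdec_uni (q : C) (B K : R) : q <> 0 -> (Cmod q < 1)%R -> 
  exists M : R, forall (c : Z -> C) (D : C),
  (forall k, (k < 0)%Z -> c k = 0) ->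
  (forall k : nat, (Cmod (c (Z.of_nat k)) <= K)%R) -> (Cmod D <= B)%R ->
  expdec M (fun k => c k * (D ^^ k * q ^^ tri k)).
Proof.
intros Hq0 Hq. destruct (geo_tri_bound q B Hq0 Hq) as [M HM].
exists (K * M)%R. intros c D Hc HcK HD k.
destruct (Z_lt_le_dec k 0) as [Hk|Hk].
- rewrite Hc, Cmult_0_l, Cmod_0 by exact Hk.
  assert (H0 := HM D 0%nat HD). assert (G := Cmod_ge_0 (D ^^ Z.of_nat 0 * q ^^ tri (Z.of_nat 0))).
  simpl INR in H0. rewrite Ropp_0, exp_0 in H0.
  assert (G' := Rle_trans _ _ _ (Cmod_ge_0 _) (HcK 0%nat)).
  apply Rmult_le_pos; [apply Rmult_le_pos; lra | left; apply exp_pos].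
- replace k with (Z.of_nat (Z.to_nat k)) by lia. set (j := Z.to_nat k).
  rewrite Cmod_mult, <- INR_IZR_INZ, Rabs_pos_eq, Rmult_assoc by apply pos_INR.
  apply Rmult_le_compat; try apply Cmod_ge_0; [apply HcK | now apply HM].
Qed.

(** The limit series of the iterations below: once the parameter has reached 0, only the term
    [k = 0] survives. *)
Lemma is_zseries_delta (c : C) : is_zseries (fun k => if Z.eqb k 0 then c else 0) c.
Proof.
apply is_zseries_Cser. exists c, 0. split; [|split; [|ring]].
- apply is_Clim_ext with (2 := is_Clim_const c). intros n.
  induction n as [|n IH]; [now rewrite Csum_O|]. rewrite Csum_Sn, <- IH. simpl. ring.
- apply is_Clim_ext with (2 := is_Clim_const 0). intros n.
  induction n as [|n IH]; [now rewrite Csum_O|]. rewrite Csum_Sn, <- IH. simpl. ring.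
Qed.

(** A summable [U] has the same sum as its shift, so the differences add up to 0 and no boundary
    term has to be computed. *)
Lemma is_zseries_telescope (f g U : Z -> C) (c s t u : C) :
  (forall k, f k - c * g k = U (k + 1)%Z - U k) ->
  is_zseries f s -> is_zseries g t -> is_zseries U u -> s = c * t.
Proof.
intros E Hf Hg HU.
assert (H1 := is_zseries_minus _ _ _ _ Hf (is_zseries_scal c _ _ Hg)).
assert (H2 := is_zseries_minus _ _ _ _ (is_zseries_succ _ _ HU) HU).
assert (H3 := is_zseries_uniq _ _ _ H1 (is_zseries_ext _ _ _ (fun k => eq_sym (E k)) H2)).
replace s with ((s - c * t) + c * t) by ring. rewrite H3. ring.
Qed.

Lemma qpoch_inf_qpow_stepz (q : C) (k : Z) : q <> 0 -> (Cmod q < 1)%R ->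
  qpoch_inf q (q ^^ k) = (1 - q ^^ k) * qpoch_inf q (q ^^ (k + 1)).
Proof.
intros Hq0 Hq. assert (H := qpoch_inf_stepz q 1 k Hq0 Hq). now rewrite !Cmult_1_l in H.
Qed.

Lemma is_Clim_pow_pow (q : C) (k : nat) : (Cmod q < 1)%R ->
  is_Clim (fun N => (q ^ N) ^ k) (if Z.eqb (Z.of_nat k) 0 then 1 else 0).
Proof.
intros Hq. destruct k as [|k]; [apply (is_Clim_const 1)|].
apply is_Clim_ext with (u := fun N => (q ^ S k) ^ N).
- intros N. now rewrite <- !Cpow_mult_r, Nat.mul_comm.
- apply is_Clim_pow_0. rewrite Cmod_pow. simpl.
  assert (P := pow_lt_1_bounds (Cmod q) k ltac:(split; [apply Cmod_ge_0 | exact Hq])).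
  assert (G := Cmod_ge_0 q). nra.
Qed.

(* The factor [(q^(k+1))_oo = (q)_oo / (q)_k] vanishes for [k < 0], so one-sided
   series can be handled as bilateral ones and telescoping has no boundary term. *)
Definition phi_term (q D E : C) (k : Z) : C :=
  qpoch_inf q (q ^^ (k + 1)) * qpoch_inf q (D * E * q ^^ k) / qpoch_inf q (E * q ^^ k)
  * ((- D) ^^ k * q ^^ tri k).

(** The exponent [j] is left free because the bound is used both for the term ([j = k + 1]) and for
    its telescoping certificate ([j = k]). *)
Lemma phi_coef_bound (q D D' E : C) (j : Z) (k : nat) : q <> 0 -> (Cmod q < 1)%R ->
  qpoch_inf q E <> 0 -> (Cmod D' <= Cmod D)%R ->
  (Cmod (qpoch_inf q (q ^^ j) * qpoch_inf q (D' * E * q ^^ Z.of_nat k) / qpoch_inf q (E * q ^^ Z.of_nat k))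
   <= qbnd q 1 * qbnd q (D * E) * (qbnd q E / Cmod (qpoch_inf q E)))%R.
Proof.
intros Hq0 Hq HE HD. unfold Cdiv. rewrite !Cmod_mult, Cpowz_of_nat.
apply Rmult_le_compat; [apply Rmult_le_pos; apply Cmod_ge_0 | apply Cmod_ge_0 | |].
- apply Rmult_le_compat; try apply Cmod_ge_0; [now apply qpoch_inf_qpow_bound|].
  apply Rle_trans with (1 := qpoch_inf_bound_pow q _ k Hq). apply qbnd_le; [exact Hq|].
  rewrite !Cmod_mult. apply Rmult_le_compat_r; [apply Cmod_ge_0 | exact HD].
- now apply qpoch_inf_inv_bound.
Qed.

Lemma phi_term_expdec (q D E : C) : q <> 0 -> (Cmod q < 1)%R -> qpoch_inf q E <> 0 ->
  exists M, forall D', (Cmod D' <= Cmod D)%R -> expdec M (phi_term q D' E).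
Proof.
intros Hq0 Hq HE.
destruct (expdec_uni q (Cmod D) (qbnd q 1 * qbnd q (D * E) * (qbnd q E / Cmod (qpoch_inf q E))) Hq0 Hq)
  as [M HM].
exists M. intros D' HD. apply HM.
- intros k Hk. rewrite qpoch_inf_qpow_le_0; [unfold Cdiv; ring | assumption | assumption | lia].
- intros k. now apply phi_coef_bound.
- now rewrite Cmod_opp.
Qed.

(** [U] is a certificate in the style of Gosper's algorithm, a rational multiple of the term. After
    removal of the common products, with [s = q^k], the claim is [(1 - D E s) - (1 - D) s = D s (1 -
    E s) + (1 - s) (1 - D E s)]. *)
Lemma phi_term_step (q D E : C) (k : Z) : q <> 0 -> (Cmod q < 1)%R -> D <> 0 ->
  (forall k, qpoch_inf q (E * q ^^ k) <> 0) ->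
  let U := fun k => - (qpoch_inf q (q ^^ k) * qpoch_inf q (D * E * q ^^ k) / qpoch_inf q (E * q ^^ k))
                    * ((- D) ^^ k * q ^^ tri k) in
  phi_term q D E k - (1 - D) * phi_term q (D * q) E k = U (k + 1)%Z - U k.
Proof.
intros Hq0 Hq HD HE U. unfold U, phi_term.
assert (HmD := Copp_neq_0 D HD).
replace (D * q * E * q ^^ k) with (D * E * q ^^ (k + 1)) by (rewrite Cpowz_succ by exact Hq0; ring).
replace (- (D * q)) with ((- D) * q) by ring.
rewrite (Cpowz_mult_l (- D) q), tri_succ, (Cpowz_add q (tri k)), (Cpowz_succ (- D)) by assumption.
rewrite (qpoch_inf_qpow_stepz q k Hq0 Hq).
rewrite (qpoch_inf_stepz q (D * E) k Hq0 Hq).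
assert (H0 := HE k). assert (H1 := HE (k + 1)%Z).
rewrite (qpoch_inf_stepz q E k Hq0 Hq) in H0 |- *.
assert (H2 : 1 - E * q ^^ k <> 0) by (intros E0; apply H0; rewrite E0; ring).
set (P1 := qpoch_inf q (q ^^ (k + 1))). set (P2 := qpoch_inf q (D * E * q ^^ (k + 1))).
set (P3 := qpoch_inf q (E * q ^^ (k + 1))) in *.
set (t := q ^^ tri k). set (w := (- D) ^^ k). set (s := q ^^ k) in *.
field. split; assumption.
Qed.

(** In standard notation this is [1phi1(E; D E; q, D) = (D)_oo / (D E)_oo], multiplied by
    [(q, D E)_oo / (E)_oo] so that no condition on [D E] arises. The recurrence
    [F(D) = (1 - D) F(D q)] builds up the product [(D)_oo]. *)
Lemma phi11_sum (q D E : C) : q <> 0 -> (Cmod q < 1)%R -> D <> 0 ->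
  (forall k, qpoch_inf q (E * q ^^ k) <> 0) ->
  is_zseries (phi_term q D E) (qpoch_inf q q * qpoch_inf q D / qpoch_inf q E).
Proof.
intros Hq0 Hq HD HE.
assert (HE0 : qpoch_inf q E <> 0).
{ intros E0. apply (HE 0%Z). simpl. now rewrite Cmult_1_r. }
destruct (phi_term_expdec q D E Hq0 Hq HE0) as [M HM].
assert (HDq : forall N, (Cmod (D * q ^ N) <= Cmod D)%R) by (intros N; now apply Cmod_mult_pow_le).
set (F := fun N => ZSeries (phi_term q (D * q ^ N) E)).
assert (HF : forall N, is_zseries (phi_term q (D * q ^ N) E) (F N)).
{ intros N. apply ZSeries_correct. apply (expdec_ex M). now apply HM. }
assert (Hrec : forall N, F N = (1 - D * q ^ N) * F (S N)).
{ intros N. assert (HDN : D * q ^ N <> 0) by (apply Cmult_neq_0; [exact HD | now apply Cpow_nz]).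
  assert (HU : ex_zseries (fun k => - (qpoch_inf q (q ^^ k) * qpoch_inf q (D * q ^ N * E * q ^^ k)
     / qpoch_inf q (E * q ^^ k)) * ((- (D * q ^ N)) ^^ k * q ^^ tri k))).
  { destruct (expdec_uni q (Cmod D) (qbnd q 1 * qbnd q (D * E) * (qbnd q E / Cmod (qpoch_inf q E))) Hq0 Hq)
      as [M' HM'].
    apply (expdec_ex M'). apply HM'.
    - intros k Hk. rewrite qpoch_inf_qpow_le_0; [unfold Cdiv; ring | assumption | assumption | lia].
    - intros k. rewrite Cmod_opp. now apply phi_coef_bound.
    - now rewrite Cmod_opp. }
  destruct HU as [u HU].
  apply (is_zseries_telescope _ _ _ _ _ _ u (fun k => phi_term_step q (D * q ^ N) E k Hq0 Hq HDN HE)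
    (HF N)); [|exact HU].
  replace (D * q ^ N * q) with (D * q ^ S N) by (simpl; ring). apply HF. }
assert (Hfin : forall N, F 0%nat = qfin q D N * F N).
{ induction N as [|N IH]; [change (qfin q D 0) with (RtoC 1); ring|].
  rewrite IH, Hrec. change (qfin q D (S N)) with (qfin q D N * (1 - D * q ^ N)). ring. }
destruct (tannery (fun N => phi_term q (D * q ^ N) E)
  (fun k => if Z.eqb k 0 then qpoch_inf q q / qpoch_inf q E else 0) F M) as (t & Ht & HFt).
- intros N. now apply HM.
- intros k. destruct (Z_lt_le_dec k 0) as [Hk|Hk].
  + replace (Z.eqb k 0) with false by (symmetry; apply Z.eqb_neq; lia).
    apply is_Clim_ext with (2 := is_Clim_const 0). intros N. unfold phi_term.
    rewrite qpoch_inf_qpow_le_0; [unfold Cdiv; ring | assumption | assumption | lia].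
  + set (j := Z.to_nat k). replace k with (Z.of_nat j) by lia.
    (* [c] collects the factors free of [N]. What remains is [(D E q^j q^N)_oo], tending to 1, and
       [(q^N)^j], which selects [j = 0] in the limit. *)
    set (c := qpoch_inf q (q ^^ (Z.of_nat j + 1)) / qpoch_inf q (E * q ^^ Z.of_nat j)
              * ((- D) ^ j * q ^^ tri (Z.of_nat j))).
    assert (L := is_Clim_scal c _ _ (is_Clim_mult _ _ _ _
      (qpoch_inf_lim q (D * E * q ^ j) Hq) (is_Clim_pow_pow q j Hq))).
    replace (if (Z.of_nat j =? 0)%Z then qpoch_inf q q / qpoch_inf q E else 0)
      with (c * (1 * (if (Z.of_nat j =? 0)%Z then 1 else 0))).
    * apply is_Clim_ext with (2 := L). intros N. unfold phi_term, c.
      rewrite (Cpowz_of_nat (- (D * q ^ N))).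
      replace (- (D * q ^ N)) with ((- D) * q ^ N) by ring. rewrite Cpow_mult_l.
      replace (D * q ^ N * E * q ^^ Z.of_nat j) with (D * E * q ^ j * q ^ N)
        by (rewrite Cpowz_of_nat; ring).
      unfold Cdiv. ring.
    * unfold c. clearbody j. destruct j as [|j].
      -- change (tri (Z.of_nat 0)) with 0%Z. simpl. rewrite !Cmult_1_r. reflexivity.
      -- simpl. ring.
- exact HF.
- assert (Et := is_zseries_uniq _ _ _ Ht (is_zseries_delta _)). subst t.
  assert (E0 : F 0%nat = qpoch_inf q D * (qpoch_inf q q / qpoch_inf q E)).
  { apply is_Clim_unique with (u := fun N => qfin q D N * F N).
    - apply is_Clim_ext with (2 := is_Clim_const (F 0%nat)). exact Hfin.
    - apply is_Clim_mult; [now apply qfin_cvg | exact HFt]. }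
  assert (HF0 := HF 0%nat). rewrite E0 in HF0. simpl in HF0. rewrite Cmult_1_r in HF0.
  replace (qpoch_inf q q * qpoch_inf q D / qpoch_inf q E)
    with (qpoch_inf q D * (qpoch_inf q q / qpoch_inf q E)) by (unfold Cdiv; ring).
  exact HF0.
Qed.

(* The 1phi1 sum at [E = 0], [D = z q^(-N)] and [k = n + N], for [N -> oo]. *)
Lemma jacobi_triple_product (q z : C) : q <> 0 -> (Cmod q < 1)%R -> z <> 0 ->
  is_zseries (fun n => (- z) ^^ n * q ^^ tri n) (qpoch_inf q q * th q z).
Proof.
intros Hq0 Hq Hz. assert (Hmz := Copp_neq_0 z Hz).
assert (Hdec : exists M, forall n, (Cmod ((- z) ^^ n * q ^^ tri n) <= M * exp (- zabs n))%R).
{ apply (grow_decay q zabs (fun n => IZR n ^ 2 / 2)%R _ (1 / 2) 0 Hq0 Hq); [lra | now apply grow_theta_factor |].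
  intros n. unfold zabs. rewrite <- (pow2_abs (IZR n)). lra. }
destruct Hdec as [M HM].
set (D := fun N : nat => z * q ^^ (- Z.of_nat N)).
assert (HD : forall N, D N <> 0) by (intros N; apply Cmult_neq_0; [exact Hz | now apply Cpowz_neq_0]).
(* [K N] compensates the factor free of [n] that the substitution [D = z q^(-N)], [k = n + N] brings
   into the general term. *)
set (K := fun N : nat => (- z) ^^ (- Z.of_nat N) * q ^^ tri (- Z.of_nat N)).
destruct (tannery
  (fun N n => qpoch_inf q (q ^^ (n + Z.of_nat N + 1)) * ((- z) ^^ n * q ^^ tri n))
  (fun n => (- z) ^^ n * q ^^ tri n)
  (fun N => K N * (qpoch_inf q q * qpoch_inf q (D N) / qpoch_inf q 0)) (qbnd q 1 * M)) as (t & Ht & HL).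
- intros N n. rewrite Cmod_mult, Rmult_assoc. apply Rmult_le_compat; try apply Cmod_ge_0.
  + now apply qpoch_inf_qpow_bound.
  + apply HM.
- intros n. replace ((- z) ^^ n * q ^^ tri n) with (1 * ((- z) ^^ n * q ^^ tri n)) at 1 by ring.
  apply is_Clim_mult; [|apply is_Clim_const].
  apply is_Clim_ext with (2 := qpoch_inf_lim q (q ^^ (n + 1)) Hq).
  intros N. rewrite <- Cpowz_of_nat, <- Cpowz_add by exact Hq0. do 2 f_equal. lia.
- intros N.
  assert (HS := phi11_sum q (D N) 0 Hq0 Hq (HD N)).
  assert (H0 : forall k : Z, qpoch_inf q (0 * q ^^ k) <> 0).
  { intros k. rewrite Cmult_0_l, qpoch_inf_0 by exact Hq. exact C1_neq_0. }
  specialize (HS H0). apply (is_zseries_shift _ _ (Z.of_nat N)) in HS.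
  apply (is_zseries_scal (K N)) in HS. apply is_zseries_ext with (2 := HS).
  intros n. unfold phi_term, K, D.
  rewrite Cmult_0_r, !Cmult_0_l, qpoch_inf_0 by exact Hq.
  replace (- (z * q ^^ (- Z.of_nat N))) with ((- z) * q ^^ (- Z.of_nat N)) by ring.
  rewrite Cpowz_mult_l, <- Cpowz_mult by (try apply Cpowz_neq_0; assumption).
  assert (E1 : q ^^ (- Z.of_nat N * (n + Z.of_nat N)) * q ^^ tri (n + Z.of_nat N) * q ^^ tri (- Z.of_nat N)
          = q ^^ tri n).
  { rewrite <- !Cpowz_add by exact Hq0. f_equal.
    assert (T1 := tri_double n). assert (T2 := tri_double (n + Z.of_nat N)).
    assert (T3 := tri_double (- Z.of_nat N)). nia. }
  assert (E2 : (- z) ^^ (- Z.of_nat N) * (- z) ^^ (n + Z.of_nat N) = (- z) ^^ n).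
  { rewrite <- Cpowz_add by exact Hmz. f_equal. lia. }
  rewrite <- E1, <- E2. field.
- assert (E : t = qpoch_inf q q * th q z).
  { apply is_Clim_unique with (u := fun N =>
      (K N * (qpoch_inf q q * qpoch_inf q (D N) / qpoch_inf q 0)) * qpoch_inf q (q / z * q ^ N)).
    - replace t with (t * 1) by ring.
      apply is_Clim_mult; [exact HL | now apply qpoch_inf_lim].
    - apply is_Clim_ext with (2 := is_Clim_const (qpoch_inf q q * th q z)).
      intros N. assert (E := th_shift_neg q z (- Z.of_nat N) Hq0 Hq Hz).
      rewrite Z.opp_involutive, Cpowz_of_nat in E. rewrite <- E.
      rewrite qpoch_inf_0 by exact Hq. unfold K, D. field. }
  now rewrite <- E.
Qed.

(* The 6phi5 series with two of its parameters sent to infinity. *)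
Definition vwp_term (q A b : C) (k : Z) : C :=
  (1 - A * q ^^ (2 * k)) * q ^^ tri k *
  (qpoch_inf q (q ^^ (k + 1)) * qpoch_inf q (A / b * q ^^ (k + 1))
   / (qpoch_inf q (A * q ^^ k) * qpoch_inf q (b * q ^^ k)))
  * ((A * q / b) ^^ k * q ^^ tri k).

(** The constant 1 says that the sum does not change under [A -> A q]. With [s = q^k] and
    [c = A q / b], cancelling the common products and then the factor [s (1 - A s)] reduces the
    claim to [(1 - c s) - (1 - A q s^2) = - c s (1 - b s)]. *)
Lemma vwp_term_step (q A b : C) (k : Z) : q <> 0 -> (Cmod q < 1)%R -> A <> 0 -> b <> 0 ->
  (forall k, qpoch_inf q (A * q ^^ k) <> 0) -> (forall k, qpoch_inf q (b * q ^^ k) <> 0) ->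
  let U := fun k => - q ^^ tri k *
     (qpoch_inf q (q ^^ k) * qpoch_inf q (A / b * q ^^ (k + 1))
      / (qpoch_inf q (A * q ^^ k) * qpoch_inf q (b * q ^^ k)))
     * ((A * q / b) ^^ k * q ^^ tri k) in
  vwp_term q A b k - 1 * vwp_term q (A * q) b k = U (k + 1)%Z - U k.
Proof.
intros Hq0 Hq HA Hb HAk Hbk U. unfold U, vwp_term.
assert (HAb : A * q / b <> 0) by (apply Cdiv_neq_0; [now apply Cmult_neq_0 | exact Hb]).
replace (A * q / b * q ^^ (k + 1)) with (A / b * q ^^ (k + 1 + 1))
  by (rewrite (Cpowz_succ q (k + 1)) by exact Hq0; field; exact Hb).
replace (A * q * q ^^ k) with (A * q ^^ (k + 1)) by (rewrite Cpowz_succ by exact Hq0; ring).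
replace (A * q * q / b) with (A * q / b * q) by (field; exact Hb).
rewrite (Cpowz_mult_l (A * q / b) q), tri_succ, (Cpowz_add q (tri k)), (Cpowz_succ (A * q / b)) by assumption.
replace (2 * k)%Z with (k + k)%Z by lia. rewrite (Cpowz_add q k k) by exact Hq0.
rewrite (qpoch_inf_qpow_stepz q k Hq0 Hq).
rewrite (qpoch_inf_stepz q (A / b) (k + 1) Hq0 Hq).
assert (H0 := HAk k). assert (H1 := HAk (k + 1)%Z).
assert (G0 := Hbk k). assert (G1 := Hbk (k + 1)%Z).
rewrite (qpoch_inf_stepz q A k Hq0 Hq) in H0 |- *.
rewrite (qpoch_inf_stepz q b k Hq0 Hq) in G0 |- *.
assert (H2 : 1 - A * q ^^ k <> 0) by (intros E0; apply H0; rewrite E0; ring).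
assert (G2 : 1 - b * q ^^ k <> 0) by (intros E0; apply G0; rewrite E0; ring).
set (P1 := qpoch_inf q (q ^^ (k + 1))). set (P2 := qpoch_inf q (A / b * q ^^ (k + 1 + 1))).
set (P3 := qpoch_inf q (A * q ^^ (k + 1))) in *.
set (P4 := qpoch_inf q (b * q ^^ (k + 1))) in *.
set (t := q ^^ tri k). set (w := (A * q / b) ^^ k).
rewrite (Cpowz_succ q k Hq0).
set (s := q ^^ k) in *.
field. repeat split; assumption.
Qed.

(** [vwp_term] contains [q ^^ tri k] twice: one copy is spent here as a bounded coefficient, the
    other provides the decay in [expdec_uni]. *)
Lemma Cmod_qtri_le_1 (q : C) (k : Z) : q <> 0 -> (Cmod q < 1)%R -> (Cmod (q ^^ tri k) <= 1)%R.
Proof.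
intros Hq0 Hq. rewrite Cmod_Cpowz, <- exp_0 by exact Hq0. apply exp_le_compat.
assert (HL := ln_Cmod_neg q Hq0 Hq).
assert (H : (0 <= tri k)%Z) by (assert (T := tri_double k); nia).
apply IZR_le in H. nra.
Qed.

Lemma vwp_coef_bound (q A b : C) (N : nat) (j : Z) (k : nat) : q <> 0 -> (Cmod q < 1)%R ->
  qpoch_inf q A <> 0 -> qpoch_inf q b <> 0 ->
  (Cmod (q ^^ tri (Z.of_nat k) *
    (qpoch_inf q (q ^^ j) * qpoch_inf q (A * q ^ N / b * q ^^ (Z.of_nat k + 1))
     / (qpoch_inf q (A * q ^ N * q ^^ Z.of_nat k) * qpoch_inf q (b * q ^^ Z.of_nat k))))
   <= 1 * (qbnd q 1 * qbnd q (A / b)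
      * (qbnd q A / Cmod (qpoch_inf q A) * (qbnd q b / Cmod (qpoch_inf q b)))))%R.
Proof.
intros Hq0 Hq HA Hb.
replace (A * q ^ N / b * q ^^ (Z.of_nat k + 1)) with (A / b * q ^ (N + S k))
  by (replace (Z.of_nat k + 1)%Z with (Z.of_nat (S k)) by lia;
      rewrite Cpowz_of_nat, Cpow_add_r; unfold Cdiv; ring).
replace (A * q ^ N * q ^^ Z.of_nat k) with (A * q ^ (N + k))
  by (rewrite Cpowz_of_nat, Cpow_add_r; ring).
rewrite (Cpowz_of_nat q k).
assert (HAk : qpoch_inf q (A * q ^ (N + k)) <> 0).
{ intros E. apply HA. rewrite (qpoch_inf_fin q A (N + k) Hq), E. ring. }
assert (Hbk : qpoch_inf q (b * q ^ k) <> 0).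
{ intros E. apply Hb. rewrite (qpoch_inf_fin q b k Hq), E. ring. }
unfold Cdiv.
replace (/ (qpoch_inf q (A * q ^ (N + k)) * qpoch_inf q (b * q ^ k)))
  with (/ qpoch_inf q (A * q ^ (N + k)) * / qpoch_inf q (b * q ^ k)) by (field; tauto).
rewrite !Cmod_mult.
repeat (apply Rmult_le_compat; try apply Cmod_ge_0; repeat apply Rmult_le_pos; try apply Cmod_ge_0).
- now apply Cmod_qtri_le_1.
- now apply qpoch_inf_qpow_bound.
- now apply qpoch_inf_bound_pow.
- now apply qpoch_inf_inv_bound.
- now apply qpoch_inf_inv_bound.
Qed.

(** In the normalisation of [vwp_term] the value is free of [A]. Hence [A] may be replaced by
    [A q^N] and sent to 0, where the series reduces to its term [k = 0]. *)
Lemma vwp_sum (q A b : C) : q <> 0 -> (Cmod q < 1)%R -> A <> 0 -> b <> 0 ->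
  ~ is_qpower q A -> ~ is_qpower q b ->
  is_zseries (vwp_term q A b) (qpoch_inf q q / qpoch_inf q b).
Proof.
intros Hq0 Hq HA Hb HAp Hbp.
assert (HPA := qpoch_inf_nz0 q A Hq0 Hq HAp).
assert (HPb := qpoch_inf_nz0 q b Hq0 Hq Hbp).
set (K := (1 * (qbnd q 1 * qbnd q (A / b)
      * (qbnd q A / Cmod (qpoch_inf q A) * (qbnd q b / Cmod (qpoch_inf q b)))))%R).
assert (HcK := fun N j k => vwp_coef_bound q A b N j k Hq0 Hq HPA HPb). fold K in HcK.
assert (HDb : forall N, (Cmod (A * q ^ N * q / b) <= Cmod (A / b))%R).
{ intros N. replace (A * q ^ N * q / b) with (A / b * q ^ (S N)) by (simpl; unfold Cdiv; ring).
  now apply Cmod_mult_pow_le. }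
destruct (expdec_uni q (Cmod (A / b)) ((1 + Cmod A) * K) Hq0 Hq) as [M HM].
assert (Hdec : forall N, expdec M (vwp_term q (A * q ^ N) b)).
{ intros N. apply (HM (fun k => (1 - A * q ^ N * q ^^ (2 * k)) * q ^^ tri k *
  (qpoch_inf q (q ^^ (k + 1)) * qpoch_inf q (A * q ^ N / b * q ^^ (k + 1))
   / (qpoch_inf q (A * q ^ N * q ^^ k) * qpoch_inf q (b * q ^^ k))))); [| |apply HDb].
  - intros k Hk. rewrite (qpoch_inf_qpow_le_0 q (k + 1)); [unfold Cdiv; ring | assumption | assumption | lia].
  - intros k. rewrite <- Cmult_assoc, Cmod_mult. apply Rmult_le_compat; try apply Cmod_ge_0; [|apply HcK].
    apply Rle_trans with (1 := Cmod_sub_le _ _). rewrite Cmod_1. apply Rplus_le_compat_l.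
    replace (2 * Z.of_nat k)%Z with (Z.of_nat (2 * k)) by lia.
    rewrite Cpowz_of_nat, <- Cmult_assoc, <- Cpow_add_r. now apply Cmod_mult_pow_le. }
set (F := fun N => ZSeries (vwp_term q (A * q ^ N) b)).
assert (HF : forall N, is_zseries (vwp_term q (A * q ^ N) b) (F N)).
{ intros N. apply ZSeries_correct. now apply (expdec_ex M). }
assert (Hrec : forall N, F N = 1 * F (S N)).
{ intros N. assert (HAN : A * q ^ N <> 0) by (apply Cmult_neq_0; [exact HA | now apply Cpow_nz]).
  assert (HU : ex_zseries (fun k => - q ^^ tri k *
     (qpoch_inf q (q ^^ k) * qpoch_inf q (A * q ^ N / b * q ^^ (k + 1))
      / (qpoch_inf q (A * q ^ N * q ^^ k) * qpoch_inf q (b * q ^^ k)))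
     * ((A * q ^ N * q / b) ^^ k * q ^^ tri k))).
  { destruct (expdec_uni q (Cmod (A / b)) K Hq0 Hq) as [M' HM'].
    apply (expdec_ex M'). apply HM'; [| |apply HDb].
    - intros k Hk. rewrite (qpoch_inf_qpow_le_0 q k); [unfold Cdiv; ring | assumption | assumption | lia].
    - intros k. refine (Rle_trans _ _ _ (Req_le _ _ _) (HcK N (Z.of_nat k) k)).
      rewrite <- Cmod_opp. f_equal. ring. }
  destruct HU as [u HU].
  refine (is_zseries_telescope _ _ _ _ _ _ u (fun k => vwp_term_step q (A * q ^ N) b k Hq0 Hq HAN Hb _ _)
    (HF N) _ HU).
  - intros j. rewrite <- Cmult_assoc, <- Cpowz_of_nat, <- Cpowz_add by exact Hq0.
    now apply qpoch_inf_nz.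
  - intros j. now apply qpoch_inf_nz.
  - replace (A * q ^ N * q) with (A * q ^ S N) by (simpl; ring). apply HF. }
assert (Hfin : forall N, F 0%nat = F N).
{ induction N as [|N IH]; [reflexivity|]. rewrite IH, Hrec. ring. }
destruct (tannery (fun N => vwp_term q (A * q ^ N) b)
  (fun k => if Z.eqb k 0 then qpoch_inf q q / qpoch_inf q b else 0) F M) as (t & Ht & HFt).
- exact Hdec.
- intros k. destruct (Z_lt_le_dec k 0) as [Hk|Hk].
  + replace (Z.eqb k 0) with false by (symmetry; apply Z.eqb_neq; lia).
    apply is_Clim_ext with (2 := is_Clim_const 0). intros N. unfold vwp_term.
    rewrite (qpoch_inf_qpow_le_0 q (k + 1)); [unfold Cdiv; ring | assumption | assumption | lia].
  + set (j := Z.to_nat k). replace k with (Z.of_nat j) by lia. clearbody j. clear k Hk.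
    set (c := q ^^ tri (Z.of_nat j) *
      (qpoch_inf q (q ^^ (Z.of_nat j + 1)) / qpoch_inf q (b * q ^^ Z.of_nat j))
              * ((A * q / b) ^ j * q ^^ tri (Z.of_nat j))).
    assert (L1 : is_Clim (fun N => 1 - A * q ^^ (2 * Z.of_nat j) * q ^ N) 1).
    { assert (L := is_Clim_plus _ _ _ _ (is_Clim_const 1)
        (is_Clim_scal (- (A * q ^^ (2 * Z.of_nat j))) _ _ (is_Clim_pow_0 q Hq))).
      replace (1 + - (A * q ^^ (2 * Z.of_nat j)) * 0) with (RtoC 1) in L by ring.
      apply is_Clim_ext with (2 := L). intros N. ring. }
    assert (HPj := qpoch_inf_nz q A (Z.of_nat j) Hq0 Hq HAp).
    (* The reciprocal is [qfin] over a fixed nonzero value, so [qfin_cvg] gives its limit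
       directly. *)
    assert (L2 : is_Clim (fun N => / qpoch_inf q (A * q ^^ Z.of_nat j * q ^ N)) 1).
    { assert (L := is_Clim_scal (/ qpoch_inf q (A * q ^^ Z.of_nat j)) _ _
        (qfin_cvg q (A * q ^^ Z.of_nat j) Hq)).
      rewrite Cinv_l in L by exact HPj.
      apply is_Clim_ext with (2 := L).
      intros N. assert (E := qpoch_inf_fin q (A * q ^^ Z.of_nat j) N Hq). rewrite E in HPj |- *.
      field. split; intros E0; apply HPj; rewrite E0; ring. }
    assert (L := is_Clim_scal c _ _ (is_Clim_mult _ _ _ _
      (is_Clim_mult _ _ _ _ L1 L2) (is_Clim_mult _ _ _ _
      (qpoch_inf_lim q (A / b * q ^^ (Z.of_nat j + 1)) Hq) (is_Clim_pow_pow q j Hq)))).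
    replace (if (Z.of_nat j =? 0)%Z then qpoch_inf q q / qpoch_inf q b else 0)
      with (c * (1 * 1 * (1 * (if (Z.of_nat j =? 0)%Z then 1 else 0)))).
    * apply is_Clim_ext with (2 := L). intros N. unfold vwp_term, c.
      rewrite (Cpowz_of_nat (A * q ^ N * q / b)).
      replace (A * q ^ N * q / b) with (A * q / b * q ^ N) by (unfold Cdiv; ring).
      rewrite Cpow_mult_l.
      replace (A * q ^ N * q ^^ Z.of_nat j) with (A * q ^^ Z.of_nat j * q ^ N) by ring.
      replace (A * q ^ N * q ^^ (2 * Z.of_nat j)) with (A * q ^^ (2 * Z.of_nat j) * q ^ N) by ring.
      replace (A * q ^ N / b * q ^^ (Z.of_nat j + 1)) with (A / b * q ^^ (Z.of_nat j + 1) * q ^ N)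
        by (unfold Cdiv; ring).
      assert (G1 : qpoch_inf q (A * q ^^ Z.of_nat j * q ^ N) <> 0).
      { rewrite <- Cpowz_of_nat, <- Cmult_assoc, <- Cpowz_add by exact Hq0. now apply qpoch_inf_nz. }
      assert (G2 := qpoch_inf_nz q b (Z.of_nat j) Hq0 Hq Hbp).
      set (w := (A * q / b) ^ j). field. tauto.
    * unfold c. destruct j as [|j].
      -- change (tri (Z.of_nat 0)) with 0%Z. simpl. rewrite !Cmult_1_r, !Cmult_1_l. reflexivity.
      -- simpl. ring.
- exact HF.
- assert (Et := is_zseries_uniq _ _ _ Ht (is_zseries_delta _)). subst t.
  assert (E0 : F 0%nat = qpoch_inf q q / qpoch_inf q b).
  { apply is_Clim_unique with (2 := HFt).
    apply is_Clim_ext with (2 := is_Clim_const (F 0%nat)). exact Hfin. }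
  assert (HF0 := HF 0%nat). rewrite E0 in HF0. simpl in HF0. rewrite Cmult_1_r in HF0.
  exact HF0.
Qed.

(** * The double sum *)

Lemma Cpowz_opp_l (z : C) (n : Z) : z <> 0 -> (- z) ^^ n = (- (1)) ^^ n * z ^^ n.
Proof.
intros Hz. replace (- z) with (- (1) * z) by ring.
apply Cpowz_mult_l; [apply Copp_neq_0, C1_neq_0 | exact Hz].
Qed.

Lemma Cpowz_m1_sqr (n : Z) : (- (1)) ^^ n * (- (1)) ^^ n = 1.
Proof.
assert (H := Copp_neq_0 1 C1_neq_0).
rewrite <- Cpowz_mult_l by exact H. replace (- (1) * - (1)) with (RtoC 1) by ring.
apply Cpowz_1_l.
Qed.

(** What is left of the explicit factors in the [n]-th term of [S] once [(- y) ^^ n * q ^^ tri n],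
    supplied by the 1phi1 sum, is divided out; here [c] stands for [y / a]. *)
Definition row_coef (q x c : C) (n : Z) : C :=
  (1 - x * c / q * q ^^ (2 * n)) * q ^^ (3 * tri n - n) * (- (x ^ 2 * c)) ^^ n.

(** The explicit factors left over when quasi-periodicity of theta turns the products of the double
    series into those of [vwp_term] at [k = m - n]. With [A = x c / q], both sides are monomials
    times [1 - A q^(2n)], because [1 - 1 / (A q^(2n))] is a monomial multiple of it. *)
Lemma vwp_reflect_coef (q x c : C) (m n : Z) : q <> 0 -> x <> 0 -> c <> 0 ->
  row_coef q x c n * ((- c) ^^ n * q ^^ tri n) * ((- x) ^^ m * q ^^ tri m)
  = (1 - / (x * c / q * q ^^ (2 * m)) * q ^^ (2 * (m - n))) * q ^^ tri (m - n)
    * ((q / (c * q ^^ m)) ^^ (m - n) * q ^^ tri (m - n))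
    * ((- (x * c / q)) ^^ (m + n + 1) * q ^^ tri (m + n + 1)) * ((- x) ^^ n * q ^^ tri n).
Proof.
intros Hq Hx Hc. unfold row_coef.
assert (Hxc : x * c / q <> 0) by (apply Cdiv_neq_0; [now apply Cmult_neq_0 | exact Hq]).
assert (Hm1 := Copp_neq_0 1 C1_neq_0).
assert (Hx2 : x ^ 2 <> 0) by now apply Cpow_nz.
assert (Hx2c : x ^ 2 * c <> 0) by now apply Cmult_neq_0.
rewrite (Cpowz_opp_l (x ^ 2 * c)), (Cpowz_opp_l c), (Cpowz_opp_l x m), (Cpowz_opp_l x n),
  (Cpowz_opp_l (x * c / q)) by assumption.
assert (E1 : q ^^ (2 * m) = q ^^ m * q ^^ m) by (rewrite <- Cpowz_add by exact Hq; f_equal; lia).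
assert (E2 : q ^^ (2 * n) = q ^^ n * q ^^ n) by (rewrite <- Cpowz_add by exact Hq; f_equal; lia).
assert (E3 : q ^^ (3 * tri n - n) = q ^^ tri n * q ^^ tri n * q ^^ tri n / q ^^ n).
{ rewrite Cpowz_sub by exact Hq. f_equal. rewrite <- !Cpowz_add by exact Hq. f_equal. lia. }
assert (E4 : q ^^ (2 * (m - n)) = (q ^^ m * q ^^ m) / (q ^^ n * q ^^ n)).
{ rewrite <- E1, <- E2, <- Cpowz_sub by exact Hq. f_equal. lia. }
assert (E5 : q ^^ tri (m - n) = q ^^ tri m * q ^^ tri n / q ^^ (m * n) * q ^^ n).
{ rewrite tri_sub, Cpowz_add, Cpowz_sub, Cpowz_add by exact Hq. reflexivity. }
assert (E6 : q ^^ tri (m + n + 1) = q ^^ tri m * q ^^ tri n * q ^^ (m * n) * (q ^^ m * q ^^ n)).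
{ rewrite tri_succ, tri_add, !Cpowz_add by exact Hq. reflexivity. }
assert (E7 : (q / (c * q ^^ m)) ^^ (m - n) =
  q ^^ (m * n) / (q ^^ n * (q ^^ tri m * q ^^ tri m)) * (c ^^ n / c ^^ m)).
{ replace (q / (c * q ^^ m)) with (q ^^ (1 - m) / c)
    by (rewrite Cpowz_sub by exact Hq; simpl; field; split; [now apply Cpowz_neq_0 | exact Hc]).
  rewrite Cpowz_div_l, <- Cpowz_mult, (Cpowz_sub c) by (try apply Cpowz_neq_0; assumption).
  replace ((1 - m) * (m - n))%Z with (m * n - (n + (tri m + tri m)))%Z
    by (assert (T := tri_double m); nia).
  rewrite Cpowz_sub, !Cpowz_add by exact Hq.
  assert (H1 := Cpowz_neq_0 c n Hc). assert (H2 := Cpowz_neq_0 c m Hc).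
  assert (H3 := Cpowz_neq_0 q n Hq). assert (H4 := Cpowz_neq_0 q (tri m) Hq).
  field. tauto. }
assert (E8 : (x * c / q) ^^ (m + n + 1) =
  x ^^ m * x ^^ n * x * (c ^^ m * c ^^ n * c) / (q ^^ m * q ^^ n * q)).
{ rewrite Cpowz_div_l, Cpowz_mult_l by (try apply Cmult_neq_0; assumption).
  rewrite !Cpowz_succ, !Cpowz_add by assumption. reflexivity. }
assert (E9 : (x ^ 2 * c) ^^ n = x ^^ n * x ^^ n * c ^^ n).
{ rewrite Cpowz_mult_l by assumption. f_equal. simpl. rewrite Cmult_1_r. now apply Cpowz_mult_l. }
assert (E10 : (- (1)) ^^ (m + n + 1) = - ((- (1)) ^^ m * (- (1)) ^^ n)).
{ rewrite Cpowz_succ, Cpowz_add by exact Hm1. ring. }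
rewrite E1, E2, E3, E4, E5, E6, E7, E8, E9, E10.
assert (H1 := Cpowz_neq_0 c n Hc). assert (H2 := Cpowz_neq_0 c m Hc).
assert (H3 := Cpowz_neq_0 q n Hq). assert (H4 := Cpowz_neq_0 q (tri m) Hq).
assert (H5 := Cpowz_neq_0 q m Hq). assert (H6 := Cpowz_neq_0 q (tri n) Hq).
assert (H7 := Cpowz_neq_0 q (m * n) Hq).
assert (Sm := Cpowz_m1_sqr m). assert (Sn := Cpowz_m1_sqr n).
set (em := (- (1)) ^^ m) in *. set (en := (- (1)) ^^ n) in *.
set (t := q ^^ tri m) in *. set (tn := q ^^ tri n) in *. set (u := q ^^ (m * n)) in *.
set (r := q ^^ m) in *. set (s := q ^^ n) in *.
set (xm := x ^^ m). set (xn := x ^^ n). set (cm := c ^^ m) in *. set (cn := c ^^ n) in *.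
(* Both sides carry the same sign factor [en * en * em]; once it is split off, the identity is one
   of rational functions. *)
transitivity (en * en * em * ((1 - x * c / q * (s * s)) * (tn * tn * tn / s) * (xn * xn * cn)
   * (cn * tn) * (xm * t))); [ring|].
transitivity (en * en * em * ((1 - / (x * c / q * (r * r)) * (r * r / (s * s))) * (t * tn / u * s) *
(u / (s * (t * t)) * (cn / cm) * (t * tn / u * s)) *
((- (1)) * (xm * xn * x * (cm * cn * c) / (r * s * q)) * (t * tn * u * (r * s))) *
(xn * tn))); [|ring].
f_equal. field. tauto.
Qed.

Lemma grow_one_minus (q A : C) : q <> 0 -> (Cmod q < 1)%R ->
  grow q zabs (fun _ => 0%R) (fun n => 1 - A * q ^^ (2 * n)).
Proof.
intros Hq0 Hq. exists (Cmod A)%R, (2 * Rabs (ln (Cmod q)))%R.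
assert (HL := Rabs_pos (ln (Cmod q))). split; [lra|]. intros n.
apply Rle_trans with (1 := Cmod_sub_le _ _).
rewrite Cmod_1, Cmod_mult, Cmod_Cpowz, mult_IZR by exact Hq0.
assert (H := mult_IZR_le_zabs n (ln (Cmod q))).
assert (H' := Rmult_le_pos _ _ HL (zabs_pos n)).
assert (E1 : (exp (2 * IZR n * ln (Cmod q)) <= exp (2 * Rabs (ln (Cmod q)) * zabs n))%R)
  by (apply exp_le_compat; lra).
assert (E2 : (1 <= exp (2 * Rabs (ln (Cmod q)) * zabs n))%R)
  by (rewrite <- exp_0 at 1; apply exp_le_compat; lra).
rewrite Rmult_0_r, Rplus_0_r, exp_plus.
set (X := exp (2 * Rabs (ln (Cmod q)) * zabs n)) in *.
assert (E3 := exp_ineq1_le (Cmod A)). assert (HA := Cmod_ge_0 A).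
apply Rle_trans with ((1 + Cmod A) * X)%R; [|apply Rmult_le_compat_r; lra].
assert (K := Rmult_le_compat_l _ _ _ HA E1). lra.
Qed.

(* The exponent of [|q|] in the double series is positive definite; after dropping
   linear terms it is at least [(n^2 + m^2) / 8]. *)
Lemma double_quad_form (n m : Z) :
  (1 / 16 * (zabs n + zabs m) ^ 2 - 3 * (zabs n + zabs m)
   <= IZR (3 * tri n - n) + IZR (tri m) + negsq m - negsq (m + n))%R.
Proof.
rewrite minus_IZR, mult_IZR, !IZR_tri. unfold negsq.
assert (Hz : forall k, (zabs k = IZR k \/ zabs k = - IZR k)%R).
{ intros k. unfold zabs, Rabs. destruct (Rcase_abs (IZR k)); auto. }
assert (Hp := zabs_pos n). assert (Hp' := zabs_pos m).
assert (Hsq : (zabs n ^ 2 = IZR n ^ 2)%R) by (destruct (Hz n) as [-> | ->]; ring).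
assert (Hsq' : (zabs m ^ 2 = IZR m ^ 2)%R) by (destruct (Hz m) as [-> | ->]; ring).
assert (Hle : (IZR n <= zabs n)%R) by apply Rle_abs.
assert (Hle' : (IZR m <= zabs m)%R) by apply Rle_abs.
assert (Hsum : ((zabs n + zabs m) ^ 2 <= 2 * (IZR n ^ 2 + IZR m ^ 2))%R).
{ rewrite <- Hsq, <- Hsq'. assert (K := pow2_ge_0 (zabs n - zabs m)). lra. }
clear Hz Hsq Hsq'.
assert (Q1 := pow2_ge_0 (IZR n - IZR m)). assert (Q2 := pow2_ge_0 (IZR n)).
assert (Q3 := pow2_ge_0 (IZR m)).
assert (Q4 := pow2_ge_0 (IZR m - 2 * IZR n)).
destruct (Z_lt_le_dec (m + n) 0) as [H1|H1]; rewrite ?plus_IZR in *;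
  destruct (Z_lt_le_dec m 0) as [H2|H2].
- lra.
(* Here the quadratic part is [n^2 - m n], which is indefinite; the constraint [0 <= m < - n]
   supplies the positivity. *)
- apply IZR_lt in H1. apply IZR_le in H2. rewrite plus_IZR in H1.
  assert (K : (0 <= - (IZR m + IZR n) * (IZR m - IZR n))%R) by (apply Rmult_le_pos; lra).
  assert (K2 : (0 <= IZR m * - IZR n)%R) by (apply Rmult_le_pos; lra).
  lra.
- lra.
- lra.
Qed.

Lemma qpoch_inf_q_neq_0 (q : C) : q <> 0 -> (Cmod q < 1)%R -> qpoch_inf q q <> 0.
Proof.
intros Hq0 Hq. apply qpoch_inf_neq_0; [exact Hq|]. intros j E.
assert (H : (Cmod (q * q ^ j) < 1)%R).
{ apply Rle_lt_trans with (2 := Hq). now apply Cmod_mult_pow_le. }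
rewrite E, Cmod_1 in H. lra.
Qed.

(** To be used with [w = x / a] and [c = y / a]. The first two groups depend on [n] and on [m]
    alone. The last one is, up to a constant, the Bailey kernel [1 / ((q)_(m-n) (A q)_(m+n))] with
    [A q = x c]. *)
Definition double_term (q x y w c : C) (n m : Z) : C :=
  row_coef q x c n * (qpoch_inf q (x * q ^^ n) * / qpoch_inf q (c * q ^^ n))
  * ((- y) ^^ m * q ^^ tri m * / qpoch_inf q (w * q ^^ m))
  * (qpoch_inf q (q ^^ (m - n + 1)) * qpoch_inf q (x * c * q ^^ (m + n))).

Lemma double_term_bound (q x y w c : C) : q <> 0 -> (Cmod q < 1)%R ->
  x <> 0 -> y <> 0 -> w <> 0 -> c <> 0 ->
  ~ is_qpower q x -> ~ is_qpower q w -> ~ is_qpower q c -> ~ is_qpower q (x * c) ->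
  exists M, forall n m, (Cmod (double_term q x y w c n m)
     <= M * exp (- Rabs (IZR n)) * exp (- Rabs (IZR m)))%R.
Proof.
intros Hq0 Hq Hx Hy Hw Hc Hpx Hpw Hpc Hpxc.
assert (Hmy := Copp_neq_0 y Hy). assert (Hxc := Cmult_neq_0 x c Hx Hc).
assert (Hx2c : - (x ^ 2 * c) <> 0).
{ apply Copp_neq_0, Cmult_neq_0; [now apply Cpow_nz | exact Hc]. }
(* All factors are pulled back to [Z * Z] with one common size, so that their exponents of [|q|] can
   be added. *)
set (sz := fun p : Z * Z => (zabs (fst p) + zabs (snd p))%R).
assert (S1 : forall p : Z * Z, (zabs (fst p) <= sz p + 0)%R)
  by (intros p; unfold sz; assert (G := zabs_pos (snd p)); lra).
assert (S2 : forall p : Z * Z, (zabs (snd p) <= sz p + 0)%R)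
  by (intros p; unfold sz; assert (G := zabs_pos (fst p)); lra).
assert (S3 : forall p : Z * Z, (zabs (snd p + fst p) <= sz p + 0)%R)
  by (intros p; unfold sz; assert (G := zabs_add (snd p) (fst p)); lra).
assert (G1 := grow_comp q _ _ sz _ (fun p : Z * Z => fst p) 0 (grow_one_minus q (x * c / q) Hq0 Hq) S1).
assert (G2 := grow_qpow q sz (fun p : Z * Z => (3 * tri (fst p) - fst p)%Z) Hq0).
assert (G3 := grow_comp q _ _ sz _ (fun p : Z * Z => fst p) 0 (grow_pow q _ Hx2c) S1).
assert (G4 := grow_comp q _ _ sz _ (fun p : Z * Z => fst p) 0 (grow_qpoch q x Hq0 Hq Hx Hpx) S1).
assert (G5 := grow_comp q _ _ sz _ (fun p : Z * Z => fst p) 0 (grow_qpoch_inv q c Hq0 Hq Hc Hpc) S1).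
assert (G6 := grow_comp q _ _ sz _ (fun p : Z * Z => snd p) 0 (grow_pow q _ Hmy) S2).
assert (G7 := grow_qpow q sz (fun p : Z * Z => tri (snd p)) Hq0).
assert (G8 := grow_comp q _ _ sz _ (fun p : Z * Z => snd p) 0 (grow_qpoch_inv q w Hq0 Hq Hw Hpw) S2).
assert (G9 := grow_bounded q sz (fun p : Z * Z => qpoch_inf q (q ^^ (snd p - fst p + 1))) _
  (fun p => qpoch_inf_qpow_bound q _ Hq0 Hq)).
assert (G10 := grow_comp q _ _ sz _ (fun p : Z * Z => (snd p + fst p)%Z) 0
  (grow_qpoch q _ Hq0 Hq Hxc Hpxc) S3).
assert (G := grow_mult _ _ _ _ _ _
  (grow_mult _ _ _ _ _ _
    (grow_mult _ _ _ _ _ _ (grow_mult _ _ _ _ _ _ (grow_mult _ _ _ _ _ _ G1 G2) G3)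
      (grow_mult _ _ _ _ _ _ G4 G5))
    (grow_mult _ _ _ _ _ _ (grow_mult _ _ _ _ _ _ G6 G7) G8))
  (grow_mult _ _ _ _ _ _ G9 G10)).
cbv beta in G. assert (H16 : (0 < 1 / 16)%R) by lra.
destruct (grow_decay q sz _ _ (1 / 16)%R 3%R Hq0 Hq H16 G) as [M HM].
- intros [n m]. unfold sz. cbv beta. simpl fst. simpl snd.
  assert (K := double_quad_form n m). lra.
- exists M. intros n m. specialize (HM (n, m)). unfold sz in HM. simpl fst in HM. simpl snd in HM.
  replace (M * exp (- Rabs (IZR n)) * exp (- Rabs (IZR m)))%R
    with (M * exp (- (zabs n + zabs m)))%R
    by (rewrite Rmult_assoc, <- exp_plus; unfold zabs; do 2 f_equal; ring).
  exact HM.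
Qed.

(** The 1phi1 sum at [D = y q^n], [E = w q^n] and [k = m - n]. Its product [D E q^k] is
    [y w q^(m+n)], and [x c = y w] identifies it with the one in the kernel. *)
Lemma double_row (q x y w c : C) (n : Z) : q <> 0 -> (Cmod q < 1)%R ->
  x <> 0 -> y <> 0 -> w <> 0 -> c <> 0 -> x * c = y * w -> ~ is_qpower q w -> ~ is_qpower q c ->
  is_zseries (fun m => double_term q x y w c n m)
    (qpoch_inf q q *
     ((1 - x * c / q * q ^^ (2 * n)) * q ^^ (4 * tri n - n) * (x ^ 2 * c * y) ^^ n
      * (qpoch_inf q (x * q ^^ n) * qpoch_inf q (y * q ^^ n)
         / (qpoch_inf q (w * q ^^ n) * qpoch_inf q (c * q ^^ n))))).
Proof.
intros Hq0 Hq Hx Hy Hw Hc Exc Hpw Hpc.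
assert (Hmy := Copp_neq_0 y Hy).
assert (Hqn := Cpowz_neq_0 q n Hq0).
assert (HD : y * q ^^ n <> 0) by now apply Cmult_neq_0.
assert (HE : forall k, qpoch_inf q (w * q ^^ n * q ^^ k) <> 0).
{ intros k. rewrite <- Cmult_assoc, <- Cpowz_add by exact Hq0. now apply qpoch_inf_nz. }
assert (HS := phi11_sum q (y * q ^^ n) (w * q ^^ n) Hq0 Hq HD HE).
apply (is_zseries_shift _ _ (- n)) in HS.
apply (is_zseries_scal (row_coef q x c n * (qpoch_inf q (x * q ^^ n) * / qpoch_inf q (c * q ^^ n))
   * ((- y) ^^ n * q ^^ tri n))) in HS.
replace (qpoch_inf q q * _) with
  (row_coef q x c n * (qpoch_inf q (x * q ^^ n) * / qpoch_inf q (c * q ^^ n)) * ((- y) ^^ n * q ^^ tri n) *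
      (qpoch_inf q q * qpoch_inf q (y * q ^^ n) / qpoch_inf q (w * q ^^ n))).
- apply is_zseries_ext with (2 := HS). intros m. cbv beta. unfold phi_term, double_term.
  replace (m + - n)%Z with (m - n)%Z by lia.
  replace (y * q ^^ n * (w * q ^^ n) * q ^^ (m - n)) with (x * c * q ^^ (m + n)).
  2:{ rewrite Exc, Cpowz_add, Cpowz_sub by exact Hq0. field. exact Hqn. }
  replace (w * q ^^ n * q ^^ (m - n)) with (w * q ^^ m).
  2:{ rewrite Cpowz_sub by exact Hq0. field. exact Hqn. }
  assert (E : (- y) ^^ n * q ^^ tri n * ((- (y * q ^^ n)) ^^ (m - n) * q ^^ tri (m - n))
            = (- y) ^^ m * q ^^ tri m).
  { replace (- (y * q ^^ n)) with ((- y) * q ^^ n) by ring.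
    rewrite Cpowz_mult_l, <- Cpowz_mult, (Cpowz_sub (- y)) by assumption.
    replace (q ^^ tri m) with (q ^^ (tri n + n * (m - n) + tri (m - n)))
      by (f_equal; assert (T1 := tri_double n); assert (T2 := tri_double m);
          assert (T3 := tri_double (m - n)); nia).
    rewrite !Cpowz_add by exact Hq0. field. now apply Cpowz_neq_0. }
  rewrite <- E. unfold Cdiv. ring.
- unfold row_coef.
  assert (E1 : q ^^ (4 * tri n - n) = q ^^ (3 * tri n - n) * q ^^ tri n).
  { rewrite <- Cpowz_add by exact Hq0. f_equal. lia. }
  assert (E2 : (x ^ 2 * c * y) ^^ n = (- (x ^ 2 * c)) ^^ n * (- y) ^^ n).
  { replace (x ^ 2 * c * y) with (- (x ^ 2 * c) * - y) by ring.
    apply Cpowz_mult_l; [|exact Hmy].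
    apply Copp_neq_0, Cmult_neq_0; [now apply Cpow_nz | exact Hc]. }
  assert (Hwn := qpoch_inf_nz q w n Hq0 Hq Hpw).
  rewrite E1, E2.
  assert (Hcn := qpoch_inf_nz q c n Hq0 Hq Hpc).
  field. tauto.
Qed.

(** The sum [vwp_sum] with base parameter [1 / (A q^(2m))], [b = q / (x q^m)] and index [k = m - n].
    Running backwards inverts the arguments of the products; quasi-periodicity at [c], [A] and [x]
    inverts them back and produces the quotient [theta(A) / theta(c)]. *)
Lemma double_column (q x y w c : C) (m : Z) : q <> 0 -> (Cmod q < 1)%R ->
  x <> 0 -> y <> 0 -> w <> 0 -> c <> 0 ->
  ~ is_qpower q x -> ~ is_qpower q c -> ~ is_qpower q (x * c) ->
  is_zseries (fun n => double_term q x y w c n m)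
    (qpoch_inf q q * th q (x * c / q) / th q c *
     ((- y) ^^ m * q ^^ tri m * (qpoch_inf q (x * q ^^ m) / qpoch_inf q (w * q ^^ m)))).
Proof.
intros Hq0 Hq Hx Hy Hw Hc Hpx Hpc Hpxc.
assert (Hqm := Cpowz_neq_0 q m Hq0).
set (A := x * c / q).
assert (HA : A <> 0) by (apply Cdiv_neq_0; [now apply Cmult_neq_0 | exact Hq0]).
assert (HpA : ~ is_qpower q A).
{ intros H. apply Hpxc. apply (is_qpower_mul q _ (-1) Hq0). simpl. rewrite Cmult_1_r. exact H. }
assert (HAm : A * q ^^ (2 * m) <> 0) by (apply Cmult_neq_0; [exact HA | now apply Cpowz_neq_0]).
assert (HA'p : ~ is_qpower q (/ (A * q ^^ (2 * m)))).
{ intros H. apply HpA. apply (is_qpower_mul q _ (2 * m) Hq0). now apply is_qpower_inv. }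
assert (Hxm : x * q ^^ m <> 0) by now apply Cmult_neq_0.
assert (Hpxm : ~ is_qpower q (x * q ^^ m)).
{ intros H. apply Hpx. now apply (is_qpower_mul q _ m Hq0). }
assert (Hbp := is_qpower_theta q _ Hq0 Hxm Hpxm).
assert (HS := vwp_sum q (/ (A * q ^^ (2 * m))) (q / (x * q ^^ m)) Hq0 Hq
  (Cinv_neq_0 _ HAm) (Cdiv_neq_0 _ _ Hq0 Hxm) HA'p Hbp).
apply (is_zseries_reflect _ _ m) in HS.
set (d := (- y) ^^ m * q ^^ tri m * / qpoch_inf q (w * q ^^ m)).
assert (Htc := th_neq_0 q c Hq0 Hq Hc Hpc).
apply (is_zseries_scal (d * (th q (x * q ^^ m) * th q A / th q c))) in HS.
assert (Hb0 := qpoch_inf_nz0 q _ Hq0 Hq Hbp).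
replace (qpoch_inf q q * _ / _ * _) with
  (d * (th q (x * q ^^ m) * th q A / th q c) * (qpoch_inf q q / qpoch_inf q (q / (x * q ^^ m)))).
2:{ unfold d, th at 1.
    change (qpoch_inf q (x * q ^^ m) / qpoch_inf q (w * q ^^ m))
      with (qpoch_inf q (x * q ^^ m) * / qpoch_inf q (w * q ^^ m)).
    set (iw := / qpoch_inf q (w * q ^^ m)). field. tauto. }
apply is_zseries_ext with (2 := HS). clear HS. intros n. cbv beta. unfold vwp_term, double_term. fold d.
assert (Hqn := Cpowz_neq_0 q n Hq0).
assert (H2m : q ^^ (2 * m) = q ^^ m * q ^^ m) by (rewrite <- Cpowz_add by exact Hq0; f_equal; lia).
replace (/ (A * q ^^ (2 * m)) / (q / (x * q ^^ m)) * q ^^ (m - n + 1)) with (q / c * q ^^ (- n)).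
2:{ rewrite H2m, Cpowz_succ, Cpowz_sub, Cpowz_opp by exact Hq0. unfold A. field. tauto. }
replace (/ (A * q ^^ (2 * m)) * q ^^ (m - n)) with (q / A * q ^^ (- (m + n + 1))).
2:{ rewrite H2m, Cpowz_opp, Cpowz_succ, Cpowz_sub, Cpowz_add by exact Hq0. field. tauto. }
replace (q / (x * q ^^ m) * q ^^ (m - n)) with (q / x * q ^^ (- n)).
2:{ rewrite Cpowz_sub, Cpowz_opp by exact Hq0. field. tauto. }
replace (/ (A * q ^^ (2 * m)) * q / (q / (x * q ^^ m))) with (q / (c * q ^^ m)).
2:{ rewrite H2m. unfold A. field. tauto. }
replace (x * c * q ^^ (m + n)) with (A * q ^^ (m + n + 1)).
2:{ rewrite Cpowz_succ by exact Hq0. unfold A. field. exact Hq0. }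
assert (T1 := th_shift_neg q c n Hq0 Hq Hc).
assert (T2 := th_shift_neg q A (m + n + 1) Hq0 Hq HA).
assert (T3 := th_shift_neg q x n Hq0 Hq Hx).
assert (T4 := th_shift q x m Hq0 Hq Hx).
assert (R := vwp_reflect_coef q x c m n Hq0 Hx Hc). fold A in R.
assert (HtA := th_neq_0 q A Hq0 Hq HA HpA).
assert (Htx := th_neq_0 q x Hq0 Hq Hx Hpx).
assert (Hmc := Copp_neq_0 c Hc). assert (HmA := Copp_neq_0 A HA). assert (Hmx := Copp_neq_0 x Hx).
assert (Gc : (- c) ^^ n * q ^^ tri n <> 0) by (apply Cmult_neq_0; now apply Cpowz_neq_0).
assert (Gm : (- x) ^^ m * q ^^ tri m <> 0) by (apply Cmult_neq_0; now apply Cpowz_neq_0).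
set (gc := (- c) ^^ n * q ^^ tri n) in *.
set (gA := (- A) ^^ (m + n + 1) * q ^^ tri (m + n + 1)) in *.
set (gx := (- x) ^^ n * q ^^ tri n) in *.
set (gm := (- x) ^^ m * q ^^ tri m) in *.
set (rc := row_coef q x c n) in *.
set (P1 := qpoch_inf q (c * q ^^ n)) in *. set (P1' := qpoch_inf q (q / c * q ^^ (- n))) in *.
set (P2 := qpoch_inf q (A * q ^^ (m + n + 1))) in *.
set (P2' := qpoch_inf q (q / A * q ^^ (- (m + n + 1)))) in *.
set (P3 := qpoch_inf q (x * q ^^ n)) in *. set (P3' := qpoch_inf q (q / x * q ^^ (- n))) in *.
set (Pk := qpoch_inf q (q ^^ (m - n + 1))) in *.
set (t4 := th q (x * q ^^ m)) in *.
assert (N2 : P2' <> 0) by (intros E0; apply HtA; rewrite <- T2, E0; ring).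
assert (N3 : P3' <> 0) by (intros E0; apply Htx; rewrite <- T3, E0; ring).
assert (N1 : P1 <> 0) by (intros E0; apply Htc; rewrite <- T1, E0; ring).
assert (N1' : P1' <> 0) by (intros E0; apply Htc; rewrite <- T1, E0; ring).
set (u1 := 1 - / (A * q ^^ (2 * m)) * q ^^ (2 * (m - n))) in *.
set (u2 := (q / (c * q ^^ m)) ^^ (m - n)) in *.
set (tk := q ^^ tri (m - n)) in *.
(* With [gc] and [gm] present, each pair of reflected products completes to a theta value and [T1]
   to [T4] apply. *)
apply (Cmult_cancel_r _ _ (gc * gm)); [now apply Cmult_neq_0|].
transitivity (d * (u1 * tk * (u2 * tk) * gA * gx) * (P3 * / P1) * (Pk * P2)).
- transitivity (d * (t4 * gm) * (P2 * P2' * gA) / (P1 * P1' * gc) * gc *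
   (u1 * tk * (Pk * P1' / (P2' * P3')) * (u2 * tk))).
  + rewrite T1, T2. field. tauto.
  + rewrite T4, <- T3. field. tauto.
- rewrite <- R. ring.
Qed.

(** Fubini delivers the convergence of both series along with their relation. The value [l] is the
    double sum divided by [(q)_oo theta(A) / theta(c)], which is nonzero because [x c] and [c] are
    not powers of [q]. *)
Lemma bailey_bilateral (q x y w c : C) : q <> 0 -> (Cmod q < 1)%R ->
  x <> 0 -> y <> 0 -> w <> 0 -> c <> 0 -> x * c = y * w ->
  ~ is_qpower q x -> ~ is_qpower q w -> ~ is_qpower q c -> ~ is_qpower q (x * c) ->
  exists l : C,
  is_zseries (fun m => (- y) ^^ m * q ^^ tri m *
    (qpoch_inf q (x * q ^^ m) / qpoch_inf q (w * q ^^ m))) l /\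
  is_zseries (fun n => (1 - x * c / q * q ^^ (2 * n)) * q ^^ (4 * tri n - n) * (x ^ 2 * c * y) ^^ n
      * (qpoch_inf q (x * q ^^ n) * qpoch_inf q (y * q ^^ n)
         / (qpoch_inf q (w * q ^^ n) * qpoch_inf q (c * q ^^ n))))
    (th q (x * c / q) / th q c * l).
Proof.
intros Hq0 Hq Hx Hy Hw Hc Exc Hpx Hpw Hpc Hpxc.
destruct (double_term_bound q x y w c Hq0 Hq Hx Hy Hw Hc Hpx Hpw Hpc Hpxc) as [M HM].
destruct (zseries_fubini _ _ _ M HM
  (fun n => double_row q x y w c n Hq0 Hq Hx Hy Hw Hc Exc Hpw Hpc)
  (fun m => double_column q x y w c m Hq0 Hq Hx Hy Hw Hc Hpx Hpc Hpxc)) as (s & Hr & Hcol).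
assert (HPq := qpoch_inf_q_neq_0 q Hq0 Hq).
assert (Htc := th_neq_0 q c Hq0 Hq Hc Hpc).
assert (HpA : ~ is_qpower q (x * c / q)).
{ intros H. apply Hpxc. apply (is_qpower_mul q _ (-1) Hq0). simpl. rewrite Cmult_1_r. exact H. }
assert (HtA : th q (x * c / q) <> 0).
{ apply th_neq_0; try assumption. apply Cdiv_neq_0; [now apply Cmult_neq_0 | exact Hq0]. }
exists (th q c / (qpoch_inf q q * th q (x * c / q)) * s). split.
- apply (is_zseries_scal (th q c / (qpoch_inf q q * th q (x * c / q)))) in Hcol.
  apply is_zseries_ext with (2 := Hcol). intros m. cbv beta.
  set (X := (- y) ^^ m * q ^^ tri m * _). field. tauto.
- apply (is_zseries_scal (/ qpoch_inf q q)) in Hr.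
  replace (th q (x * c / q) / th q c * (th q c / (qpoch_inf q q * th q (x * c / q)) * s))
    with (/ qpoch_inf q q * s) by (field; tauto).
  apply is_zseries_ext with (2 := Hr). intros n. cbv beta.
  rewrite Cmult_assoc, Cinv_l by exact HPq. ring.
Qed.

(** * The complex exponential *)

Lemma cexp_add (z w : C) : cexp (z + w) = cexp z * cexp w.
Proof.
destruct z as [a b]. destruct w as [c d]. unfold cexp, Cmult, Cplus, Re, Im. simpl.
rewrite exp_plus, cos_plus, sin_plus. f_equal; ring.
Qed.

Lemma cexp_0 : cexp 0 = 1.
Proof.
unfold cexp. simpl. rewrite exp_0, cos_0, sin_0. apply injective_projections; simpl; ring.
Qed.

Lemma cexp_neq_0 (z : C) : cexp z <> 0.
Proof.
intros E. apply C1_neq_0. rewrite <- cexp_0. replace (RtoC 0) with (z + - z) by ring.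
rewrite cexp_add, E. ring.
Qed.

Lemma cexp_opp (z : C) : cexp (- z) = / cexp z.
Proof.
apply (Cmult_cancel_r _ _ (cexp z) (cexp_neq_0 z)).
rewrite <- cexp_add, Cinv_l by apply cexp_neq_0. rewrite <- cexp_0. f_equal. ring.
Qed.

Lemma cexp_Cpowz (z : C) (n : Z) : cexp (z * IZR n) = cexp z ^^ n.
Proof.
assert (Hz := cexp_neq_0 z). revert n. apply Z_ind_succ.
- replace (z * IZR 0) with (RtoC 0) by ring. exact cexp_0.
- intros n. rewrite Cpowz_succ by exact Hz.
  replace (z * IZR (n + 1)) with (z * IZR n + z) by (rewrite plus_IZR, RtoC_plus; ring).
  rewrite cexp_add. split; intros E; [now rewrite E|].
  now apply (Cmult_cancel_r _ _ _ Hz).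
Qed.

Lemma cexp_PI_half : cexp (PI * Ci * / 2) = Ci.
Proof.
replace (PI * Ci * / 2) with ((0, PI / 2)%R : C).
- unfold cexp, Re, Im. simpl. rewrite exp_0, cos_PI2, sin_PI2. unfold Ci. f_equal; ring.
- rewrite <- RtoC_inv by lra. unfold Ci, Cmult, RtoC. simpl. f_equal; field.
Qed.

Lemma cexp_PI : cexp (PI * Ci) = - (1).
Proof.
replace (PI * Ci) with (PI * Ci * / 2 + PI * Ci * / 2).
- rewrite cexp_add, cexp_PI_half. unfold Ci. apply injective_projections; simpl; ring.
- field.
Qed.

Lemma Cmod_cexp (z : C) : Cmod (cexp z) = exp (Re z).
Proof.
unfold cexp, Cmod. simpl fst. simpl snd.
replace ((exp (Re z) * cos (Im z)) ^ 2 + (exp (Re z) * sin (Im z)) ^ 2)%R with (exp (Re z) ^ 2)%R.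
- apply sqrt_pow2. left. apply exp_pos.
- assert (H := sin2_cos2 (Im z)). unfold Rsqr in H.
  transitivity (exp (Re z) ^ 2 * (sin (Im z) * sin (Im z) + cos (Im z) * cos (Im z)))%R; [|ring].
  rewrite H. ring.
Qed.

Lemma nome_neq_0 (tau : C) : nome tau <> 0.
Proof. apply cexp_neq_0. Qed.

Lemma Cmod_nome_lt_1 (tau : C) : (0 < Im tau)%R -> (Cmod (nome tau) < 1)%R.
Proof.
intros H. unfold nome, qpow. rewrite Cmod_cexp.
apply Rlt_le_trans with (exp 0); [apply exp_increasing | right; apply exp_0].
destruct tau as [a b]. unfold Im in H. simpl in H. simpl.
assert (HP := PI_RGT_0). assert (K := Rmult_lt_0_compat _ _ HP H). lra.
Qed.

Lemma qpow_add (tau s t : C) : qpow tau (s + t) = qpow tau s * qpow tau t.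
Proof. unfold qpow. rewrite <- cexp_add. f_equal. ring. Qed.

Lemma qpow_IZR (tau : C) (n : Z) : qpow tau (IZR n) = nome tau ^^ n.
Proof. unfold nome, qpow. rewrite <- cexp_Cpowz. f_equal. ring. Qed.

Lemma qpow_opp (tau s : C) : qpow tau (- s) = / qpow tau s.
Proof. unfold qpow. rewrite <- cexp_opp. f_equal. ring. Qed.

Lemma RtoC_m1 : RtoC (-1) = - (1).
Proof. apply injective_projections; simpl; ring. Qed.

(** * The generalized [mu]-function as a [1psi1]-type series *)

Lemma IZR_tri_C (n : Z) : RtoC (IZR (tri n)) = (IZR n * IZR n - IZR n) * / 2.
Proof.
rewrite IZR_tri. rewrite <- RtoC_inv, <- !RtoC_mult, <- RtoC_minus, <- RtoC_mult by lra.
f_equal. field.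
Qed.

(** Since [(n + 1/2)^2 / 2 = tri n + n + 1/8], the series is the triple product at [y q] rather than
    at [y]; [theta(y q) = - theta(y) / y] then accounts for the sign and for the division by [y].
    The factor [Ci] is [exp (PI i / 2)], coming from the half period [/ 2] added to the argument. *)
Lemma vartheta11_eq (tau v : C) : (0 < Im tau)%R ->
  let q := nome tau in
  let y := cexp (2 * PI * Ci * v) in
  vartheta11 tau v = - (Ci * qpow tau (/ 8) * cexp (PI * Ci * v) / y * (qpoch_inf q q * th q y)).
Proof.
intros Htau q y. assert (Hq0 := nome_neq_0 tau). assert (Hq := Cmod_nome_lt_1 tau Htau).
fold q in Hq0, Hq. assert (Hy : y <> 0) by apply cexp_neq_0.
assert (Hyq : y * q <> 0) by now apply Cmult_neq_0.
assert (H := jacobi_triple_product q (y * q) Hq0 Hq Hyq).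
apply (is_zseries_scal (Ci * qpow tau (/ 8) * cexp (PI * Ci * v))) in H.
assert (T := th_shift q y 1 Hq0 Hq Hy).
replace (q ^^ 1) with q in T by (simpl; ring).
replace (q ^^ tri 1) with (RtoC 1) in T by reflexivity.
replace ((- y) ^^ 1) with (- y) in T by (simpl; ring).
unfold vartheta11. apply is_zseries_unique. rewrite <- T.
replace (- _) with (Ci * qpow tau (/ 8) * cexp (PI * Ci * v) * (qpoch_inf q q * th q (y * q)))
  by (field; exact Hy).
apply is_zseries_ext with (2 := H). intros n. cbv beta.
replace (Ci * qpow tau (/ 8)) with (cexp (PI * Ci * / 2) * qpow tau (/ 8))
  by (rewrite cexp_PI_half; reflexivity).
replace (- (y * q)) with (- (1) * (y * q)) by ring.
rewrite <- cexp_PI, !Cpowz_mult_l by (try assumption; apply cexp_neq_0).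
unfold y, q, nome, qpow. rewrite <- !cexp_Cpowz, IZR_tri_C, <- !cexp_add. f_equal.
field.
Qed.

(** The substitution [m = n + 1] turns [n (n + 1) / 2] into [tri m] and leaves the constant
    [- cexp (PI * Ci * v) / y]. The convergence statement is kept as a separate conjunct because the
    comparison with the original function at [alpha = 1] concerns the series itself. *)
Lemma gen_mu_eq (tau u v alpha l : C) : (0 < Im tau)%R ->
  let q := nome tau in
  let x := cexp (2 * PI * Ci * u) in
  let y := cexp (2 * PI * Ci * v) in
  let a := qpow tau alpha in
  ~ is_qpower q y ->
  is_zseries (fun m => (- y) ^^ m * q ^^ tri m *
    (qpoch_inf q (x * q ^^ m) / qpoch_inf q (x / a * q ^^ m))) l ->
  is_zseries (fun n =>
      (-1) ^^ n * cexp (2 * PI * Ci * (IZR n + / 2) * v)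
      * q ^^ (n * (n + 1) / 2)
      * (qpoch_inf q (x * q ^^ (n + 1))
         / qpoch_inf q (x * qpow tau (IZR n - alpha + 1)))) (- cexp (PI * Ci * v) / y * l)
  /\ gen_mu tau u v alpha =
     - Ci * qpow tau (- / 8) * cexp (PI * Ci * alpha * (u - v)) * (l / (qpoch_inf q q * th q y)).
Proof.
intros Htau q x y a Hpy Hl. assert (Hq0 := nome_neq_0 tau). assert (Hq := Cmod_nome_lt_1 tau Htau).
fold q in Hq0, Hq. assert (Hy : y <> 0) by apply cexp_neq_0.
assert (Ha : a <> 0) by apply cexp_neq_0.
assert (Hmy := Copp_neq_0 y Hy).
assert (H : is_zseries (fun n =>
      (-1) ^^ n * cexp (2 * PI * Ci * (IZR n + / 2) * v)
      * q ^^ (n * (n + 1) / 2)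
      * (qpoch_inf q (x * q ^^ (n + 1))
         / qpoch_inf q (x * qpow tau (IZR n - alpha + 1)))) (- cexp (PI * Ci * v) / y * l)).
{ apply is_zseries_succ in Hl. apply (is_zseries_scal (- cexp (PI * Ci * v) / y)) in Hl.
  apply is_zseries_ext with (2 := Hl). intros n. cbv beta.
  replace (x * qpow tau (IZR n - alpha + 1)) with (x / a * q ^^ (n + 1)).
  2:{ unfold Cminus. rewrite !qpow_add, qpow_opp. fold a.
      change (qpow tau 1) with q. rewrite qpow_IZR. fold q. rewrite Cpowz_succ by exact Hq0.
      field. exact Ha. }
  replace (n * (n + 1) / 2)%Z with (tri (n + 1)).
  2:{ unfold tri. f_equal. ring. }
  rewrite RtoC_m1, (Cpowz_succ (- y)), (Cpowz_opp_l y) by assumption.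
  replace (cexp (2 * PI * Ci * (IZR n + / 2) * v)) with (y ^^ n * cexp (PI * Ci * v)).
  2:{ unfold y. rewrite <- cexp_Cpowz, <- cexp_add. f_equal. field. }
  set (X := qpoch_inf q _ / qpoch_inf q _). field. exact Hy. }
split; [exact H|].
unfold gen_mu. fold q. fold x. rewrite (is_zseries_unique _ _ H).
rewrite vartheta11_eq by exact Htau. fold q. fold y.
rewrite qpow_opp.
assert (HP := qpoch_inf_q_neq_0 q Hq0 Hq). assert (Ht := th_neq_0 q y Hq0 Hq Hy Hpy).
assert (He := cexp_neq_0 (PI * Ci * v)).
assert (H8 : qpow tau (/ 8) <> 0) by apply cexp_neq_0.
assert (Hi : Ci <> 0) by (rewrite <- cexp_PI_half; apply cexp_neq_0).
replace (- Ci) with (/ Ci) by (rewrite Ci_inv; reflexivity).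
set (e1 := cexp (PI * Ci * alpha * (u - v))). set (e2 := cexp (PI * Ci * v)) in *.
set (e3 := qpow tau (/ 8)) in *. set (t := th q y) in *. set (p := qpoch_inf q q) in *.
field. tauto.
Qed.

(** * The two forms of the bilateral series *)

Lemma qtheta_th (q z : C) : qtheta q z = th q z.
Proof. unfold qtheta, qpochs_inf, th. simpl. ring. Qed.

(** Up to a factor free of [n], [(x/a)_n / (x)_n] is [(x q^n)_oo / (x q^n / a)_oo], and likewise for
    [y]; the exponents agree since [4 tri n - n = 2 n^2 - 3 n]. *)
Lemma vwp_term_eq (q x y a : C) (n : Z) : q <> 0 -> (Cmod q < 1)%R ->
  x <> 0 -> y <> 0 -> a <> 0 ->
  ~ is_qpower q x -> ~ is_qpower q y -> ~ is_qpower q (x / a) -> ~ is_qpower q (y / a) ->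
  (1 - x * y / a * q ^^ (2 * n - 1))
       * (qpochs q [x / a; y / a] n / qpochs q [x; y] n)
       * q ^^ (2 * n ^ 2 - 3 * n) * (x ^ 2 * y ^ 2 / a) ^^ n
  = qpoch_inf q (x / a) * qpoch_inf q (y / a) / (qpoch_inf q x * qpoch_inf q y) *
    ((1 - x * (y / a) / q * q ^^ (2 * n)) * q ^^ (4 * tri n - n) * (x ^ 2 * (y / a) * y) ^^ n
      * (qpoch_inf q (x * q ^^ n) * qpoch_inf q (y * q ^^ n)
         / (qpoch_inf q (x / a * q ^^ n) * qpoch_inf q (y / a * q ^^ n)))).
Proof.
intros Hq0 Hq Hx Hy Ha Hpx Hpy Hpxa Hpya.
replace (2 * n ^ 2 - 3 * n)%Z with (4 * tri n - n)%Z by (assert (T := tri_double n); nia).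
replace (x ^ 2 * (y / a) * y) with (x ^ 2 * y ^ 2 / a) by (field; exact Ha).
replace (x * (y / a) / q * q ^^ (2 * n)) with (x * y / a * q ^^ (2 * n - 1)).
2:{ rewrite Cpowz_sub by exact Hq0. simpl (q ^^ 1). field. tauto. }
unfold qpochs, qpoch. cbn [map fold_right].
rewrite !(Cmult_comm (q ^^ n)).
assert (N1 := qpoch_inf_nz q x n Hq0 Hq Hpx). assert (N2 := qpoch_inf_nz q y n Hq0 Hq Hpy).
assert (N3 := qpoch_inf_nz q _ n Hq0 Hq Hpxa). assert (N4 := qpoch_inf_nz q _ n Hq0 Hq Hpya).
assert (M1 := qpoch_inf_nz0 q x Hq0 Hq Hpx). assert (M2 := qpoch_inf_nz0 q y Hq0 Hq Hpy).
set (p1 := qpoch_inf q (x * q ^^ n)) in *. set (p2 := qpoch_inf q (y * q ^^ n)) in *.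
set (p3 := qpoch_inf q (x / a * q ^^ n)) in *. set (p4 := qpoch_inf q (y / a * q ^^ n)) in *.
set (r1 := qpoch_inf q x) in *. set (r2 := qpoch_inf q y) in *.
set (r3 := qpoch_inf q (x / a)) in *. set (r4 := qpoch_inf q (y / a)) in *.
set (A := x * y / a * q ^^ (2 * n - 1)). set (g := (x ^ 2 * y ^ 2 / a) ^^ n).
field. tauto.
Qed.

Lemma is_qpower_sqr (q s : C) : q <> 0 -> is_qpower q s -> is_qpower q (s ^ 2).
Proof.
intros Hq [n ->]. exists (n + n)%Z. rewrite Cpowz_add by exact Hq. simpl. ring.
Qed.

(** Applied to [s] and to [- s], this produces the very well poised factor
    [(1 - s^2 q^(2n)) / (1 - s^2)]. *)
Lemma qpoch_ratio (q s : C) (n : Z) : q <> 0 -> (Cmod q < 1)%R -> ~ is_qpower q s ->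
  qpoch q (q * s) n / qpoch q s n = (1 - s * q ^^ n) / (1 - s).
Proof.
intros Hq0 Hq Hs. unfold qpoch.
assert (E0 := qpoch_inf_step q s Hq). assert (En := qpoch_inf_stepz q s n Hq0 Hq).
assert (N0 := qpoch_inf_nz0 q s Hq0 Hq Hs). assert (Nn := qpoch_inf_nz q s n Hq0 Hq Hs).
replace (q ^^ n * (q * s)) with (s * q ^^ (n + 1)) by (rewrite Cpowz_succ by exact Hq0; ring).
replace (q ^^ n * s) with (s * q ^^ n) by ring. replace (q * s) with (s * q) by ring.
rewrite E0, En in *.
assert (H1 : 1 - s <> 0) by (intros E; apply N0; rewrite E; ring).
assert (H2 : qpoch_inf q (s * q) <> 0) by (intros E; apply N0; rewrite E; ring).
assert (H3 : 1 - s * q ^^ n <> 0) by (intros E; apply Nn; rewrite E; ring).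
assert (H4 : qpoch_inf q (s * q ^^ (n + 1)) <> 0) by (intros E; apply Nn; rewrite E; ring).
field. tauto.
Qed.

Lemma qpoch_neq_0 (q z : C) (n : Z) : q <> 0 -> (Cmod q < 1)%R -> ~ is_qpower q z ->
  qpoch q z n <> 0.
Proof.
intros Hq0 Hq Hz. unfold qpoch. apply Cdiv_neq_0; [now apply qpoch_inf_nz0|].
rewrite Cmult_comm. now apply qpoch_inf_nz.
Qed.

(** Only [s ^ 2] survives, so either square root may be taken. The four zero parameters contribute
    the factor 1 but raise the exponent in [psi_term] to [8 - 4 = 4], hence [q ^^ (4 * tri n)]; the
    remaining [q^(-n)] comes from the argument of the series. *)
Lemma psi_term_eq (q x y a s : C) (n : Z) : q <> 0 -> (Cmod q < 1)%R ->
  x <> 0 -> y <> 0 -> a <> 0 ->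
  ~ is_qpower q x -> ~ is_qpower q y -> ~ is_qpower q (x * y / (a * q)) ->
  s ^ 2 = x * y / (a * q) ->
  psi_term q [q * s; - (q * s); x / a; y / a]
    [s; - s; y; x; RtoC 0; RtoC 0; RtoC 0; RtoC 0] (x ^ 2 * y ^ 2 / (a * q)) n
  = / (1 - x * y / (a * q)) *
    ((1 - x * y / a * q ^^ (2 * n - 1))
       * (qpochs q [x / a; y / a] n / qpochs q [x; y] n)
       * q ^^ (2 * n ^ 2 - 3 * n) * (x ^ 2 * y ^ 2 / a) ^^ n).
Proof.
intros Hq0 Hq Hx Hy Ha Hpx Hpy HpA Hs.
assert (Hps : ~ is_qpower q s).
{ intros H. apply HpA. rewrite <- Hs. now apply is_qpower_sqr. }
assert (Hpms : ~ is_qpower q (- s)).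
{ intros H. apply HpA. rewrite <- Hs. replace (s ^ 2) with ((- s) ^ 2) by ring.
  now apply is_qpower_sqr. }
assert (R1 := qpoch_ratio q s n Hq0 Hq Hps).
assert (R2 := qpoch_ratio q (- s) n Hq0 Hq Hpms).
replace (q * - s) with (- (q * s)) in R2 by ring.
assert (N1 := qpoch_neq_0 q s n Hq0 Hq Hps). assert (N2 := qpoch_neq_0 q (- s) n Hq0 Hq Hpms).
assert (N3 := qpoch_neq_0 q x n Hq0 Hq Hpx). assert (N4 := qpoch_neq_0 q y n Hq0 Hq Hpy).
assert (HA1 : 1 - x * y / (a * q) <> 0).
{ apply Csub_neq_0. intros E. apply HpA. exists 0%Z. now rewrite <- E. }
assert (H1s : 1 - s <> 0).
{ apply Csub_neq_0. intros E. apply Hps. exists 0%Z. now rewrite <- E. }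
assert (H2s : 1 - - s <> 0).
{ apply Csub_neq_0. intros E. apply Hpms. exists 0%Z. now rewrite <- E. }
assert (Hp0 : qpoch q 0 n = 1).
{ unfold qpoch. rewrite Cmult_0_r, qpoch_inf_0 by exact Hq. field. }
unfold psi_term, qpochs. simpl length. cbn [map fold_right]. rewrite Hp0.
replace (Z.of_nat 8 - Z.of_nat 4)%Z with 4%Z by reflexivity. fold (tri n).
rewrite RtoC_m1.
assert (E4 : ((- (1)) ^^ n * q ^^ tri n) ^^ 4 = q ^^ (4 * tri n)).
{ assert (S1 := Cpowz_m1_sqr n). set (e := (- (1)) ^^ n) in *.
  replace (4 * tri n)%Z with (tri n + tri n + (tri n + tri n))%Z by lia.
  rewrite !Cpowz_add by exact Hq0. set (t := q ^^ tri n).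
  transitivity ((e * e) * (e * e) * (t * t * (t * t))); [simpl; ring|]. rewrite S1. ring. }
rewrite E4.
replace (2 * n ^ 2 - 3 * n)%Z with (4 * tri n - n)%Z by (assert (T := tri_double n); nia).
replace (2 * n - 1)%Z with (n + n - 1)%Z by lia.
rewrite !Cpowz_sub, (Cpowz_add q n n) by exact Hq0. simpl (q ^^ 1).
replace (x ^ 2 * y ^ 2 / (a * q)) with (x ^ 2 * y ^ 2 / a / q) by (field; tauto).
rewrite (Cpowz_div_l (x ^ 2 * y ^ 2 / a) q);
  [|apply Cdiv_neq_0; [apply Cmult_neq_0; now apply Cpow_nz | exact Ha] | exact Hq0].
assert (Hqn := Cpowz_neq_0 q n Hq0).
set (g := (x ^ 2 * y ^ 2 / a) ^^ n).
set (t4 := q ^^ (4 * tri n)).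
set (p1 := qpoch q s n) in *. set (p2 := qpoch q (- s) n) in *.
set (p3 := qpoch q x n) in *. set (p4 := qpoch q y n) in *.
set (p5 := qpoch q (x / a) n). set (p6 := qpoch q (y / a) n).
replace (qpoch q (q * s) n) with ((1 - s * q ^^ n) / (1 - s) * p1) by (rewrite <- R1; field; exact N1).
replace (qpoch q (- (q * s)) n) with ((1 - - s * q ^^ n) / (1 - - s) * p2) by (rewrite <- R2; field; exact N2).
set (r := q ^^ n) in *.
replace (x * y / a * (r * r / (q * 1))) with (s ^ 2 * (r * r)) by (rewrite Hs; field; tauto).
rewrite <- Hs in HA1 |- *.
field. repeat split; assumption.
Qed.

Lemma gen_mu_4psi8 (tau u v alpha : C) (Htau : (0 < Im tau)%R) :
  let q := nome tau in
  let x := cexp (2 * PI * Ci * u) in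
  let y := cexp (2 * PI * Ci * v) in
  let a := qpow tau alpha in
  let pref :=
    - Ci * qpow tau (- / 8) * cexp (PI * Ci * alpha * (u - v))
    * (qpochs_inf q [x; y; a * q / x; a * q / y]
       / (qpoch_inf q q * qtheta q y * qtheta q (x / a)
          * qtheta q (x * y / (a * q)))) in
  let term := fun n : Z =>
    (1 - x * y / a * q ^^ (2 * n - 1))
    * (qpochs q [x / a; y / a] n / qpochs q [x; y] n)
    * q ^^ (2 * n ^ 2 - 3 * n) * (x ^ 2 * y ^ 2 / a) ^^ n in
  ~ is_qpower q x -> ~ is_qpower q y ->
  ~ is_qpower q (x / a) -> ~ is_qpower q (y / a) ->
  ~ is_qpower q (x * y / a) ->
  (forall s : C, s ^ 2 = x * y / (a * q) ->
     let al := [q * s; - (q * s); x / a; y / a] in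
     let bl := [s; - s; y; x; RtoC 0; RtoC 0; RtoC 0; RtoC 0] in
     let z := x ^ 2 * y ^ 2 / (a * q) in
     ex_zseries (psi_term q al bl z) /\
     gen_mu tau u v alpha
     = pref * (1 - x * y / (a * q)) * psi q al bl z) /\
  ex_zseries term /\
  gen_mu tau u v alpha = pref * ZSeries term.
Proof.
intros q x y a pref term Hpx Hpy Hpxa Hpya Hpxya.
assert (Hq0 : q <> 0) by apply nome_neq_0. assert (Hq := Cmod_nome_lt_1 tau Htau). fold q in Hq.
assert (Hx : x <> 0) by apply cexp_neq_0. assert (Hy : y <> 0) by apply cexp_neq_0.
assert (Ha : a <> 0) by apply cexp_neq_0.
assert (Hxa : x / a <> 0) by now apply Cdiv_neq_0. assert (Hya : y / a <> 0) by now apply Cdiv_neq_0.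
assert (Exy : x * (y / a) = x * y / a) by (field; exact Ha).
assert (HA : x * (y / a) / q = x * y / (a * q)) by (field; tauto).
assert (HpA : ~ is_qpower q (x * y / (a * q))).
{ intros H. apply Hpxya. apply (is_qpower_mul q _ (-1) Hq0).
  replace (x * y / a * q ^^ (-1)) with (x * y / (a * q)); [exact H|]. simpl. field. tauto. }
rewrite <- Exy in Hpxya.
destruct (bailey_bilateral q x y (x / a) (y / a) Hq0 Hq Hx Hy Hxa Hya) as (l & Hl & HS);
  try assumption.
{ field. exact Ha. }
destruct (gen_mu_eq tau u v alpha l Htau Hpy Hl) as [_ Hmu]. fold q x y in Hmu.
assert (M1 := qpoch_inf_nz0 q x Hq0 Hq Hpx). assert (M2 := qpoch_inf_nz0 q y Hq0 Hq Hpy).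
assert (Tya := th_neq_0 q _ Hq0 Hq Hya Hpya). assert (Txa := th_neq_0 q _ Hq0 Hq Hxa Hpxa).
assert (Ty := th_neq_0 q _ Hq0 Hq Hy Hpy).
assert (HA0 : x * y / (a * q) <> 0)
  by (apply Cdiv_neq_0; apply Cmult_neq_0; assumption).
assert (TA := th_neq_0 q _ Hq0 Hq HA0 HpA).
assert (Hpq := qpoch_inf_q_neq_0 q Hq0 Hq).
rewrite HA in HS.
set (kap := qpoch_inf q (x / a) * qpoch_inf q (y / a) / (qpoch_inf q x * qpoch_inf q y)).
assert (Hterm : is_zseries term (kap * (th q (x * y / (a * q)) / th q (y / a) * l))).
{ apply is_zseries_ext with (2 := is_zseries_scal kap _ _ HS). intros n.
  symmetry. unfold kap, term. rewrite <- HA. now apply vwp_term_eq. }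
assert (Hval : gen_mu tau u v alpha = pref * (kap * (th q (x * y / (a * q)) / th q (y / a) * l))).
{ rewrite Hmu. unfold pref, kap. rewrite !qtheta_th.
  replace (qpochs_inf q [x; y; a * q / x; a * q / y])
    with (qpoch_inf q x * qpoch_inf q y * (qpoch_inf q (q / (x / a)) * qpoch_inf q (q / (y / a)))).
  2:{ unfold qpochs_inf. simpl.
      replace (q / (x / a)) with (a * q / x) by (field; tauto).
      replace (q / (y / a)) with (a * q / y) by (field; tauto). ring. }
  set (e := - Ci * qpow tau (- / 8) * cexp (PI * Ci * alpha * (u - v))).
  (* The constant [kap] completes [(aq/x, aq/y)_oo] to [theta(x/a) theta(y/a)], so the two inserted
     quotients equal 1. *)
  transitivity (e * (l / (qpoch_inf q q * th q y)) *
    ((qpoch_inf q (x / a) * qpoch_inf q (q / (x / a))) / th q (x / a)) *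
    ((qpoch_inf q (y / a) * qpoch_inf q (q / (y / a))) / th q (y / a))).
  - fold (th q (x / a)) (th q (y / a)). field. tauto.
  - field. tauto. }
split; [|split].
- intros s Hs al bl z.
  assert (HA1 : 1 - x * y / (a * q) <> 0).
  { apply Csub_neq_0. intros E. apply HpA. exists 0%Z. now rewrite <- E. }
  assert (Hpsi : is_zseries (psi_term q al bl z)
    (/ (1 - x * y / (a * q)) * (kap * (th q (x * y / (a * q)) / th q (y / a) * l)))).
  { apply is_zseries_ext with (2 := is_zseries_scal (/ (1 - x * y / (a * q))) _ _ Hterm).
    intros n. symmetry. now apply psi_term_eq. }
  split; [now exists (/ (1 - x * y / (a * q)) * (kap * (th q (x * y / (a * q)) / th q (y / a) * l)))|].
  unfold psi. rewrite (is_zseries_unique _ _ Hpsi), Hval.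
  set (w := kap * _). set (d := 1 - x * y / (a * q)) in *. field. exact HA1.
- now exists (kap * (th q (x * y / (a * q)) / th q (y / a) * l)).
- now rewrite (is_zseries_unique _ _ Hterm).
Qed.

(** * The case a = q: the original mu-function *)

Lemma qtheta_shift_sqr (q z : C) : q <> 0 -> (Cmod q < 1)%R -> z <> 0 ->
  qtheta q (z / q ^ 2) = z ^ 2 / q ^ 3 * qtheta q z.
Proof.
intros Hq0 Hq Hz. rewrite !qtheta_th.
assert (Hz2 : z / q ^ 2 <> 0) by (apply Cdiv_neq_0; [exact Hz | now apply Cpow_nz]).
assert (T := th_shift q (z / q ^ 2) 2 Hq0 Hq Hz2).
rewrite <- T. replace (q ^^ tri 2) with q by (change (tri 2) with 1%Z; simpl; ring).
replace (z / q ^ 2 * q ^^ 2) with z by (simpl; field; exact Hq0).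
replace ((- (z / q ^ 2)) ^^ 2) with ((z / q ^ 2) * (z / q ^ 2)) by (simpl; ring).
field. exact Hq0.
Qed.

(** At [alpha = 1] the quotient of products collapses to [1 / (1 - x q^n)], and the half-integer
    power of [y] inside the series changes the prefactor [e^(PI i (u - v))] into [e^(PI i u)].
    Moving that constant out of [ZSeries] needs convergence, which [bailey_bilateral] provides. *)
Lemma zwegers_mu_eq (tau u v : C) : (0 < Im tau)%R ->
  let q := nome tau in
  let x := cexp (2 * PI * Ci * u) in
  let y := cexp (2 * PI * Ci * v) in
  ~ is_qpower q x -> ~ is_qpower q y -> ~ is_qpower q (x * y) ->
  zwegers_mu tau u v = gen_mu tau u v 1.
Proof.
intros Htau q x y Hpx Hpy Hpxy.
assert (Hq0 : q <> 0) by apply nome_neq_0. assert (Hq := Cmod_nome_lt_1 tau Htau). fold q in Hq.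
assert (Hx : x <> 0) by apply cexp_neq_0. assert (Hy : y <> 0) by apply cexp_neq_0.
assert (Hqp : forall z, ~ is_qpower q z -> ~ is_qpower q (z / q)).
{ intros z Hz H. apply Hz. apply (is_qpower_mul q _ (-1) Hq0). simpl. rewrite Cmult_1_r. exact H. }
assert (Exy : x * (y / q) = x * y / q) by (field; exact Hq0).
destruct (bailey_bilateral q x y (x / q) (y / q) Hq0 Hq Hx Hy) as (l & Hl & _);
  try (apply Cdiv_neq_0; assumption); try (now apply Hqp); try assumption.
{ field. exact Hq0. }
{ rewrite Exy. now apply Hqp. }
destruct (gen_mu_eq tau u v 1 l Htau Hpy Hl) as [HG _]. fold q x y in HG.
unfold gen_mu, zwegers_mu. fold q x y. rewrite (is_zseries_unique _ _ HG).
apply (is_zseries_scal (/ cexp (PI * Ci * v))) in HG.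
assert (He := cexp_neq_0 (PI * Ci * v)).
rewrite (is_zseries_unique _ (/ cexp (PI * Ci * v) * (- cexp (PI * Ci * v) / y * l))).
- replace (PI * Ci * u) with (PI * Ci * 1 * (u - v) + PI * Ci * v) by ring.
  rewrite cexp_add. unfold Cdiv. set (t := / vartheta11 tau v). field. tauto.
- apply is_zseries_ext with (2 := HG). intros n. cbv beta.
  replace (IZR n - 1 + 1) with (RtoC (IZR n)) by ring. rewrite qpow_IZR. fold q.
  assert (Hn := qpoch_inf_nz q x n Hq0 Hq Hpx).
  rewrite (qpoch_inf_stepz q x n Hq0 Hq) in Hn |- *.
  replace (2 * PI * Ci * (IZR n + / 2) * v) with (2 * PI * Ci * IZR n * v + PI * Ci * v) by field.
  rewrite cexp_add.
  assert (H1 : 1 - x * q ^^ n <> 0) by (intros E; apply Hn; rewrite E; ring).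
  assert (H2 : qpoch_inf q (x * q ^^ (n + 1)) <> 0) by (intros E; apply Hn; rewrite E; ring).
  set (p := qpoch_inf q (x * q ^^ (n + 1))) in *. set (e := cexp (PI * Ci * v)) in *.
  set (e' := cexp (2 * PI * Ci * IZR n * v)). set (d := 1 - x * q ^^ n) in *.
  set (m := (-1) ^^ n). field. tauto.
Qed.

(** Taken at [n + 1] because the sums for [a = q] are reindexed by one, which gives the denominators
    [1 - z q^n]. *)
Lemma qpoch_div_q_ratio (q z : C) (n : Z) : q <> 0 -> (Cmod q < 1)%R -> ~ is_qpower q z ->
  qpoch q (z / q) (n + 1) / qpoch q z (n + 1) = (1 - z / q) / (1 - z * q ^^ n).
Proof.
intros Hq0 Hq Hz.
assert (Hzq : ~ is_qpower q (z / q)).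
{ intros H. apply Hz. apply (is_qpower_mul q _ (-1) Hq0). simpl. rewrite Cmult_1_r. exact H. }
assert (R := qpoch_ratio q (z / q) (n + 1) Hq0 Hq Hzq).
replace (q * (z / q)) with z in R by (field; exact Hq0).
replace (z / q * q ^^ (n + 1)) with (z * q ^^ n) in R
  by (rewrite Cpowz_succ by exact Hq0; field; exact Hq0).
assert (N := qpoch_neq_0 q z (n + 1) Hq0 Hq Hz). assert (N' := qpoch_neq_0 q _ (n + 1) Hq0 Hq Hzq).
assert (H1 : 1 - z / q <> 0).
{ apply Csub_neq_0. intros E. apply Hzq. exists 0%Z. now rewrite <- E. }
assert (H2 : 1 - z * q ^^ n <> 0).
{ apply Csub_neq_0. intros E. apply Hz. apply (is_qpower_mul q _ n Hq0). exists 0%Z. now rewrite <- E. }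
set (p := qpoch q z (n + 1)) in *. set (p' := qpoch q (z / q) (n + 1)) in *.
set (d := 1 - z * q ^^ n) in *. set (d' := 1 - z / q) in *.
replace p with (d / d' * p') by (rewrite <- R; field; exact N').
field. tauto.
Qed.

(** [1 / (1 - z q^n)] is the quotient [(z q^(n+1))_oo / (z q^n)_oo], whose quadratic exponents
    cancel; the zero exponent is left in the form in which the product rule delivers it. *)
Lemma grow_inv_one_minus (q z : C) : q <> 0 -> (Cmod q < 1)%R -> z <> 0 -> ~ is_qpower q z ->
  grow q zabs (fun n => - negsq n + negsq n)%R (fun n => / (1 - z * q ^^ n)).
Proof.
intros Hq0 Hq Hz Hp.
assert (Hzq : z * q <> 0) by now apply Cmult_neq_0.
assert (Hpq : ~ is_qpower q (z * q)).
{ intros H. apply Hp. apply (is_qpower_mul q _ 1 Hq0). simpl. rewrite Cmult_1_r. exact H. }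
destruct (grow_mult _ _ _ _ _ _ (grow_qpoch q _ Hq0 Hq Hzq Hpq) (grow_qpoch_inv q z Hq0 Hq Hz Hp))
  as (k & m & Hm & H).
exists k, m. split; [exact Hm|]. intros n.
replace (/ (1 - z * q ^^ n)) with (qpoch_inf q (z * q * q ^^ n) * / qpoch_inf q (z * q ^^ n)); [apply H|].
assert (N := qpoch_inf_nz q z n Hq0 Hq Hp).
rewrite (qpoch_inf_stepz q z n Hq0 Hq) in N |- *.
replace (z * q * q ^^ n) with (z * q ^^ (n + 1)) by (rewrite Cpowz_succ by exact Hq0; ring).
field. split; intros E; apply N; rewrite E; ring.
Qed.

Lemma ex_zseries_appell (q z w : C) : q <> 0 -> (Cmod q < 1)%R -> z <> 0 -> w <> 0 ->
  ~ is_qpower q z -> ~ is_qpower q w ->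
  ex_zseries (fun n => z ^^ (2 * n) * w ^^ (2 * n) * q ^^ (2 * n ^ 2)
    / ((1 - z * q ^^ n) * (1 - w * q ^^ n))).
Proof.
intros Hq0 Hq Hz Hw Hpz Hpw.
assert (G := grow_mult _ _ _ _ _ _
  (grow_mult _ _ _ _ _ _
    (grow_mult _ _ _ _ _ _ (grow_pow q _ (Cpowz_neq_0 z 2 Hz)) (grow_pow q _ (Cpowz_neq_0 w 2 Hw)))
    (grow_qpow q zabs (fun n => (2 * n ^ 2)%Z) Hq0))
  (grow_mult _ _ _ _ _ _ (grow_inv_one_minus q z Hq0 Hq Hz Hpz) (grow_inv_one_minus q w Hq0 Hq Hw Hpw))).
cbv beta in G. assert (H2 : (0 < 2)%R) by lra.
destruct (grow_decay q zabs _ _ 2 0 Hq0 Hq H2 G) as [M HM].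
- intros n. assert (E : IZR (2 * n ^ 2) = (2 * IZR n ^ 2)%R).
  { replace (n ^ 2)%Z with (n * n)%Z by ring. rewrite !mult_IZR. ring. }
  rewrite E. unfold zabs. rewrite pow2_abs. lra.
- apply (expdec_ex M). intros n. specialize (HM n).
  assert (Dz : 1 - z * q ^^ n <> 0).
  { apply Csub_neq_0. intros E. apply Hpz. apply (is_qpower_mul q _ n Hq0). exists 0%Z. now rewrite <- E. }
  assert (Dw : 1 - w * q ^^ n <> 0).
  { apply Csub_neq_0. intros E. apply Hpw. apply (is_qpower_mul q _ n Hq0). exists 0%Z. now rewrite <- E. }
  unfold Cdiv. replace (/ ((1 - z * q ^^ n) * (1 - w * q ^^ n)))
    with (/ (1 - z * q ^^ n) * / (1 - w * q ^^ n)) by (field; tauto).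
  rewrite (Cpowz_mult z), (Cpowz_mult w) by assumption. exact HM.
Qed.

Theorem theorem2 (tau u v : C) (Htau : (0 < Im tau)%R) :
  let q := nome tau in
  let x := cexp (2 * PI * Ci * u) in
  let y := cexp (2 * PI * Ci * v) in
  (forall alpha : C,
     let a := qpow tau alpha in
     let pref :=
       - Ci * qpow tau (- / 8) * cexp (PI * Ci * alpha * (u - v))
       * (qpochs_inf q [x; y; a * q / x; a * q / y]
          / (qpoch_inf q q * qtheta q y * qtheta q (x / a)
             * qtheta q (x * y / (a * q)))) in
     let term := fun n : Z =>
       (1 - x * y / a * q ^^ (2 * n - 1))
       * (qpochs q [x / a; y / a] n / qpochs q [x; y] n)
       * q ^^ (2 * n ^ 2 - 3 * n) * (x ^ 2 * y ^ 2 / a) ^^ n in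
     ~ is_qpower q x -> ~ is_qpower q y ->
     ~ is_qpower q (x / a) -> ~ is_qpower q (y / a) ->
     ~ is_qpower q (x * y / a) ->
     (forall s : C, s ^ 2 = x * y / (a * q) ->
        let al := [q * s; - (q * s); x / a; y / a] in
        let bl := [s; - s; y; x; RtoC 0; RtoC 0; RtoC 0; RtoC 0] in
        let z := x ^ 2 * y ^ 2 / (a * q) in
        ex_zseries (psi_term q al bl z) /\
        gen_mu tau u v alpha
        = pref * (1 - x * y / (a * q)) * psi q al bl z) /\
     ex_zseries term /\
     gen_mu tau u v alpha = pref * ZSeries term)
  /\
  (let rxy := cexp (PI * Ci * (u + v)) in
   let pref := Ci * qpow tau (- / 8) * (rxy / (qpoch_inf q q * qtheta q (x * y))) in
   let term := fun n : Z =>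
     (1 - x * y * q ^^ (2 * n)) / ((1 - x * q ^^ n) * (1 - y * q ^^ n))
     * x ^^ (2 * n) * y ^^ (2 * n) * q ^^ (2 * n ^ 2) in
   let term1 := fun n : Z =>
     x ^^ (2 * n) * y ^^ (2 * n) * q ^^ (2 * n ^ 2)
     / ((1 - x * q ^^ n) * (1 - y * q ^^ n)) in
   let term2 := fun n : Z =>
     x ^^ (- 2 * n) * y ^^ (- 2 * n) * q ^^ (2 * n ^ 2)
     / ((1 - / x * q ^^ n) * (1 - / y * q ^^ n)) in
   ~ is_qpower q x -> ~ is_qpower q y -> ~ is_qpower q (x * y) ->
   (forall s : C, s ^ 2 = x * y ->
      let al := [s; - s; x / q; y / q] in
      let bl := [s / q; - (s / q); y; x; RtoC 0; RtoC 0; RtoC 0; RtoC 0] in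
      let z := x ^ 2 * y ^ 2 / q ^ 2 in
      ex_zseries (psi_term q al bl z) /\
      zwegers_mu tau u v
      = Ci * qpow tau (- / 8) * (rxy / ((1 - x / q) * (q - y)))
        * / (qpoch_inf q q * qtheta q (x * y / q ^ 2))
        * (1 - x * y / q ^ 2) * psi q al bl z) /\
   (ex_zseries term /\ zwegers_mu tau u v = pref * ZSeries term) /\
   (ex_zseries term1 /\ ex_zseries term2 /\
    zwegers_mu tau u v = pref * (ZSeries term1 - ZSeries term2))).
Proof.
intros q x y. split; [intros alpha; exact (gen_mu_4psi8 tau u v alpha Htau)|].
intros rxy pref term term1 term2 Hpx Hpy Hpxy.
assert (Hq0 : q <> 0) by apply nome_neq_0. assert (Hq := Cmod_nome_lt_1 tau Htau). fold q in Hq.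
assert (Hx : x <> 0) by apply cexp_neq_0. assert (Hy : y <> 0) by apply cexp_neq_0.
assert (Hqp : forall z, ~ is_qpower q z -> ~ is_qpower q (z / q)).
{ intros z Hz H. apply Hz. apply (is_qpower_mul q _ (-1) Hq0). simpl. rewrite Cmult_1_r. exact H. }
rewrite (zwegers_mu_eq tau u v Htau Hpx Hpy Hpxy).
assert (G := gen_mu_4psi8 tau u v 1 Htau). cbv zeta in G. change (qpow tau 1) with q in G.
fold q x y in G.
specialize (G Hpx Hpy (Hqp _ Hpx) (Hqp _ Hpy) (Hqp _ Hpxy)).
destruct G as (Gpsi & Gex & Gval).
assert (Hxy : x * y <> 0) by now apply Cmult_neq_0.
assert (Hq2 : q * q = q ^ 2) by ring.
rewrite Hq2 in Gpsi, Gval.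
(* The sign changes because [q - y = - y (1 - q / y)], and the square root appears as
   [e^(PI i (u + v)) = e^(PI i (u - v)) y]. *)
assert (Hpref : - Ci * qpow tau (- / 8) * cexp (PI * Ci * 1 * (u - v)) *
  (qpochs_inf q [x; y; q ^ 2 / x; q ^ 2 / y] /
    (qpoch_inf q q * qtheta q y * qtheta q (x / q) * qtheta q (x * y / q ^ 2)))
  = Ci * qpow tau (- / 8) * (rxy / ((1 - x / q) * (q - y)))
        * / (qpoch_inf q q * qtheta q (x * y / q ^ 2))).
{ assert (Ty := th_neq_0 q y Hq0 Hq Hy Hpy).
  assert (Hxq0 : x / q <> 0) by now apply Cdiv_neq_0.
  assert (Txq := th_neq_0 q _ Hq0 Hq Hxq0 (Hqp _ Hpx)).
  assert (Hxyq0 : x * y / q ^ 2 <> 0) by (apply Cdiv_neq_0; [exact Hxy | now apply Cpow_nz]).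
  assert (Hpxyq : ~ is_qpower q (x * y / q ^ 2)).
  { rewrite <- Hq2. replace (x * y / (q * q)) with (x * y / q / q) by (field; exact Hq0).
    now apply Hqp, Hqp. }
  assert (TA := th_neq_0 q _ Hq0 Hq Hxyq0 Hpxyq).
  assert (Hpq := qpoch_inf_q_neq_0 q Hq0 Hq).
  assert (Erxy : rxy = cexp (PI * Ci * 1 * (u - v)) * y).
  { unfold rxy, y. rewrite <- cexp_add. f_equal. ring. }
  rewrite Erxy, !qtheta_th.
  set (e := cexp (PI * Ci * 1 * (u - v))). set (e8 := qpow tau (- / 8)).
  assert (Px : qpoch_inf q (x / q) = (1 - x / q) * qpoch_inf q x).
  { rewrite (qpoch_inf_step q (x / q) Hq). do 2 f_equal. field. exact Hq0. }
  assert (Py : qpoch_inf q (q / y) = (1 - q / y) * qpoch_inf q (q ^ 2 / y)).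
  { rewrite (qpoch_inf_step q (q / y) Hq). do 2 f_equal. field. exact Hy. }
  unfold th in Ty, Txq. unfold th at 1 2. rewrite Py in Ty |- *. rewrite Px in Txq |- *.
  replace (q / (x / q)) with (q ^ 2 / x) in Txq |- * by (field; tauto).
  unfold qpochs_inf. cbn [map fold_right].
  assert (N1 : 1 - x / q <> 0) by (intros E; apply Txq; rewrite E; ring).
  assert (N2 : qpoch_inf q x <> 0) by (intros E; apply Txq; rewrite E; ring).
  assert (N3 : qpoch_inf q (q ^ 2 / x) <> 0) by (intros E; apply Txq; rewrite E; ring).
  assert (N4 : 1 - q / y <> 0) by (intros E; apply Ty; rewrite E; ring).
  assert (N5 : qpoch_inf q y <> 0) by (intros E; apply Ty; rewrite E; ring).
  assert (N6 : qpoch_inf q (q ^ 2 / y) <> 0) by (intros E; apply Ty; rewrite E; ring).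
  replace (q - y) with (- (y * (1 - q / y))) by (field; exact Hy).
  set (d1 := 1 - x / q) in *. set (d2 := 1 - q / y) in *.
  set (p1 := qpoch_inf q (q ^ 2 / x)) in *. set (p2 := qpoch_inf q (q ^ 2 / y)) in *.
  set (p3 := qpoch_inf q x) in *. set (p4 := qpoch_inf q y) in *.
  set (t := th q _) in *. set (p5 := qpoch_inf q q) in *. field. tauto. }
rewrite Hpref in Gpsi, Gval. clear Hpref. clearbody rxy x y q.
assert (D1 : forall z n, ~ is_qpower q z -> 1 - z * q ^^ n <> 0).
{ intros z n Hz. apply Csub_neq_0. intros E. apply Hz.
  apply (is_qpower_mul q _ n Hq0). exists 0%Z. now rewrite <- E. }
assert (Hxq1 : 1 - x / q <> 0).
{ apply Csub_neq_0. intros E. apply (Hqp _ Hpx). exists 0%Z. now rewrite <- E. }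
assert (Hyq1 : 1 - y / q <> 0).
{ apply Csub_neq_0. intros E. apply (Hqp _ Hpy). exists 0%Z. now rewrite <- E. }
assert (Hqy : q - y <> 0).
{ apply Csub_neq_0. intros E. apply Hpy. exists 1%Z. rewrite <- E. simpl. ring. }
(* After the reindexing [n -> n + 1] the summand for [a = q] is a constant multiple of [term]. *)
assert (Hcoef : forall n,
  (1 - x * y / q * q ^^ (2 * (n + 1) - 1))
    * (qpochs q [x / q; y / q] (n + 1) / qpochs q [x; y] (n + 1))
    * q ^^ (2 * (n + 1) ^ 2 - 3 * (n + 1)) * (x ^ 2 * y ^ 2 / q) ^^ (n + 1)
  = (1 - x / q) * (1 - y / q) * (x * y) ^ 2 / q ^ 2 * term n).
{ intros n. unfold qpochs. cbn [map fold_right].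
  assert (Rx := qpoch_div_q_ratio q x n Hq0 Hq Hpx).
  assert (Ry := qpoch_div_q_ratio q y n Hq0 Hq Hpy).
  assert (Nx := qpoch_neq_0 q x (n + 1) Hq0 Hq Hpx).
  assert (Ny := qpoch_neq_0 q y (n + 1) Hq0 Hq Hpy).
  assert (Dx := D1 x n Hpx). assert (Dy := D1 y n Hpy).
  replace (qpoch q (x / q) (n + 1) * (qpoch q (y / q) (n + 1) * 1) /
      (qpoch q x (n + 1) * (qpoch q y (n + 1) * 1)))
    with ((qpoch q (x / q) (n + 1) / qpoch q x (n + 1)) * (qpoch q (y / q) (n + 1) / qpoch q y (n + 1)))
    by (field; tauto).
  rewrite Rx, Ry. unfold term.
  replace (2 * (n + 1) - 1)%Z with (2 * n + 1)%Z by lia.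
  replace (2 * (n + 1) ^ 2 - 3 * (n + 1))%Z with (2 * n ^ 2 + n - 1)%Z by lia.
  assert (Eg : (x ^ 2 * y ^ 2 / q) ^^ (n + 1) = x ^^ (2 * n) * y ^^ (2 * n) * (x * y) ^ 2 / (q ^^ n * q)).
  { assert (Hx2 : x ^ 2 <> 0) by now apply Cpow_nz. assert (Hy2 : y ^ 2 <> 0) by now apply Cpow_nz.
    rewrite Cpowz_div_l, Cpowz_mult_l by first [assumption | apply Cmult_neq_0; assumption].
    rewrite !Cpowz_succ, !Cpowz_mult by assumption.
    change (x ^^ 2) with (x ^ 2). change (y ^^ 2) with (y ^ 2).
    set (X := (x ^ 2) ^^ n). set (Y := (y ^ 2) ^^ n).
    assert (Hn := Cpowz_neq_0 q n Hq0). field. tauto. }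
  rewrite Eg, Cpowz_succ, Cpowz_sub, Cpowz_add by exact Hq0. simpl (q ^^ 1).
  assert (Hn := Cpowz_neq_0 q n Hq0).
  set (dx := 1 - x * q ^^ n) in *. set (dy := 1 - y * q ^^ n) in *.
  set (X := x ^^ (2 * n)). set (Y := y ^^ (2 * n)). set (s := q ^^ (2 * n)).
  set (t := q ^^ (2 * n ^ 2)). set (r := q ^^ n) in *.
  field. tauto. }
assert (Hk : (1 - x / q) * (1 - y / q) * (x * y) ^ 2 / q ^ 2 <> 0).
{ apply Cdiv_neq_0; [|now apply Cpow_nz].
  apply Cmult_neq_0; [now apply Cmult_neq_0 | now apply Cpow_nz]. }
set (k := (1 - x / q) * (1 - y / q) * (x * y) ^ 2 / q ^ 2) in *.
destruct Gex as [S HS]. rewrite (is_zseries_unique _ _ HS) in Gval.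
assert (Hterm : is_zseries term (/ k * S)).
{ apply is_zseries_succ in HS. apply (is_zseries_scal (/ k)) in HS.
  apply is_zseries_ext with (2 := HS). intros n. cbv beta. rewrite Hcoef. field. exact Hk. }
assert (Hpxyt := th_neq_0 q _ Hq0 Hq Hxy Hpxy).
assert (Hpq := qpoch_inf_q_neq_0 q Hq0 Hq).
(* [theta(x y / q^2) = (x y)^2 q^(-3) theta(x y)] cancels the constant [k] against the factors
   [1 - x / q] and [q - y] of the prefactor. *)
assert (Hval : gen_mu tau u v 1 = pref * (/ k * S)).
{ rewrite Gval. unfold pref. rewrite qtheta_shift_sqr, qtheta_th by assumption.
  set (t := th q _) in *. unfold k.
  assert (Ey : 1 - y / q = (q - y) / q) by (field; exact Hq0). rewrite Ey.
  set (d1 := 1 - x / q) in *. set (d2 := q - y) in *. set (e8 := qpow tau (- / 8)).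
  set (p := qpoch_inf q q) in *. field. tauto. }
split; [|split].
- intros s Hs al bl z.
  assert (Hs' : (s / q) ^ 2 = x * y / q ^ 2).
  { replace ((s / q) ^ 2) with (s ^ 2 / q ^ 2) by (field; exact Hq0). now rewrite Hs. }
  specialize (Gpsi (s / q) Hs'). replace (q * (s / q)) with s in Gpsi by (field; exact Hq0).
  exact Gpsi.
- split; [now exists (/ k * S) | now rewrite (is_zseries_unique _ _ Hterm)].
- assert (H1 : ex_zseries term1) by exact (ex_zseries_appell q x y Hq0 Hq Hx Hy Hpx Hpy).
  assert (H2 : ex_zseries term2).
  { assert (Hpx' : ~ is_qpower q (/ x)) by (intros H; apply Hpx; now apply is_qpower_inv).
    assert (Hpy' : ~ is_qpower q (/ y)) by (intros H; apply Hpy; now apply is_qpower_inv).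
    destruct (ex_zseries_appell q (/ x) (/ y) Hq0 Hq (Cinv_neq_0 x Hx) (Cinv_neq_0 y Hy) Hpx' Hpy') as [s Hs].
    exists s. apply is_zseries_ext with (2 := Hs). intros n. unfold term2.
    rewrite !Cpowz_inv_l, <- !Cpowz_opp by assumption.
    replace (- (2 * n))%Z with (-2 * n)%Z by lia. reflexivity. }
  split; [exact H1|]. split; [exact H2|].
  apply ZSeries_correct in H1. apply ZSeries_correct in H2.
  rewrite Hval. f_equal. apply (is_zseries_uniq term); [exact Hterm|].
  (* Reflected, [term2 (- n)] is [x y q^(2n)] times [term1 n], so the difference restores the
     numerator [1 - x y q^(2n)]. *)
  apply is_zseries_ext with (2 := is_zseries_minus _ _ _ _ H1 (is_zseries_opp _ _ H2)).
  intros n. unfold term, term1, term2.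
  assert (Hn := Cpowz_neq_0 q n Hq0).
  assert (Dx := D1 x n Hpx). assert (Dy := D1 y n Hpy).
  replace (-2 * - n)%Z with (2 * n)%Z by lia. replace ((- n) ^ 2)%Z with (n ^ 2)%Z by lia.
  rewrite Cpowz_opp by exact Hq0.
  assert (E2 : q ^^ (2 * n) = q ^^ n * q ^^ n) by (rewrite <- Cpowz_add by exact Hq0; f_equal; lia).
  rewrite E2.
  replace ((1 - / x * / q ^^ n) * (1 - / y * / q ^^ n))
    with ((1 - x * q ^^ n) * (1 - y * q ^^ n) / (x * y * (q ^^ n * q ^^ n))) by (field; tauto).
  set (X := x ^^ (2 * n)). set (Y := y ^^ (2 * n)). set (t := q ^^ (2 * n ^ 2)).
  set (dx := 1 - x * q ^^ n) in *. set (dy := 1 - y * q ^^ n) in *. set (r := q ^^ n) in *.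
  field. tauto.
Qed.
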